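(* As a formal power series in $q$, the area generating function $PA^{(3)}(q)=\sum_{n\ge 1}PA^{(3)}_n q^n$ of 3-sided prudent polygons (where $PA^{(3)}_n$ is the number of 3-sided prudent polygons of area $n$) is $$PA^{(3)}(q)=\frac{-2q^3(1-q)^2}{(1-2q)^2}\sum_{m=1}^{\infty}\frac{(-1)^m q^{2m}}{(1-2q)^m(1-q-q^{m+1})}\prod_{k=1}^{m-1}\frac{1-q-q^k+q^{k+1}-q^{k+2}}{1-q-q^{k+1}}+\frac{2q(3-10q+9q^2-q^3)}{(1-2q)^2(1-q)}$$ $$=6q+10q^2+20q^3+42q^4+92q^5+204q^6+454q^7+1010q^8+2242q^9+4962q^{10}+\cdots$$
   Context: All walks are on the square lattice $\mathbb{Z}^2$, start at $(0,0)$ and take unit steps north, south, east, west. A walk $\omega$ is prudent if it is self-avoiding and never takes a step towards an already occupied site: if a step goes from $p$ to $p+d$ (with $d$ a unit direction vector), then none of the points $p+kd$, $k\ge1$, has been visited before that step. Let $\omega_i$ be the walk formed by the first $i$ steps and $b_i$ its bounding box (the smallest, possibly degenerate, lattice rectangle containing $\omega_i$). A prudent walk $\omega$ of length $N$ is 3-sided if for each $i=0,1,\dots,N$ the walk $\omega_i$ ends on the north, east or west side of $b_i$, with the additional convention that the walk never steps from the south-east corner of its current box (the box before the step) to its south-west corner, or vice versa, when this box has width one and non-zero height. (Equivalently, two types of steps are forbidden: when the box has non-zero width, a south step may not be followed by a west (resp. east) step when the walk is on the east (resp. west) side of the box.) A prudent polygon is a prudent walk, with more than one step, that ends at a lattice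 site adjacent to its starting point $(0,0)$; the polygon is the closed curve obtained by adding the edge joining the endpoint to $(0,0)$. Polygons are counted as walks, i.e. they are rooted at $(0,0)$ and oriented. The polygon is 3-sided if the underlying prudent walk is 3-sided. Its area is the number of unit cells enclosed. An empty product equals 1. *)

(* Defs.v *)
From HB Require Import structures.
From mathcomp Require Import all_boot all_order all_algebra.
From mathcomp Require Import finmap.
From mathcomp Require Import boolp classical_sets functions cardinality.
Set Implicit Arguments.
Unset Strict Implicit.
Unset Printing Implicit Defensive.
Import Order.TTheory GRing.Theory Num.Theory.
Local Open Scope ring_scope.

Record fps (R : Type) : Type := FPS { fcoef : nat -> R }.

HB.instance Definition _ (R : Type) := gen_eqMixin (fps R).
HB.instance Definition _ (R : Type) := gen_choiceMixin (fps R).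

Lemma fpsP (R : Type) (f g : fps R) : (forall n, fcoef f n = fcoef g n) -> f = g.
Proof. by case: f g => [f] [g] /= fg; congr FPS; apply/funext. Qed.

Section FpsZmod.
Variable R : zmodType.
Implicit Types f g h : fps R.

Definition fps_zero : fps R := FPS (fun=> 0).
Definition fps_opp f : fps R := FPS (fun n => - fcoef f n).
Definition fps_add f g : fps R := FPS (fun n => fcoef f n + fcoef g n).

Let addA : associative fps_add.
Proof. by move=> f g h; apply: fpsP => n /=; rewrite addrA. Qed.
Let addC : commutative fps_add.
Proof. by move=> f g; apply: fpsP => n /=; rewrite addrC. Qed.
Let add0 : left_id fps_zero fps_add.
Proof. by move=> f; apply: fpsP => n /=; rewrite add0r. Qed.
Let addN : left_inverse fps_zero fps_opp fps_add.
Proof. by move=> f; apply: fpsP => n /=; rewrite addNr. Qed.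

HB.instance Definition _ := GRing.isZmodule.Build (fps R) addA addC add0 addN.

Lemma fcoef0 n : fcoef (0 : fps R) n = 0. Proof. by []. Qed.
Lemma fcoefN f n : fcoef (- f) n = - fcoef f n. Proof. by []. Qed.
Lemma fcoefD f g n : fcoef (f + g) n = fcoef f n + fcoef g n. Proof. by []. Qed.

End FpsZmod.

Section FpsRing.
Variable R : comNzRingType.
Implicit Types f g h : fps R.

Definition fps_one : fps R := FPS (fun n => (n == 0%N)%:R).
Definition fps_mul f g : fps R :=
  FPS (fun n => \sum_(i < n.+1) fcoef f i * fcoef g (n - i)).

Definition fps_trunc n f : {poly R} := \poly_(i < n.+1) fcoef f i.

Lemma coef_fps_trunc n f k : (k <= n)%N -> (fps_trunc n f)`_k = fcoef f k.
Proof. by move=> kn; rewrite coef_poly ltnS kn. Qed.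

Lemma fcoef_mul_trunc n f g k : (k <= n)%N ->
  fcoef (fps_mul f g) k = (fps_trunc n f * fps_trunc n g)`_k.
Proof.
move=> kn; rewrite coefM /=; apply: eq_bigr => i _.
have le_ik : (i <= k)%N by rewrite -ltnS.
by rewrite !coef_fps_trunc ?(leq_trans le_ik) ?(leq_trans (leq_subr _ _)).
Qed.

Let mulC : commutative fps_mul.
Proof. by move=> f g; apply: fpsP => n; rewrite !(@fcoef_mul_trunc n) // mulrC. Qed.

Let mulA : associative fps_mul.
Proof.
move=> f g h; apply: fpsP => n.
transitivity ((fps_trunc n f * fps_trunc n g * fps_trunc n h)`_n).
  rewrite -mulrA coefM; apply: eq_bigr => i _.
  have le_in : (i <= n)%N by rewrite -ltnS.
  by rewrite coef_fps_trunc // -fcoef_mul_trunc ?leq_subr.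
rewrite coefM; apply: eq_bigr => i _.
have le_in : (i <= n)%N by rewrite -ltnS.
by rewrite (coef_fps_trunc _ (leq_subr _ _)) -fcoef_mul_trunc.
Qed.

Let mul1 : left_id fps_one fps_mul.
Proof.
move=> f; apply: fpsP => n /=; rewrite big_ord_recl /= mul1r subn0 big1 ?addr0 //.
by move=> i _; rewrite mul0r.
Qed.

Let mulDl : left_distributive fps_mul (@fps_add R).
Proof.
move=> f g h; apply: fpsP => n /=; rewrite -big_split /=.
by apply: eq_bigr => i _; rewrite mulrDl.
Qed.

Let one_neq0 : fps_one != 0.
Proof.
apply/eqP => /(congr1 (fun f => fcoef f 0)) /eqP.
by rewrite fcoef0 /= oner_eq0.
Qed.

HB.instance Definition _ :=
  GRing.Zmodule_isComNzRing.Build (fps R) mulA mulC mul1 mulDl one_neq0.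

Lemma fcoef1 n : fcoef (1 : fps R) n = (n == 0%N)%:R. Proof. by []. Qed.
Lemma fcoefM f g n :
  fcoef (f * g) n = \sum_(i < n.+1) fcoef f i * fcoef g (n - i).
Proof. by []. Qed.

Definition fpsX : fps R := FPS (fun n => (n == 1%N)%:R).

(* The family (F m) for m >= a is summable, with sum S, in the topology of
   coefficientwise stabilisation. *)
Definition fps_has_sum (a : nat) (F : nat -> fps R) (S : fps R) : Prop :=
  forall n, exists M, forall N, (M <= N)%N ->
    fcoef (\sum_(a <= m < N) F m) n = fcoef S n.

End FpsRing.

Arguments fpsX {R}.

Section FpsUnitRing.
Variable R : comUnitRingType.
Implicit Types f g : fps R.

Fixpoint fps_inv_seq f (n : nat) : seq R :=
  if n is m.+1 then
    let s := fps_inv_seq f m in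
    rcons s ((fcoef f 0)^-1 *
             ((m == 0%N)%:R - \sum_(i < m) s`_i * fcoef f (m - i)))
  else [::].

Definition fps_unit : pred (fps R) := fun f => fcoef f 0 \is a GRing.unit.

(* Following the MathComp convention, a non-invertible series is its own
   inverse. *)
Definition fps_inv f : fps R :=
  if fps_unit f then FPS (fun n => (fps_inv_seq f n.+1)`_n) else f.

Lemma size_fps_inv_seq f n : size (fps_inv_seq f n) = n.
Proof. by elim: n => //= n IHn; rewrite size_rcons IHn. Qed.

Lemma nth_fps_inv_seq f n i : (i < n)%N ->
  (fps_inv_seq f n)`_i = (fps_inv_seq f i.+1)`_i.
Proof.
elim: n => // n IHn; rewrite ltnS leq_eqVlt => /orP[/eqP-> //|lt_in].
by rewrite -IHn // [fps_inv_seq f n.+1]/= nth_rcons size_fps_inv_seq lt_in.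
Qed.

Let mulV : {in fps_unit, left_inverse 1 fps_inv *%R}.
Proof.
move=> f uf; have {}uf : fps_unit f by []; apply: fpsP => n.
rewrite fcoefM big_ord_recr /= subnn /fps_inv uf.
rewrite [X in _ + X * _]/= nth_rcons size_fps_inv_seq ltnn eqxx.
rewrite mulrAC mulVr // mul1r addrC [X in _ - X](_ : _ =
  \sum_(i < n) fcoef (FPS (fun n => (fps_inv_seq f n.+1)`_n)) i *
    fcoef f (n - i)) ?subrK //.
by apply: eq_bigr => i _; rewrite nth_fps_inv_seq.
Qed.

Let unitPl f g : g * f = 1 -> fps_unit f.
Proof.
move=> /(congr1 (fun f => fcoef f 0)); rewrite fcoefM big_ord1 subn0 => gf1.
by apply/unitrP; exists (fcoef g 0); split; rewrite // mulrC.
Qed.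

Let inv_out : {in [predC fps_unit], fps_inv =1 id}.
Proof. by move=> f nuf; rewrite /fps_inv; case: ifP => // uf; case/negP: nuf. Qed.

HB.instance Definition _ :=
  GRing.ComNzRing_hasMulInverse.Build (fps R) mulV unitPl inv_out.

Lemma fps_unitE f : (f \is a GRing.unit) = (fcoef f 0 \is a GRing.unit).
Proof. by []. Qed.

End FpsUnitRing.

Definition site : Type := (int * int)%type.

Definition directions : seq site :=
  [:: (0, 1); (0, -1); (1, 0); (-1, 0)].

Definition adjacent : rel site := fun p q => q - p \in directions.

(* A walk is the list of the sites it visits after its starting point, which is
   always (0, 0).  Thus [size w] is the number of steps, [last 0 w] the
   endpoint, [visited w] the list of all sites, and [take i w] the walk formed
   by the first [i] steps. *)
Definition walk : Type := seq site.

Definition is_walk (w : walk) : bool := path adjacent 0 w.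

Definition visited (w : walk) : seq site := 0 :: w.

(* [nth 0 w i] is the site reached by step number [i.+1]. *)
Definition prudent (w : walk) : Prop :=
  [/\ is_walk w, uniq (visited w) &
      forall i k : nat, (i < size w)%N -> (1 <= k)%N ->
        let p := last 0 (take i w) in
        let d := nth 0 w i - p in
        p + d *+ k \notin visited (take i w)].

(* Since (0, 0) is visited, 0 is a neutral initial value for the extrema. *)
Definition box_east  (w : walk) : int := \big[Num.max/0]_(p <- visited w) p.1.
Definition box_west  (w : walk) : int := \big[Num.min/0]_(p <- visited w) p.1.
Definition box_north (w : walk) : int := \big[Num.max/0]_(p <- visited w) p.2.
Definition box_south (w : walk) : int := \big[Num.min/0]_(p <- visited w) p.2.

Definition box_SE (w : walk) : site := (box_east w, box_south w).
Definition box_SW (w : walk) : site := (box_west w, box_south w).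

Definition ends_on_NEW_side (w : walk) : bool :=
  [|| (last 0 w).2 == box_north w,
      (last 0 w).1 == box_east w |
      (last 0 w).1 == box_west w].

(* Moving from [last 0 w] to [q] is a forbidden step along the south side of
   the box of [w]. *)
Definition forbidden_step (w : walk) (q : site) : bool :=
  [&& box_east w - box_west w == 1, box_south w < box_north w &
      ((last 0 w == box_SE w) && (q == box_SW w)) ||
      ((last 0 w == box_SW w) && (q == box_SE w))].

Definition three_sided (w : walk) : Prop :=
  (forall i : nat, (i <= size w)%N -> ends_on_NEW_side (take i w)) /\
  (forall i : nat, (i < size w)%N -> ~~ forbidden_step (take i w) (nth 0 w i)).

Definition prudent_polygon (w : walk) : Prop :=
  [/\ prudent w, (1 < size w)%N & adjacent (last 0 w) 0].

(* The unit edge {p, q} belongs to the closed curve obtained by joining the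
   endpoint of the walk to (0, 0). *)
Definition polygon_edge (w : walk) (p q : site) : bool :=
  let edges := zip (visited w) (rcons w 0) in
  ((p, q) \in edges) || ((q, p) \in edges).

(* The unit cell [x, x+1] x [y, y+1] is represented by its south-west corner
   (x, y).  Two cells are linked when they share a side that is not an edge of
   the polygon. *)
Definition cell_link (w : walk) : rel site := fun c c' =>
  [|| (c' == c + (1, 0)) && ~~ polygon_edge w (c + (1, 0)) (c + (1, 1)),
      (c' == c - (1, 0)) && ~~ polygon_edge w c (c + (0, 1)),
      (c' == c + (0, 1)) && ~~ polygon_edge w (c + (0, 1)) (c + (1, 1)) |
      (c' == c - (0, 1)) && ~~ polygon_edge w c (c + (1, 0))].

Definition cell_component (w : walk) (c : site) : set site :=
  [set c' | exists2 s, path (cell_link w) c s & c' = last c s]%classic.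

(* The interior is the union of the bounded components of the complement. *)
Definition enclosed_cells (w : walk) : set site :=
  [set c | finite_set (cell_component w c)]%classic.

Definition has_area (w : walk) (n : nat) : Prop :=
  (enclosed_cells w #= `I_n)%card.

Definition polygons3 (n : nat) : set walk :=
  [set w | [/\ prudent_polygon w, three_sided w & has_area w n]]%classic.

(* [fset_set A] is junk (empty) when [A] is infinite. *)
Definition PA3 (n : nat) : nat := #|` fset_set (polygons3 n)|%fset.

Definition PA3_gf : fps int :=
  FPS (fun n => if (1 <= n)%N then (PA3 n)%:Z else 0).

(* Main.v *)
(** The area of a self-avoiding lattice polygon is the absolute value of its
    shoelace sum: drawing the polygon one edge at a time, the complement stays
    connected until the last edge, so it has at most two components, on which the
    winding number is constant, and the winding number jumps by one across the
    last edge.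

    Up to the reflection [x -> - x], a 3-sided prudent polygon starts with a walk
    confined to [x >= 0], and such a walk is determined by the steps that enlarge its
    box to the east (recorded with their depth below the top of the box) or to the
    north (recorded with their column).  The confined part is followed by a forced
    closing path, and the area becomes a sum of nonnegative contributions of the
    recorded steps.  Let [F_R] and [X_R] count by area the codes with [R] columns
    that end with a north step, respectively do not.  Then
    [X_(R+1) = X_R / (1 - q) + F_R] and
    [F_R = q^(R+1) X_R + (q + ... + q^(R+1)) F_R], so that
    [W(u) = \sum_R u^R F_R] satisfies a linear equation relating [W(u)] and
    [W(q u)]; iterating it from [u = 1] gives the series. *)

Require Import Defs.
From mathcomp Require Import all_boot all_order all_algebra.
From mathcomp Require Import finmap.
From mathcomp Require Import boolp classical_sets functions cardinality.
From mathcomp Require Import zify.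
From mathcomp Require Import ring.
Set Implicit Arguments.
Unset Strict Implicit.
Unset Printing Implicit Defensive.
Import Order.TTheory GRing.Theory Num.Theory.
Local Open Scope ring_scope.

(** * Connectedness of the complement of a self-avoiding walk *)

(** Up to reflection a polygon can close in three ways, and only one of them carries the recursion.
    Closing down column -1 allows every code whose latest symbol is a north step; closing along row
    1 gives the compositions of the area, with series q/(1-2q); closing from below gives one thin
    rectangle for each area, with series q/(1-q). Reflection accounts for the overall factor 2.

    In the iteration the index m = 0 is special: there 1-q-q^(m+1) is 1-2q and the numerator of the
    product is -q^2. Treating this step separately leaves the series from m = 1 on and produces its
    prefactor.

    The two families behave differently at u = 1. X_R has constant term 1, since east steps at depth
    0 cost nothing, so among the powers u = q^m the sum of u^R X_R converges only for m >= 1,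
    whereas F_R is divisible by q^(R+1). The recurrences pair W(q^m) with the other series at
    q^(m+1), so the divergent value is never met. *)

Fixpoint edges (p : site) (w : seq site) : seq (site * site) :=
  if w is q :: w' then (p, q) :: edges q w' else [::].

Lemma edges_rcons p w q :
  edges p (rcons w q) = rcons (edges p w) (last p w, q).
Proof. by elim: w p => //= a w IHw p; rewrite IHw. Qed.

Lemma zip_edges p w q : zip (p :: w) (rcons w q) = edges p (rcons w q).
Proof. by elim: w p => //= a w IHw p; rewrite -IHw. Qed.

Lemma mem_edges p w e : e \in edges p w -> (e.1 \in p :: w) && (e.2 \in w).
Proof.
elim: w p => //= a w IHw p; rewrite !inE => /predU1P[-> /=|/IHw].
  by rewrite !eqxx.
by case/andP; rewrite inE => -> ->; rewrite !orbT.
Qed.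

Definition on_edge (es : seq (site * site)) (p q : site) : bool :=
  ((p, q) \in es) || ((q, p) \in es).

Lemma on_edgeC es p q : on_edge es p q = on_edge es q p.
Proof. exact: orbC. Qed.

Lemma on_edge_rcons es e p q :
  on_edge (rcons es e) p q = [|| (p, q) == e, (q, p) == e | on_edge es p q].
Proof. by rewrite /on_edge !mem_rcons !inE orbACA -orbA. Qed.

(** [cell_link] with the list of edges as a parameter, so that the curve can be drawn one edge at a
    time. *)
Definition link (es : seq (site * site)) : rel site := fun c c' =>
  [|| (c' == c + (1, 0)) && ~~ on_edge es (c + (1, 0)) (c + (1, 1)),
      (c' == c - (1, 0)) && ~~ on_edge es c (c + (0, 1)),
      (c' == c + (0, 1)) && ~~ on_edge es (c + (0, 1)) (c + (1, 1)) |
      (c' == c - (0, 1)) && ~~ on_edge es c (c + (1, 0))].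

Lemma cell_linkE w : cell_link w = link (edges 0 (rcons w 0)).
Proof. by rewrite /cell_link /polygon_edge -zip_edges. Qed.

Lemma siteE (a b c d : int) : ((a, b) == (c, d)) = (a == c) && (b == d).
Proof. by []. Qed.

Lemma siteD (a b c d : int) : (a, b) + (c, d) = (a + c, b + d) :> site.
Proof. by []. Qed.

Lemma siteB (a b c d : int) : (a, b) - (c, d) = (a - c, b - d) :> site.
Proof. by []. Qed.

(** Differences are moved to the other cell, so that exchanging [c] and [c'] swaps the cases in
    pairs and symmetry becomes immediate. *)
Lemma linkP es (c c' : site) :
  reflect
    [\/ c'.1 = c.1 + 1 /\ c'.2 = c.2 /\
          on_edge es (c'.1, c.2) (c'.1, c.2 + 1) = false,
        c.1 = c'.1 + 1 /\ c'.2 = c.2 /\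
          on_edge es (c.1, c'.2) (c.1, c'.2 + 1) = false,
        c'.2 = c.2 + 1 /\ c'.1 = c.1 /\
          on_edge es (c.1, c'.2) (c.1 + 1, c'.2) = false |
        c.2 = c'.2 + 1 /\ c'.1 = c.1 /\
          on_edge es (c'.1, c.2) (c'.1 + 1, c.2) = false]
    (link es c c').
Proof.
case: c c' => [x y] [x' y']; rewrite /link !siteB !siteD !siteE !addr0 /=.
apply: (iffP or4P) => -[].
- by move=> /andP[/andP[/eqP-> /eqP->] /negbTE e]; constructor 1.
- move=> /andP[/andP[/eqP-> /eqP->] /negbTE e]; constructor 2.
  by rewrite subrK.
- by move=> /andP[/andP[/eqP-> /eqP->] /negbTE e]; constructor 3.
- move=> /andP[/andP[/eqP-> /eqP->] /negbTE e]; constructor 4.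
  by rewrite subrK.
- by move=> [-> [-> e]]; constructor 1; rewrite !eqxx e.
- by move=> [-> [-> e]]; constructor 2; rewrite !addrK !eqxx e.
- by move=> [-> [-> e]]; constructor 3; rewrite !eqxx e.
- by move=> [-> [-> e]]; constructor 4; rewrite !addrK !eqxx e.
Qed.

Lemma link_sym es : symmetric (link es).
Proof.
move=> c c'; apply/linkP/linkP => -[] [-> [-> h]];
  by [constructor 1 | constructor 2 | constructor 3 | constructor 4].
Qed.

Definition conn es (c c' : site) : Prop :=
  exists2 s, path (link es) c s & c' = last c s.

Lemma conn_refl es c : conn es c c. Proof. by exists [::]. Qed.

Lemma conn_trans es c1 c2 c3 : conn es c1 c2 -> conn es c2 c3 -> conn es c1 c3.
Proof.
move=> [s1 p1 ->] [s2 p2 ->]; exists (s1 ++ s2); rewrite ?last_cat //.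
by rewrite cat_path p1.
Qed.

Lemma conn_link es c c' : link es c c' -> conn es c c'.
Proof. by move=> l; exists [:: c'] => //=; rewrite l. Qed.

Lemma conn_sym es c c' : conn es c c' -> conn es c' c.
Proof.
move=> [s]; elim: s c => [|a s IHs] c /=; first by move=> _ ->; apply: conn_refl.
case/andP=> l /IHs h /h {h} h; apply: conn_trans h _.
by apply: conn_link; rewrite link_sym.
Qed.

Lemma conn_sub es es' :
  (forall c c', link es c c' -> conn es' c c') ->
  forall c c', conn es c c' -> conn es' c c'.
Proof.
move=> h c c' [s]; elim: s c => [|a s IHs] c /=.
  by move=> _ ->; apply: conn_refl.
by case/andP=> /h l /IHs h' /h'; apply: conn_trans.
Qed.

Lemma conn_nil c c' : conn [::] c c'.
Proof.
have hE (x y : int) n : conn [::] (x, y) (x + Posz n, y).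
  elim: n => [|n IHn]; first by rewrite addr0; apply: conn_refl.
  apply: conn_trans IHn _; apply: conn_link; apply/linkP; constructor 1 => /=.
  by split; [lia|].
have hN (x y : int) n : conn [::] (x, y) (x, y + Posz n).
  elim: n => [|n IHn]; first by rewrite addr0; apply: conn_refl.
  apply: conn_trans IHn _; apply: conn_link; apply/linkP; constructor 3 => /=.
  by split; [lia|].
case: c c' => [x y] [x' y'].
apply: (@conn_trans _ _ (x', y)).
  have [h|h] := leP x x'.
    by have -> : x' = x + Posz `|x' - x|%N by lia.
  by apply: conn_sym; have {1}-> : x = x' + Posz `|x - x'|%N by lia.
have [h|h] := leP y y'.
  by have -> : y' = y + Posz `|y' - y|%N by lia.
by apply: conn_sym; have {1}-> : y = y' + Posz `|y - y'|%N by lia.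
Qed.

(* Only one of the four edges around the fresh endpoint [q] is blocked, so the
   two cells it separates stay connected the other way round [q]. *)
Lemma conn_fresh es p q :
  (forall a, on_edge es a q = false) -> p != q ->
  forall c c', link es c c' -> conn (rcons es (p, q)) c c'.
Proof.
move=> fresh npq.
have eq_p a : on_edge (rcons es (p, q)) a q = (a == p).
  rewrite on_edge_rcons fresh orbF xpair_eqE eqxx andbT xpair_eqE.
  by rewrite [q == p]eq_sym (negbTE npq) orbF.
have eq_p' a : on_edge (rcons es (p, q)) q a = (a == p).
  by rewrite on_edgeC eq_p.
(* By symmetry only links to the east and to the north need a detour. *)
suff main c c' : c'.1 = c.1 + 1 /\ c'.2 = c.2 /\
          on_edge es (c'.1, c.2) (c'.1, c.2 + 1) = false \/
        c'.2 = c.2 + 1 /\ c'.1 = c.1 /\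
          on_edge es (c.1, c'.2) (c.1 + 1, c'.2) = false ->
    conn (rcons es (p, q)) c c'.
  move=> c c' /linkP[] h.
  - by apply: main; left.
  - by apply: conn_sym; apply: main; left; case: h => -> [-> ->].
  - by apply: main; right.
  - by apply: conn_sym; apply: main; right; case: h => -> [-> ->].
case: c c' => [x y] [x' y'] /= [] [-> [-> h]] {x' y'}.
- have [e|ne] := boolP (on_edge (rcons es (p, q)) (x + 1, y) (x + 1, y + 1));
    last by apply: conn_link; apply/linkP; constructor 1; rewrite (negbTE ne).
  move: e; rewrite on_edge_rcons h orbF => /orP[] /eqP[ep eq].
  + apply: (@conn_trans _ _ (x, y + 1)).
      apply: conn_link; apply/linkP; constructor 3 => /=.
      by rewrite eq eq_p -ep siteE; lia.
    apply: (@conn_trans _ _ (x + 1, y + 1)).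
      apply: conn_link; apply/linkP; constructor 1 => /=.
      by rewrite eq eq_p' -ep siteE; lia.
    apply: conn_link; apply/linkP; constructor 4 => /=.
    by rewrite eq eq_p' -ep siteE; lia.
  + apply: (@conn_trans _ _ (x, y - 1)).
      apply: conn_link; apply/linkP; constructor 4 => /=.
      by rewrite eq eq_p -ep siteE; lia.
    apply: (@conn_trans _ _ (x + 1, y - 1)).
      apply: conn_link; apply/linkP; constructor 1 => /=.
      by rewrite subrK eq eq_p -ep siteE; lia.
    apply: conn_link; apply/linkP; constructor 3 => /=.
    by rewrite eq eq_p' -ep siteE; lia.
- have [e|ne] := boolP (on_edge (rcons es (p, q)) (x, y + 1) (x + 1, y + 1));
    last by apply: conn_link; apply/linkP; constructor 3; rewrite (negbTE ne).
  move: e; rewrite on_edge_rcons h orbF => /orP[] /eqP[ep eq].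
  + apply: (@conn_trans _ _ (x + 1, y)).
      apply: conn_link; apply/linkP; constructor 1 => /=.
      by rewrite eq eq_p -ep siteE; lia.
    apply: (@conn_trans _ _ (x + 1, y + 1)).
      apply: conn_link; apply/linkP; constructor 3 => /=.
      by rewrite eq eq_p' -ep siteE; lia.
    apply: conn_link; apply/linkP; constructor 2 => /=.
    by rewrite eq eq_p' -ep siteE; lia.
  + apply: (@conn_trans _ _ (x - 1, y)).
      apply: conn_link; apply/linkP; constructor 2 => /=.
      by rewrite eq eq_p -ep siteE; lia.
    apply: (@conn_trans _ _ (x - 1, y + 1)).
      apply: conn_link; apply/linkP; constructor 3 => /=.
      by rewrite subrK eq eq_p -ep siteE; lia.
    apply: conn_link; apply/linkP; constructor 1 => /=.
    by rewrite eq eq_p' -ep siteE; lia.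
Qed.

(** The walk is drawn step by step: self-avoidance makes each new endpoint fresh, as [conn_fresh]
    requires. *)
Lemma conn_walk w : uniq (visited w) -> forall c c', conn (edges 0 w) c c'.
Proof.
elim/last_ind: w => [|w q IHw]; first by move=> _; apply: conn_nil.
rewrite /visited -rcons_cons rcons_uniq => /andP[nq uw] c c'.
rewrite edges_rcons; apply: conn_sub (IHw uw c c').
apply: conn_fresh => [a|].
  apply/negP => /orP[] /mem_edges /=; rewrite -/(visited w) => /andP[].
    by rewrite inE in nq => _ h; rewrite h orbT in nq.
  by move=> h; rewrite h in nq.
by apply: contraNneq nq => <-; rewrite mem_last.
Qed.

(** * Winding numbers *)

Lemma adjacentP (p q : site) :
  reflect [\/ q = (p.1, p.2 + 1), q = (p.1, p.2 - 1), q = (p.1 + 1, p.2) |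
              q = (p.1 - 1, p.2)]
    (adjacent p q).
Proof.
case: p q => [x y] [x' y'].
rewrite /adjacent /directions siteB !inE !siteE /=.
apply: (iffP or4P) => -[].
- by move=> h; constructor 1; congr pair; lia.
- by move=> h; constructor 2; congr pair; lia.
- by move=> h; constructor 3; congr pair; lia.
- by move=> h; constructor 4; congr pair; lia.
- by move=> [-> ->]; constructor 1; lia.
- by move=> [-> ->]; constructor 2; lia.
- by move=> [-> ->]; constructor 3; lia.
- by move=> [-> ->]; constructor 4; lia.
Qed.

Definition wind1 (c : site) (e : site * site) : int :=
  Posz [&& e.1.1 == e.2.1, c.1 < e.1.1, e.1.2 == c.2 & e.2.2 == c.2 + 1]%R
  - Posz [&& e.1.1 == e.2.1, c.1 < e.1.1, e.2.2 == c.2 & e.1.2 == c.2 + 1]%R.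

(* The winding number of a closed walk around the cell [c]: the signed number
   of crossings of the eastward ray issued from [c]. *)
Definition wind es c : int := \sum_(e <- es) wind1 c e.

Lemma wind1_up c a b :
  wind1 c ((a, b), (a, b + 1)) = Posz ((c.1 < a) && (b == c.2))%R.
Proof.
rewrite /wind1 /= eqxx /=; have -> : (b + 1 == c.2 + 1) = (b == c.2) by lia.
have -> : (b + 1 == c.2) && (b == c.2 + 1) = false by lia.
by rewrite andbF subr0 andbb.
Qed.

Lemma wind1_down c a b :
  wind1 c ((a, b), (a, b - 1)) = - Posz ((c.1 < a) && (b == c.2 + 1))%R.
Proof.
rewrite /wind1 /= eqxx /=; have -> : (b - 1 == c.2) = (b == c.2 + 1) by lia.
have -> : (b == c.2) && (b - 1 == c.2 + 1) = false by lia.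
by rewrite andbF sub0r andbb.
Qed.

Lemma wind1_down' c a b :
  wind1 c ((a, b + 1), (a, b)) = - Posz ((c.1 < a) && (b == c.2))%R.
Proof.
rewrite -{2}[b](addrK 1) wind1_down; congr (- Posz _); congr nat_of_bool.
by congr (_ && _); lia.
Qed.

Lemma wind1_horiz c p q : p.1 != q.1 -> wind1 c (p, q) = 0.
Proof. by rewrite /wind1 /= => /negbTE->. Qed.

Lemma wind1_east x y e : adjacent e.1 e.2 ->
  [|| ((x + 1, y), (x + 1, y + 1)) == e | ((x + 1, y + 1), (x + 1, y)) == e]
    = false ->
  wind1 (x, y) e = wind1 (x + 1, y) e.
Proof.
case: e => [[a b] [c d]] /adjacentP /= [] [-> ->].
- rewrite !wind1_up /= !xpair_eqE => h; congr Posz; congr nat_of_bool; lia.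
- rewrite !wind1_down /= !xpair_eqE => h.
  congr (- Posz _); congr nat_of_bool; lia.
- by rewrite !wind1_horiz //=; lia.
- by rewrite !wind1_horiz //=; lia.
Qed.

Definition right_of (x y : int) (p : site) : int := Posz ((x < p.1) && (p.2 == y))%R.

(** The ray is moved up across the lattice row [y + 1], and an edge changes its contribution only
    through its endpoints on that row. The right-hand side is a difference of one function at the
    two ends, so along a walk it telescopes, and along a closed walk it vanishes. *)
Lemma wind1_north x y e : adjacent e.1 e.2 ->
  [|| ((x, y + 1), (x + 1, y + 1)) == e | ((x + 1, y + 1), (x, y + 1)) == e]
    = false ->
  wind1 (x, y + 1) e - wind1 (x, y) e = right_of x (y + 1) e.1 - right_of x (y + 1) e.2.
Proof.
case: e => [[a b] [c d]] /adjacentP /= [] [-> ->].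
- by rewrite !wind1_up /right_of /= => _; case: (x < a)%R => //=; lia.
- by rewrite !wind1_down /right_of /= => _; case: (x < a)%R => //=; lia.
- rewrite !wind1_horiz /= ?xpair_eqE ?/right_of /=; try lia.
- rewrite !wind1_horiz /= ?xpair_eqE ?/right_of /=; try lia.
Qed.

Definition is_edge_seq es := all (fun e : site * site => adjacent e.1 e.2) es.

Lemma is_edge_seqP p w : path adjacent p w = is_edge_seq (edges p w).
Proof. by elim: w p => //= a w IHw p; rewrite IHw. Qed.

Lemma wind_rcons es e c : wind (rcons es e) c = wind es c + wind1 c e.
Proof. by rewrite /wind big_rcons. Qed.

Lemma wind_east x y es : is_edge_seq es ->
  on_edge es (x + 1, y) (x + 1, y + 1) = false ->
  wind es (x, y) = wind es (x + 1, y).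
Proof.
move=> /allP aes /negbT /norP[n1 n2]; apply: eq_big_seq => e es_e.
apply: wind1_east; first exact: aes.
by apply/norP; split; apply/eqP => e_es; move: es_e; rewrite -e_es ?(negbTE n1) ?(negbTE n2).
Qed.

Lemma edges_telescope (h : site -> int) p w :
  \sum_(e <- edges p w) (h e.1 - h e.2) = h p - h (last p w).
Proof.
elim: w p => [|a w IHw] p /=; first by rewrite big_nil subrr.
by rewrite big_cons IHw /= addrA subrK.
Qed.

Lemma wind_north x y p w : path adjacent p w ->
  on_edge (edges p w) (x, y + 1) (x + 1, y + 1) = false ->
  wind (edges p w) (x, y + 1) - wind (edges p w) (x, y)
  = right_of x (y + 1) p - right_of x (y + 1) (last p w).
Proof.
rewrite is_edge_seqP => /allP aes /negbT /norP[n1 n2].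
rewrite -(edges_telescope (right_of x (y + 1))) /wind -sumrB.
apply: eq_big_seq => e es_e; apply: wind1_north; first exact: aes.
by apply/norP; split; apply/eqP => e_es; move: es_e; rewrite -e_es ?(negbTE n1) ?(negbTE n2).
Qed.

Lemma wind_link p w c c' : path adjacent p w -> last p w = p ->
  link (edges p w) c c' -> wind (edges p w) c = wind (edges p w) c'.
Proof.
move=> pw lw /linkP; have es : is_edge_seq (edges p w) by rewrite -is_edge_seqP.
case: c c' => [x y] [x' y'] /= [] [-> [-> h]].
- exact: wind_east.
- by rewrite -wind_east.
- by apply/esym/eqP; rewrite -subr_eq0 wind_north // lw subrr.
- by apply/eqP; rewrite -subr_eq0 wind_north // lw subrr.
Qed.

Lemma wind_conn p w c c' : path adjacent p w -> last p w = p ->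
  conn (edges p w) c c' -> wind (edges p w) c = wind (edges p w) c'.
Proof.
move=> pw lw [s]; elim: s c => [|a s IHs] c /=; first by move=> _ ->.
by case/andP=> /(wind_link pw lw) -> /IHs.
Qed.

(** The path is cut at its first use of a link destroyed by [e]: until then it survives, and there
    it stands at [L] or at [R]. *)
Lemma conn_closing es e (L R : site) :
  (forall c c', link es c c' ->
     [\/ link (rcons es e) c c', c = L /\ c' = R | c = R /\ c' = L]) ->
  forall c, conn es c L -> conn (rcons es e) c L \/ conn (rcons es e) c R.
Proof.
move=> cut c [s]; elim: s c => [|a s IHs] c /=.
  by move=> _ <-; left; apply: conn_refl.
case/andP=> /cut l /IHs h /h {h} h.
case: l => [/conn_link l|[-> _]|[-> _]]; last 2 first.
- by left; apply: conn_refl.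
- by right; apply: conn_refl.
by case: h => h; [left|right]; apply: conn_trans l h.
Qed.

Lemma link_cut_vert es x y e c c' :
  e = ((x + 1, y), (x + 1, y + 1)) \/ e = ((x + 1, y + 1), (x + 1, y)) ->
  link es c c' ->
  [\/ link (rcons es e) c c', c = (x, y) /\ c' = (x + 1, y) |
      c = (x + 1, y) /\ c' = (x, y)].
Proof.
move=> e_def l; case nl : (link (rcons es e) c c'); first by constructor 1.
move/negbT/linkP: nl => nl; case/linkP: l; case: c c' nl => [a b] [a' b'] nl /=;
  move=> [? [? h]]; subst.
- constructor 2.
  have [e1|e1] := boolP (on_edge (rcons es e) (a + 1, b) (a + 1, b + 1)); last first.
    by case: nl; constructor 1; rewrite (negbTE e1).
  by move: e1; rewrite on_edge_rcons h; case: e_def => ->; rewrite !xpair_eqE => e1;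
    split; congr pair; lia.
- constructor 3.
  have [e1|e1] := boolP (on_edge (rcons es e) (a' + 1, b) (a' + 1, b + 1)); last first.
    by case: nl; constructor 2; rewrite (negbTE e1).
  by move: e1; rewrite on_edge_rcons h; case: e_def => ->; rewrite !xpair_eqE => e1;
    split; congr pair; lia.
- case: nl; constructor 3; rewrite on_edge_rcons h /=; split=> //; split=> //.
  by case: e_def => ->; rewrite !xpair_eqE; lia.
- case: nl; constructor 4; rewrite on_edge_rcons h /=; split=> //; split=> //.
  by case: e_def => ->; rewrite !xpair_eqE; lia.
Qed.

Lemma link_cut_horiz es x y e c c' :
  e = ((x, y + 1), (x + 1, y + 1)) \/ e = ((x + 1, y + 1), (x, y + 1)) ->
  link es c c' ->
  [\/ link (rcons es e) c c', c = (x, y) /\ c' = (x, y + 1) |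
      c = (x, y + 1) /\ c' = (x, y)].
Proof.
move=> e_def l; case nl : (link (rcons es e) c c'); first by constructor 1.
move/negbT/linkP: nl => nl; case/linkP: l; case: c c' nl => [a b] [a' b'] nl /=;
  move=> [? [? h]]; subst.
- case: nl; constructor 1; rewrite on_edge_rcons h /=; split=> //; split=> //.
  by case: e_def => ->; rewrite !xpair_eqE; lia.
- case: nl; constructor 2; rewrite on_edge_rcons h /=; split=> //; split=> //.
  by case: e_def => ->; rewrite !xpair_eqE; lia.
- constructor 2.
  have [e1|e1] := boolP (on_edge (rcons es e) (a, b + 1) (a + 1, b + 1)); last first.
    by case: nl; constructor 3; rewrite (negbTE e1).
  by move: e1; rewrite on_edge_rcons h; case: e_def => ->; rewrite !xpair_eqE => e1;
    split; congr pair; lia.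
- constructor 3.
  have [e1|e1] := boolP (on_edge (rcons es e) (a, b' + 1) (a + 1, b' + 1)); last first.
    by case: nl; constructor 4; rewrite (negbTE e1).
  by move: e1; rewrite on_edge_rcons h; case: e_def => ->; rewrite !xpair_eqE => e1;
    split; congr pair; lia.
Qed.

(** * Area of a self-avoiding polygon *)

Definition bounded_site (M : nat) (p : site) : bool :=
  ((- M%:Z <= p.1 <= M%:Z) && (- M%:Z <= p.2 <= M%:Z))%R.

Lemma exists_bound (s : seq site) : exists M, all (bounded_site M) s.
Proof.
elim: s => [|p s [M /allP hM]]; first by exists 0%N.
exists (M + `|p.1| + `|p.2|)%N; apply/allP => q; rewrite inE /bounded_site.
by case/predU1P=> [->|/hM]; rewrite /bounded_site; lia.
Qed.

Definition bounded_edges M es :=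
  all (fun e : site * site => bounded_site M e.1 && bounded_site M e.2) es.

Lemma edges_bounded M p w : all (bounded_site M) (p :: w) ->
  bounded_edges M (edges p w).
Proof.
elim: w p => //= a w IHw p /and3P[hp ha hw].
by rewrite hp ha IHw //= ha.
Qed.

Lemma wind1_out M c e : adjacent e.1 e.2 ->
  bounded_site M e.1 && bounded_site M e.2 ->
  (- M%:Z <= c.1)%R -> ~~ ((c.1 < M%:Z) && (- M%:Z <= c.2 < M%:Z))%R ->
  wind1 c e = 0.
Proof.
case: e => [[a b] [a' b']] /adjacentP /= [] [-> ->];
  rewrite /bounded_site /= => hb h1 h2.
- by rewrite wind1_up; lia.
- by rewrite wind1_down; lia.
- by rewrite wind1_horiz //=; lia.
- by rewrite wind1_horiz //=; lia.
Qed.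

Lemma wind1_west M c e : adjacent e.1 e.2 ->
  bounded_site M e.1 && bounded_site M e.2 -> (c.1 < - M%:Z)%R ->
  wind1 c e = - (Posz (e.1.2 > c.2)%R - Posz (e.2.2 > c.2)%R).
Proof.
case: e => [[a b] [a' b']] /adjacentP /= [] [-> ->];
  rewrite /bounded_site /= => hb h1.
- by rewrite wind1_up; lia.
- by rewrite wind1_down; lia.
- by rewrite wind1_horiz //=; lia.
- by rewrite wind1_horiz //=; lia.
Qed.

(** West of the box the ray may meet many edges, but the signed crossings telescope along the closed
    walk; elsewhere outside the box it meets none. *)
Lemma wind_out M p w c : path adjacent p w -> last p w = p ->
  bounded_edges M (edges p w) ->
  ~~ ((- M%:Z <= c.1 < M%:Z) && (- M%:Z <= c.2 < M%:Z))%R ->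
  wind (edges p w) c = 0.
Proof.
rewrite is_edge_seqP => /allP adj lw /allP bd out.
have [c1|c1] := leP (- M%:Z) c.1; last first.
  rewrite /wind (eq_big_seq (fun e : site * site =>
    - (Posz (e.1.2 > c.2)%R - Posz (e.2.2 > c.2)%R))); last first.
    by move=> e es_e; apply: wind1_west (adj _ es_e) (bd _ es_e) c1.
  rewrite sumrN (edges_telescope (fun p : site => Posz (c.2 < p.2)%R)) lw.
  by rewrite subrr oppr0.
rewrite /wind big1_seq // => e /andP[_ es_e].
by apply: (wind1_out (adj _ es_e) (bd _ es_e) c1); lia.
Qed.

Definition box_cells (M : nat) : seq site :=
  [seq (i%:Z - M%:Z, j%:Z - M%:Z) | i <- iota 0 (2 * M), j <- iota 0 (2 * M)].

Lemma mem_box_cells M c : (c \in box_cells M) =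
  ((- M%:Z <= c.1 < M%:Z) && (- M%:Z <= c.2 < M%:Z))%R.
Proof.
apply/allpairsP/idP => [[[i j] /= []]|].
  by rewrite !mem_iota => hi hj -> /=; lia.
case: c => a b /= h; exists (`|(a + M%:Z)%R|%N, `|(b + M%:Z)%R|%N) => /=.
by rewrite !mem_iota; split; try lia; congr pair; lia.
Qed.

Lemma uniq_box_cells M : uniq (box_cells M).
Proof.
apply: allpairs_uniq; try exact: iota_uniq.
by move=> [i j] [i' j'] _ _ /= [] h1 h2; congr pair; lia.
Qed.

Lemma sum_ltn_iota n k : (k <= n)%N ->
  \sum_(i <- iota 0 n) Posz (i < k)%N = k.
Proof.
elim: n k => [|n IHn] k; first by rewrite leqn0 => /eqP->; rewrite big_nil.
rewrite leq_eqVlt => /predU1P[->|kn]; last first.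
  by rewrite -addn1 iotaD big_cat big_seq1 /= IHn //; lia.
rewrite -[in iota _ _]addn1 iotaD big_cat big_seq1 /= add0n ltnSn.
rewrite (eq_big_seq (fun i => Posz (i < n)%N)) ?IHn //; first lia.
by move=> i; rewrite mem_iota; lia.
Qed.

Lemma sum_eq_iota n k : (k < n)%N ->
  \sum_(i <- iota 0 n) Posz (i == k) = 1.
Proof.
move=> kn; rewrite (bigD1_seq k) ?iota_uniq ?mem_iota //= eqxx big1 // => i.
by move/negbTE->.
Qed.

(** The cells of the box that see a vertical edge at abscissa [a] are the [a + M] cells of its row
    to its west. *)
Lemma sum_wind1 M e : adjacent e.1 e.2 ->
  bounded_site M e.1 && bounded_site M e.2 ->
  \sum_(c <- box_cells M) wind1 c e = (e.1.1 + M%:Z) * (e.2.2 - e.1.2).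
Proof.
have up (a b : int) : (- M%:Z <= a <= M%:Z)%R -> (- M%:Z <= b < M%:Z)%R ->
    \sum_(c <- box_cells M) Posz ((c.1 < a) && (b == c.2))%R = a + M%:Z.
  move=> ha hb; rewrite /box_cells big_flatten /= big_map; under eq_bigr do rewrite big_map /=.
  have -> : a + M%:Z = \sum_(i <- iota 0 (2 * M)) Posz (i < `|(a + M%:Z)%R|)%N.
    by rewrite sum_ltn_iota; lia.
  apply: eq_bigr => i _.
  rewrite -[RHS]mulr1 -(@sum_eq_iota (2 * M) `|(b + M%:Z)%R|%N); last lia.
  by rewrite mulr_sumr; apply: eq_bigr => j _; lia.
case: e => [[a b] [a' b']] /adjacentP /= [] [-> ->];
  rewrite /bounded_site /= => hb.
- by under eq_bigr do rewrite wind1_up; rewrite up; lia.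
- rewrite -{1}[b](subrK 1); under eq_bigr do rewrite wind1_down'.
  by rewrite sumrN up; lia.
- by rewrite big1 => [|c _]; [lia | rewrite wind1_horiz //=; lia].
- by rewrite big1 => [|c _]; [lia | rewrite wind1_horiz //=; lia].
Qed.

(** The discrete form of the line integral of x dy. *)
Definition shoelace (p : site) (w : seq site) : int :=
  \sum_(e <- edges p w) e.1.1 * (e.2.2 - e.1.2).

(** The shift by [M] contributes [M] times the total change of height, which is zero on a closed
    walk. *)
Lemma sum_wind M p w : path adjacent p w -> last p w = p ->
  bounded_edges M (edges p w) ->
  \sum_(c <- box_cells M) wind (edges p w) c = shoelace p w.
Proof.
rewrite is_edge_seqP => /allP adj lw /allP bd; rewrite exchange_big /=.
rewrite (eq_big_seq (fun e : site * site => e.1.1 * (e.2.2 - e.1.2)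
  - M%:Z * (e.1.2 - e.2.2))); last first.
  by move=> e es_e; rewrite sum_wind1 ?adj ?bd // mulrDl; lia.
rewrite sumrB -mulr_sumr (edges_telescope snd) lw subrr mulr0 subr0.
by [].
Qed.

Lemma sum_Posz_count (T : Type) (P : pred T) s :
  \sum_(x <- s) Posz (P x) = count P s.
Proof. by elim: s => [|x s IHs]; rewrite ?big_nil // big_cons IHs. Qed.

Section Polygon.
Variable w : walk.
Hypotheses (walk_w : is_walk w) (uniq_w : uniq (visited w)).
Hypotheses (size_w : (1 < size w)%N) (last_w : adjacent (last 0 w) 0).

Let es := edges 0 (rcons w 0).

Let esE : es = rcons (edges 0 w) (last 0 w, 0).
Proof. exact: edges_rcons. Qed.

Let path_es : path adjacent 0 (rcons w 0).
Proof. by rewrite rcons_path last_w andbT. Qed.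

Let last_es : last 0 (rcons w 0) = 0. Proof. exact: last_rcons. Qed.

(** This uses that the walk has more than one step: a single step would be retraced by the closing
    edge. *)
Let fresh_last : on_edge (edges 0 w) (last 0 w) 0 = false.
Proof.
apply/negP; case/orP => [/mem_edges/= /andP[_ w0]|].
  by move: uniq_w; rewrite /= w0.
case: w uniq_w size_w => [|a [|b s]] // /= /and3P[w0 na nb] _.
rewrite inE => /predU1P[[e]|h]; first by case/negP: na; rewrite -e mem_last.
have /andP[/= h' _] := @mem_edges a (b :: s) _ h.
by case/negP: w0.
Qed.

Let two_sides : exists L R : site,
  (forall c, conn es c L \/ conn es c R) /\ `|wind es L - wind es R| = 1.
Proof.
have conn0 c c' : conn (edges 0 w) c c' by exact: conn_walk.
have aes : is_edge_seq (edges 0 w) by rewrite -is_edge_seqP.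
have vert x y : (last 0 w, 0) = ((x + 1, y), (x + 1, y + 1)) \/
    (last 0 w, 0) = ((x + 1, y + 1), (x + 1, y)) ->
  exists L R : site, (forall c, conn es c L \/ conn es c R) /\
    `|wind es L - wind es R| = 1.
  move=> e_def; exists (x, y), (x + 1, y); rewrite esE; split=> [c|].
    apply: conn_closing (conn0 c (x, y)) => {}c c'.
    exact: link_cut_vert.
  rewrite !wind_rcons wind_east //; last first.
    by case: e_def => /pair_equal_spec[<- <-] //; rewrite on_edgeC.
  rewrite opprD addrACA subrr add0r.
  by case: e_def => ->; rewrite ?wind1_up ?wind1_down' /=; lia.
have horiz x y : (last 0 w, 0) = ((x, y + 1), (x + 1, y + 1)) \/
    (last 0 w, 0) = ((x + 1, y + 1), (x, y + 1)) ->
  exists L R : site, (forall c, conn es c L \/ conn es c R) /\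
    `|wind es L - wind es R| = 1.
  move=> e_def; exists (x, y + 1), (x, y); rewrite esE; split=> [c|].
    apply: conn_closing (conn0 c (x, y + 1)) => {}c c' /link_cut_horiz.
    move/(_ _ _ _ e_def) => [l|l|l]; [constructor 1|constructor 3|constructor 2];
      exact: l.
  (* A horizontal closing edge crosses no ray. The jump comes from the open walk, exactly one of
     whose two ends lies on the part of row [y + 1] beyond [x]. *)
  rewrite !wind_rcons opprD addrACA wind_north //; last first.
    by case: e_def => /pair_equal_spec[<- <-] //; rewrite on_edgeC.
  by case: e_def => e; rewrite e; case/pair_equal_spec: e => -> ->;
    rewrite !wind1_horiz /right_of /=; lia.
case/adjacentP: last_w => h.
- by apply: (vert (-1) (-1)); left; congr pair; case: (last 0 w) h => a b [] /=; move=> *; congr pair; lia.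
- by apply: (vert (-1) 0); right; congr pair; case: (last 0 w) h => a b [] /=; move=> *; congr pair; lia.
- by apply: (horiz (-1) (-1)); left; congr pair; case: (last 0 w) h => a b [] /=; move=> *; congr pair; lia.
- by apply: (horiz 0 (-1)); right; congr pair; case: (last 0 w) h => a b [] /=; move=> *; congr pair; lia.
Qed.

(** The winding number takes at most the two values found on the sides of the closing edge. They
    differ by one and one of them is 0, taken far away, so up to a global sign the winding number is
    the indicator of the enclosed cells. Summing it over a large box gives the shoelace sum. *)
Lemma polygon_area : has_area w `|shoelace 0 (rcons w 0)|.
Proof.
have [M hM] := exists_bound (0 :: rcons w 0).
have bd : bounded_edges M es by exact: edges_bounded.
have out c := wind_out path_es last_es bd (c := c).
have [L [R [LR wLR]]] := two_sides.
have wind_far : wind es (M%:Z, 0) = 0 by apply: out => /=; lia.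
have same c c' : wind es c = wind es c' -> conn es c c'.
  move=> e; case: (LR c) (LR c') => hc [] hc'.
  - exact: conn_trans hc (conn_sym hc').
  - move: wLR; rewrite -(wind_conn path_es last_es hc).
    by rewrite -(wind_conn path_es last_es hc') e subrr.
  - move: wLR; rewrite -(wind_conn path_es last_es hc).
    by rewrite -(wind_conn path_es last_es hc') e subrr.
  - exact: conn_trans hc (conn_sym hc').
have [eps eps1 wind_eps] : exists2 eps : int, `|eps| = 1 &
    forall c, wind es c = eps * Posz (wind es c != 0).
  have wc c : wind es c = wind es L \/ wind es c = wind es R.
    by case: (LR c) => /(wind_conn path_es last_es) ->; [left|right].
  (* One of the two values is 0 and the other 1 or -1, so the sum is the nonzero one. *)
  exists (wind es L + wind es R); first by case: (wc (M%:Z, 0)); lia.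
  by move=> c; case: (wc (M%:Z, 0)) (wc c) => h [] h'; rewrite h'; lia.
have cells : enclosed_cells w = [set` [fset c in [seq c <- box_cells M | wind es c != 0]]%fset]%classic.
  apply/seteqP; split=> c /=; last first.
    rewrite !inE mem_filter mem_box_cells => /andP[wc _].
    apply: (@sub_finite_set _ _ [set` box_cells M]); last exact: finite_seq.
    move=> c' [s]; rewrite cell_linkE => ps e /=.
    have /(wind_conn path_es last_es) ec : conn es c c' by exists s.
    by rewrite mem_box_cells; apply: contraNT wc => /out; rewrite ec => ->.
  rewrite /enclosed_cells /= => fin; rewrite !inE mem_filter.
  have [wc0|wc] := eqVneq (wind es c) 0; last first.
    by rewrite mem_box_cells; apply: contraNT wc => /out ->.
  (* A cell of winding number 0 is connected to all the cells of a ray outside the box, so its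
     component is infinite. *)
  exfalso; apply: infinite_nat.
  pose f (i : nat) : site := (M%:Z + i%:Z, 0).
  apply: (@sub_finite_set _ _ (f @^-1` cell_component w c)%classic).
    move=> i _; rewrite /cell_component /= cell_linkE.
    by apply: same; rewrite wc0 out //=; lia.
  by apply: finite_preimage fin => i j _ _ [] h; lia.
rewrite /has_area cells; apply/card_eq_fsetP.
rewrite card_fseq undup_id ?filter_uniq ?uniq_box_cells // size_filter.
apply/eqP; rewrite -eqz_nat abszE -sum_Posz_count.
rewrite -(sum_wind path_es last_es bd).
rewrite [in X in _ == X](eq_bigr _ (fun c _ => wind_eps c)) -mulr_sumr normrM eps1 mul1r.
by rewrite sum_Posz_count.
Qed.
End Polygon.

(** * Prudent 3-sided walks, one step at a time *)

Definition valid (w : walk) : Prop := prudent w /\ three_sided w.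

(* For adjacent [p] and [q]: [s] is strictly beyond [p] in the direction of [q]. *)
Definition ahead (p q s : site) : bool :=
  [|| [&& p.2 < q.2, s.1 == p.1 & p.2 < s.2],
      [&& q.2 < p.2, s.1 == p.1 & s.2 < p.2],
      [&& p.1 < q.1, s.2 == p.2 & p.1 < s.1] |
      [&& q.1 < p.1, s.2 == p.2 & s.1 < p.1]]%R.

Lemma site_mulrn (a b : int) k : (a, b) *+ k = (a * k%:Z, b * k%:Z) :> site.
Proof.
elim: k => [|k IHk]; first by rewrite !mulr0.
by rewrite mulrS IHk siteD; congr pair; lia.
Qed.

Lemma aheadP p q s : adjacent p q ->
  reflect (exists2 k, (0 < k)%N & s = p + (q - p) *+ k) (ahead p q s).
Proof.
case: p q s => [px py] [qx qy] [sx sy] /adjacentP /= adj.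
have ray k : (px, py) + ((qx, qy) - (px, py)) *+ k =
    (px + (qx - px) * k%:Z, py + (qy - py) * k%:Z) :> site.
  by rewrite siteB site_mulrn siteD.
rewrite /ahead /=.
apply: (iffP idP) => [h|[k k0]]; last rewrite ray => -[-> ->].
  exists (`|(sx - px)%R| + `|(sy - py)%R|)%N; rewrite ?ray; case: adj h => -[-> ->]; first [by lia | move=> h; congr pair; lia].
by case: adj => -[-> ->]; lia.
Qed.

Lemma bigmax_seqP (f : site -> int) (s : seq site) :
  (forall p, p \in s -> (f p <= \big[Num.max/0]_(p <- s) f p)%R) /\
  (\big[Num.max/0]_(p <- s) f p = 0 \/
   exists2 p, p \in s & f p = \big[Num.max/0]_(p <- s) f p).
Proof.
elim: s => [|a s [IH1 IH2]]; first by rewrite big_nil; split; [|left].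
rewrite big_cons; set B := \big[_/_]_(p <- s) _ in IH1 IH2 *.
split=> [p|].
  rewrite inE => /predU1P[->|/IH1 h]; first by lia.
  by apply: le_trans h _; lia.
have [h|h] := leP (f a) B; last by right; exists a; rewrite ?mem_head.
case: IH2 => [e|[p sp e]]; first by left.
by right; exists p; rewrite ?inE ?sp ?orbT.
Qed.

Lemma bigmin_seqP (f : site -> int) (s : seq site) :
  (forall p, p \in s -> (\big[Num.min/0]_(p <- s) f p <= f p)%R) /\
  (\big[Num.min/0]_(p <- s) f p = 0 \/
   exists2 p, p \in s & f p = \big[Num.min/0]_(p <- s) f p).
Proof.
elim: s => [|a s [IH1 IH2]]; first by rewrite big_nil; split; [|left].
rewrite big_cons; set B := \big[_/_]_(p <- s) _ in IH1 IH2 *.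
split=> [p|].
  rewrite inE => /predU1P[->|/IH1 h]; first by lia.
  by apply: le_trans h; lia.
have [h|h] := leP B (f a); last by right; exists a; rewrite ?mem_head //; lia.
case: IH2 => [e|[p sp e]]; first by left; lia.
by right; exists p; rewrite ?inE ?sp ?orbT //; lia.
Qed.

Lemma bigmax_visited (f : site -> int) w m : f 0 = 0 ->
  reflect ((forall p, p \in visited w -> (f p <= m)%R) /\
           exists2 p, p \in visited w & f p = m)
    (\big[Num.max/0]_(p <- visited w) f p == m).
Proof.
move=> f0; have [h1 h2] := bigmax_seqP f (visited w).
apply: (iffP eqP) => [<-|[g1 [p pw pm]]].
  split=> //; case: h2 => [->|//]; exists 0; rewrite ?mem_head //.
apply/le_anti; rewrite -{2}pm h1 // andbT.
by case: h2 => [->|[q qw <-]]; rewrite ?g1 // -f0 g1 ?mem_head.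
Qed.

Lemma bigmin_visited (f : site -> int) w m : f 0 = 0 ->
  reflect ((forall p, p \in visited w -> (m <= f p)%R) /\
           exists2 p, p \in visited w & f p = m)
    (\big[Num.min/0]_(p <- visited w) f p == m).
Proof.
move=> f0; have [h1 h2] := bigmin_seqP f (visited w).
apply: (iffP eqP) => [<-|[g1 [p pw pm]]].
  split=> //; case: h2 => [->|//]; exists 0; rewrite ?mem_head //.
apply/le_anti; rewrite -{1}pm h1 //=.
by case: h2 => [->|[q qw <-]]; rewrite ?g1 // -f0 g1 ?mem_head.
Qed.

Lemma box_eastP (w : walk) :
  (forall p, p \in visited w -> (p.1 <= box_east w)%R) /\
  exists2 p, p \in visited w & p.1 = box_east w.
Proof. by apply/bigmax_visited. Qed.

Lemma box_westP (w : walk) :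
  (forall p, p \in visited w -> (box_west w <= p.1)%R) /\
  exists2 p, p \in visited w & p.1 = box_west w.
Proof. by apply/bigmin_visited. Qed.

Lemma box_northP (w : walk) :
  (forall p, p \in visited w -> (p.2 <= box_north w)%R) /\
  exists2 p, p \in visited w & p.2 = box_north w.
Proof. by apply/bigmax_visited. Qed.

Lemma box_southP (w : walk) :
  (forall p, p \in visited w -> (box_south w <= p.2)%R) /\
  exists2 p, p \in visited w & p.2 = box_south w.
Proof. by apply/bigmin_visited. Qed.

Lemma last_visited (w : walk) : last 0 w \in visited w.
Proof. exact: mem_last. Qed.

Lemma ends_on_NEW_sideP (w : walk) : let p : site := last 0 w in
  reflect [\/ forall s, s \in visited w -> (s.2 <= p.2)%R,
              forall s, s \in visited w -> (s.1 <= p.1)%R |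
              forall s, s \in visited w -> (p.1 <= s.1)%R]
    (ends_on_NEW_side w).
Proof.
move=> p; have pw := last_visited w.
rewrite /ends_on_NEW_side /box_north /box_east /box_west.
apply: (iffP or3P) => -[].
- by rewrite eq_sym => /bigmax_visited[|h _]; [|constructor 1].
- by rewrite eq_sym => /bigmax_visited[|h _]; [|constructor 2].
- by rewrite eq_sym => /bigmin_visited[|h _]; [|constructor 3].
- by move=> h; constructor 1; rewrite eq_sym; apply/bigmax_visited; last split; last exists p.
- by move=> h; constructor 2; rewrite eq_sym; apply/bigmax_visited; last split; last exists p.
- by move=> h; constructor 3; rewrite eq_sym; apply/bigmin_visited; last split; last exists p.
Qed.

(** Visited sites replace the extrema of the box, so that the condition is proved or refuted by
    exhibiting sites. *)
Lemma forbidden_stepP (w : walk) (q : site) : let p : site := last 0 w in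
  reflect [/\ q.2 = p.2, q.1 = p.1 + 1 \/ q.1 = p.1 - 1,
              forall s, s \in visited w -> (s.1 = p.1 \/ s.1 = q.1) /\ (p.2 <= s.2)%R,
              exists2 s, s \in visited w & s.1 = q.1 &
              exists2 s, s \in visited w & (p.2 < s.2)%R]
    (forbidden_step w q).
Proof.
move=> p; have pw := last_visited w; rewrite -/p in pw.
apply: (equivP idP).
have [e1 [[ex ey] e2 /= e3]] := box_eastP w.
have [w1 [[wx wy] w2 /= w3]] := box_westP w.
have [n1 [[nx ny] n2 /= n3]] := box_northP w.
have [s1 [[sx sy] s2 /= s3]] := box_southP w.
rewrite /forbidden_step /box_SE /box_SW -/p.
move: (box_east w) (box_west w) (box_north w) (box_south w) e1 e3 w1 w3 n1 n3 s1 s3 => E W N S e1 e3 w1 w3 n1 n3 s1 s3.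
case: p pw => [px py] pw; case: q => [qx qy]; rewrite !siteE /=.
split=> [/and3P[h1 h2 h3]|[-> h1 h2 [[ax ay] aw /= a1] [[bx by_] bw /= b1]]].
  split; try lia.
  - by case=> ax ay aw; have := e1 _ aw; have := w1 _ aw; have := s1 _ aw => /=; lia.
  - case/orP: h3 => h3; [exists (wx, wy)|exists (ex, ey)] => //=; lia.
  - by exists (nx, ny) => //=; lia.
have [+ _] := h2 _ e2; have [+ _] := h2 _ w2; have [_ +] := h2 _ s2.
have := e1 _ aw; have := w1 _ aw; have := n1 _ bw.
have := s1 _ pw; have := e1 _ pw; have := w1 _ pw => /= *.
by apply/and3P; split; lia.
Qed.

Definition good (w : walk) (q : site) : bool :=
  [&& adjacent (last 0 w) q, all (fun s => ~~ ahead (last 0 w) q s) (visited w),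
      ends_on_NEW_side (rcons w q) & ~~ forbidden_step w q].

Lemma valid_nil : valid [::].
Proof.
split; first by split.
by split=> // i _; apply/ends_on_NEW_sideP; constructor 1 => s; rewrite inE => /eqP->.
Qed.

(** All the conditions bear on prefixes, so one more step adds only those at its own place. The
    freshness of [q] is the case [k = 1] of prudence. *)
Lemma validS w q : valid (rcons w q) <-> valid w /\ good w q.
Proof.
have takeS i : (i <= size w)%N -> take i (rcons w q) = take i w.
  by move=> hi; rewrite -cats1 takel_cat.
have nthS i : (i < size w)%N -> nth 0 (rcons w q) i = nth 0 w i.
  by move=> hi; rewrite nth_rcons hi.
have nth_last : nth 0 (rcons w q) (size w) = q by rewrite nth_rcons ltnn eqxx.
split=> [[[ww uw pw] [nw fw]]|[[[ww uw pw] [nw fw]] /and4P[adj /allP free ne nf]]].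
  move: ww; rewrite /is_walk rcons_path => /andP[ww adj]; split; last first.
    apply/and4P; split=> //.
    - apply/allP=> s sw; apply/(aheadP _ adj) => -[k k0 es].
      have := pw (size w) k; rewrite size_rcons => /(_ (ltnSn _) k0).
      by rewrite takeS // take_size nth_last /= -es sw.
    - have := nw (size w).+1; rewrite size_rcons take_oversize ?size_rcons //.
      exact.
    - have := fw (size w); rewrite size_rcons takeS // take_size nth_last.
      exact.
  split.
    split=> // [|i k hi k0].
      by move: uw; rewrite /visited -rcons_cons rcons_uniq => /andP[].
    have := pw i k; rewrite size_rcons takeS ?nthS // 1?ltnW //.
    by apply=> //; apply: ltnW.
  split=> i hi.
    by rewrite -takeS //; apply: nw; rewrite size_rcons ltnW.
  rewrite -takeS 1?ltnW // -nthS //; apply: fw; rewrite size_rcons; exact: ltnW.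
have nq : q \notin visited w.
  apply/negP => /free /(aheadP _ adj) []; exists 1%N => //.
  by rewrite mulr1n addrC subrK.
split.
  split; first by rewrite /is_walk rcons_path adj andbT.
    by rewrite /visited -rcons_cons rcons_uniq nq.
  move=> i k; rewrite size_rcons ltnS leq_eqVlt => /predU1P[->|hi] k0.
    rewrite takeS // take_size nth_last /=; apply/negP=> /free/(aheadP _ adj) [].
    by exists k.
  by rewrite takeS ?nthS // 1?ltnW //; apply: pw.
split=> i; rewrite size_rcons.
  rewrite leq_eqVlt => /predU1P[->|hi]; first by rewrite take_oversize ?size_rcons.
  by rewrite takeS //; apply: nw.
rewrite ltnS leq_eqVlt => /predU1P[->|hi].
  by rewrite takeS // take_size nth_last.
by rewrite takeS ?nthS // 1?ltnW //; apply: fw.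
Qed.

(** * Reflection in the vertical axis *)

Definition mirror (p : site) : site := (- p.1, p.2).

Lemma mirrorK : involutive mirror.
Proof. by case=> a b; rewrite /mirror opprK. Qed.

Lemma mirror0 : mirror 0 = 0. Proof. by []. Qed.

Lemma visited_mirror w : visited (map mirror w) = map mirror (visited w).
Proof. by []. Qed.

Lemma last_mirror w : last 0 (map mirror w) = mirror (last 0 w).
Proof. by rewrite -[in LHS]mirror0 last_map. Qed.

Lemma mem_mirror w p :
  (p \in visited (map mirror w)) = (mirror p \in visited w).
Proof. by rewrite visited_mirror -{1}[p]mirrorK mem_map //; exact: inv_inj mirrorK. Qed.

Lemma adjacent_mirror p q : adjacent (mirror p) (mirror q) = adjacent p q.
Proof.
rewrite /mirror; apply/adjacentP/adjacentP; case: p q => [a b] [c d] /= [] [h ->];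
  [constructor 1|constructor 2|constructor 4|constructor 3|
   constructor 1|constructor 2|constructor 4|constructor 3]; congr pair; lia.
Qed.

Lemma good_mirror w q : good w q -> good (map mirror w) (mirror q).
Proof.
case/and4P=> adj /allP free ne nf; apply/and4P; rewrite last_mirror; split.
- by rewrite adjacent_mirror.
- apply/allP=> s; rewrite mem_mirror => /free; rewrite /ahead /=; lia.
- rewrite -map_rcons; apply/ends_on_NEW_sideP; rewrite last_mirror.
  case/ends_on_NEW_sideP: ne => h; [constructor 1|constructor 3|constructor 2];
    by move=> s; rewrite mem_mirror => /h /=; lia.
- apply: contraNN nf => /forbidden_stepP; rewrite last_mirror /mirror /=.
  move=> [h1 h2 h3 [a aw a1] [b bw b1]]; apply/forbidden_stepP; split=> //.
  + by case: (last 0 w) h2 => lx ly; case: (q) => qx qy /=; lia.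
  + move=> [sx sy] sw; have := h3 (mirror (sx, sy)).
    rewrite mem_mirror mirrorK /mirror /= => /(_ sw).
    by case: (last 0 w) => lx ly; case: (q) => qx qy /=; lia.
  + by exists (mirror a); [rewrite -mem_mirror | rewrite /mirror /= a1 opprK].
  + by exists (mirror b); [rewrite -mem_mirror | ].
Qed.

Lemma valid_mirror w : valid w -> valid (map mirror w).
Proof.
elim/last_ind: w => [//|w q IHw] /validS[/IHw vw gw].
by rewrite map_rcons; apply/validS; split=> //; apply: good_mirror.
Qed.

(** * Straight runs *)

Section GoodSteps.
Variables (w : walk) (x y : int).
Hypothesis last_w : last 0 w = (x, y).

Let ends q (P : pred site) : P q ->
  (forall a b, (a, b) \in visited w -> P (a, b)) ->
  forall s, s \in visited (rcons w q) -> P s.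
Proof.
move=> Pq Pw [a b]; rewrite /visited -rcons_cons mem_rcons inE.
by case/predU1P=> [->//|/Pw].
Qed.

Lemma good_north :
  (forall a b, (a, b) \in visited w -> a = x -> (b <= y)%R) ->
  (forall a b, (a, b) \in visited w -> (a <= x)%R) \/
  (forall a b, (a, b) \in visited w -> (b <= y)%R) ->
  good w (x, y + 1).
Proof.
move=> free side; apply/and4P; rewrite last_w; split.
- by apply/adjacentP; constructor 1.
- by apply/allP=> -[a b] /free; rewrite /ahead /=; lia.
- apply/ends_on_NEW_sideP; rewrite last_rcons /=.
  case: side => side; [constructor 2|constructor 1].
    by apply: (ends (P := fun s => s.1 <= x)%R) => //= a b /side.
  by apply: (ends (P := fun s => s.2 <= y + 1)%R) => //= a b /side; lia.
- by apply/forbidden_stepP; rewrite last_w /= => -[]; lia.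
Qed.

Lemma good_south :
  (forall a b, (a, b) \in visited w -> a = x -> (y <= b)%R) ->
  (forall a b, (a, b) \in visited w -> (a <= x)%R) \/
  (forall a b, (a, b) \in visited w -> (x <= a)%R) ->
  good w (x, y - 1).
Proof.
move=> free side; apply/and4P; rewrite last_w; split.
- by apply/adjacentP; constructor 2.
- by apply/allP=> -[a b] /free; rewrite /ahead /=; lia.
- apply/ends_on_NEW_sideP; rewrite last_rcons /=.
  case: side => side; [constructor 2|constructor 3].
    by apply: (ends (P := fun s => s.1 <= x)%R) => //= a b /side.
  by apply: (ends (P := fun s => x <= s.1)%R) => //= a b /side; lia.
- by apply/forbidden_stepP; rewrite last_w /= => -[]; lia.
Qed.

Lemma good_east :
  (forall a b, (a, b) \in visited w -> b = y -> (a <= x)%R) ->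
  (forall a b, (a, b) \in visited w -> (a <= x)%R) \/
  (forall a b, (a, b) \in visited w -> (b <= y)%R) ->
  good w (x + 1, y).
Proof.
move=> free side; apply/and4P; rewrite last_w; split.
- by apply/adjacentP; constructor 3.
- by apply/allP=> -[a b] /free; rewrite /ahead /=; lia.
- apply/ends_on_NEW_sideP; rewrite last_rcons /=.
  case: side => side; [constructor 2|constructor 1].
    by apply: (ends (P := fun s => s.1 <= x + 1)%R) => //= a b /side; lia.
  by apply: (ends (P := fun s => s.2 <= y)%R) => //= a b /side; lia.
(* A forbidden step would need one site already in column [x + 1] and another above row [y]; each
   alternative of [side] excludes one of them. *)
- apply/forbidden_stepP; rewrite last_w /= => -[_ _ _ [[a b] aw /= ea] [[a' b'] bw /= eb]].
  by case: side => side; [have := side _ _ aw|have := side _ _ bw]; lia.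
Qed.

Lemma good_west :
  (forall a b, (a, b) \in visited w -> b = y -> (x <= a)%R) ->
  (forall a b, (a, b) \in visited w -> (x <= a)%R) \/
  (forall a b, (a, b) \in visited w -> (b <= y)%R) ->
  good w (x - 1, y).
Proof.
move=> free side; apply/and4P; rewrite last_w; split.
- by apply/adjacentP; constructor 4.
- by apply/allP=> -[a b] /free; rewrite /ahead /=; lia.
- apply/ends_on_NEW_sideP; rewrite last_rcons /=.
  case: side => side; [constructor 3|constructor 1].
    by apply: (ends (P := fun s => x - 1 <= s.1)%R) => //= a b /side; lia.
  by apply: (ends (P := fun s => s.2 <= y)%R) => //= a b /side; lia.
- apply/forbidden_stepP; rewrite last_w /= => -[_ _ _ [[a b] aw /= ea] [[a' b'] bw /= eb]].
  by case: side => side; [have := side _ _ aw|have := side _ _ bw]; lia.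
Qed.

End GoodSteps.

(* [p] itself is not listed. *)
Definition run (dx dy : int) (p : site) (k : nat) : seq site :=
  [seq (p.1 + dx * i.+1%:Z, p.2 + dy * i.+1%:Z) | i <- iota 0 k].

Lemma runS dx dy p k :
  run dx dy p k.+1 = rcons (run dx dy p k) (p.1 + dx * k.+1%:Z, p.2 + dy * k.+1%:Z).
Proof. by rewrite /run -[in LHS]addn1 iotaD map_cat cats1 add0n. Qed.

Lemma last_run dx dy p k :
  last p (run dx dy p k) = (p.1 + dx * k%:Z, p.2 + dy * k%:Z).
Proof.
case: k => [|k]; last by rewrite runS last_rcons.
by rewrite /= !mulr0 !addr0; case: p.
Qed.

Lemma mem_run_north (a b x y : int) k :
  ((a, b) \in run 0 1 (x, y) k) = ((a == x) && (y < b <= y + k%:Z))%R.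
Proof.
apply/mapP/idP => [[i] /=|h]; first by rewrite mem_iota => hi [-> ->]; lia.
exists `|(b - y - 1)%R|%N; first by rewrite mem_iota; lia.
by congr pair; rewrite /=; lia.
Qed.

Lemma mem_run_south (a b x y : int) k :
  ((a, b) \in run 0 (-1) (x, y) k) = ((a == x) && (y - k%:Z <= b < y))%R.
Proof.
apply/mapP/idP => [[i] /=|h]; first by rewrite mem_iota => hi [-> ->]; lia.
exists `|(y - b - 1)%R|%N; first by rewrite mem_iota; lia.
by congr pair; rewrite /=; lia.
Qed.

Lemma mem_run_east (a b x y : int) k :
  ((a, b) \in run 1 0 (x, y) k) = ((b == y) && (x < a <= x + k%:Z))%R.
Proof.
apply/mapP/idP => [[i] /=|h]; first by rewrite mem_iota => hi [-> ->]; lia.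
exists `|(a - x - 1)%R|%N; first by rewrite mem_iota; lia.
by congr pair; rewrite /=; lia.
Qed.

Lemma mem_run_west (a b x y : int) k :
  ((a, b) \in run (-1) 0 (x, y) k) = ((b == y) && (x - k%:Z <= a < x))%R.
Proof.
apply/mapP/idP => [[i] /=|h]; first by rewrite mem_iota => hi [-> ->]; lia.
exists `|(x - a - 1)%R|%N; first by rewrite mem_iota; lia.
by congr pair; rewrite /=; lia.
Qed.

Definition mem_run := (mem_run_north, mem_run_south, mem_run_east, mem_run_west).

Lemma visited_cat w r s : (s \in visited (w ++ r)) = (s \in visited w) || (s \in r).
Proof. by rewrite /visited -cat_cons mem_cat. Qed.

Lemma visited_rcons w q s : (s \in visited (rcons w q)) = (s \in visited w) || (s == q).
Proof. by rewrite -cats1 visited_cat mem_seq1. Qed.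

Lemma last_cat_run w x y dx dy k : last 0 w = (x, y) ->
  last 0 (w ++ run dx dy (x, y) k) = (x + dx * k%:Z, y + dy * k%:Z).
Proof. by move=> lw; rewrite last_cat lw last_run. Qed.

Lemma valid_north w x y k : valid w -> last 0 w = (x, y) ->
  (forall a b, (a, b) \in visited w -> a = x -> (b <= y)%R) ->
  (forall a b, (a, b) \in visited w -> (a <= x)%R) \/
  (forall a b, (a, b) \in visited w -> (b <= y)%R) ->
  valid (w ++ run 0 1 (x, y) k).
Proof.
move=> vw lw free side; elim: k => [|k IHk]; first by rewrite cats0.
rewrite runS -rcons_cat; apply/validS; split=> //=.
have -> : y + 1 * k.+1%:Z = (y + 1 * k%:Z) + 1 by lia.
have -> : x + 0 * k.+1%:Z = x + 0 * k%:Z by lia.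
apply: good_north (last_cat_run _ _ _ lw) _ _ => [a b|].
  by rewrite visited_cat => /orP[/free|]; rewrite ?mem_run; lia.
by case: side => side; [left|right] => a b; rewrite visited_cat => /orP[/side|];
  rewrite ?mem_run; lia.
Qed.

Lemma valid_south w x y k : valid w -> last 0 w = (x, y) ->
  (forall a b, (a, b) \in visited w -> a = x -> (y <= b)%R) ->
  (forall a b, (a, b) \in visited w -> (a <= x)%R) \/
  (forall a b, (a, b) \in visited w -> (x <= a)%R) ->
  valid (w ++ run 0 (-1) (x, y) k).
Proof.
move=> vw lw free side; elim: k => [|k IHk]; first by rewrite cats0.
rewrite runS -rcons_cat; apply/validS; split=> //=.
have -> : y + -1 * k.+1%:Z = (y + -1 * k%:Z) - 1 by lia.
have -> : x + 0 * k.+1%:Z = x + 0 * k%:Z by lia.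
apply: good_south (last_cat_run _ _ _ lw) _ _ => [a b|].
  by rewrite visited_cat => /orP[/free|]; rewrite ?mem_run; lia.
by case: side => side; [left|right] => a b; rewrite visited_cat => /orP[/side|];
  rewrite ?mem_run; lia.
Qed.

Lemma valid_east w x y k : valid w -> last 0 w = (x, y) ->
  (forall a b, (a, b) \in visited w -> b = y -> (a <= x)%R) ->
  (forall a b, (a, b) \in visited w -> (b <= y)%R) ->
  valid (w ++ run 1 0 (x, y) k).
Proof.
move=> vw lw free side; elim: k => [|k IHk]; first by rewrite cats0.
rewrite runS -rcons_cat; apply/validS; split=> //=.
have -> : x + 1 * k.+1%:Z = (x + 1 * k%:Z) + 1 by lia.
have -> : y + 0 * k.+1%:Z = y + 0 * k%:Z by lia.
apply: good_east (last_cat_run _ _ _ lw) _ _ => [a b|].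
  by rewrite visited_cat => /orP[/free|]; rewrite ?mem_run; lia.
by right=> a b; rewrite visited_cat => /orP[/side|]; rewrite ?mem_run; lia.
Qed.

Lemma valid_west w x y k : valid w -> last 0 w = (x, y) ->
  (forall a b, (a, b) \in visited w -> b = y -> (x <= a)%R) ->
  (forall a b, (a, b) \in visited w -> (b <= y)%R) ->
  valid (w ++ run (-1) 0 (x, y) k).
Proof.
move=> vw lw free side; elim: k => [|k IHk]; first by rewrite cats0.
rewrite runS -rcons_cat; apply/validS; split=> //=.
have -> : x + -1 * k.+1%:Z = (x + -1 * k%:Z) - 1 by lia.
have -> : y + 0 * k.+1%:Z = y + 0 * k%:Z by lia.
apply: good_west (last_cat_run _ _ _ lw) _ _ => [a b|].
  by rewrite visited_cat => /orP[/free|]; rewrite ?mem_run; lia.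
by right=> a b; rewrite visited_cat => /orP[/side|]; rewrite ?mem_run; lia.
Qed.

(** * Codes of walks in a half-plane *)

(* A code lists, latest first, the steps that enlarge the box of a walk confined
   to [x >= 0]: [inl d] is an east step into a new column, made at depth [d]
   below the top of the box, and [inr a] a north step into a new top row, made
   in column [a]. *)
Definition code : Type := seq (nat + nat).

Fixpoint cols (c : code) : nat :=
  match c with [::] => 0 | inl _ :: c' => (cols c').+1 | inr _ :: c' => cols c' end.

Fixpoint rows (c : code) : nat :=
  match c with [::] => 0 | inl _ :: c' => rows c' | inr _ :: c' => (rows c').+1 end.

(** The cells gained by each recorded step when the curve is closed as in [polyC]: an east step at
    depth [d] gains the [d] cells of the new column between it and the top of the box, a north step
    in column [a] gains the cells of the new row from column -1 to [a]. *)
Fixpoint weight (c : code) : nat :=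
  match c with
  | [::] => 0
  | inl d :: c' => weight c' + d
  | inr a :: c' => weight c' + a.+1
  end.

Definition on_row (c : code) : bool := if c is inr _ :: _ then true else false.

(** After a north step the walk is alone in the top row and moves along it: it may leave upwards in
    any column, but eastwards only at depth 0. After an east step it is alone in the last column and
    moves vertically, possibly below the box: any depth is allowed, but a new row is entered from
    the last column. *)
Fixpoint admissible (c : code) : bool :=
  match c with
  | [::] => true
  | inl d :: c' => admissible c' && (on_row c' ==> (d == 0%N))
  | inr a :: c' =>
    admissible c' && (if on_row c' then (a <= cols c')%N else a == cols c')
  end.

Definition pos (c : code) : site :=
  match c with
  | [::] => (0, 0)
  | inl d :: c' => ((cols c')%:Z + 1, (rows c')%:Z - d%:Z)
  | inr a :: c' => (a%:Z, (rows c')%:Z + 1)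
  end.

Definition hrun (p : site) (x : int) : seq site :=
  if (p.1 <= x)%R then run 1 0 p `|(x - p.1)%R| else run (-1) 0 p `|(p.1 - x)%R|.

Definition vrun (p : site) (y : int) : seq site :=
  if (p.2 <= y)%R then run 0 1 p `|(y - p.2)%R| else run 0 (-1) p `|(p.2 - y)%R|.

(** The straight run from the last recorded step to the place where the step [s] starts. *)
Definition approach (c : code) (s : nat + nat) : seq site :=
  if on_row c then hrun (pos c) (if s is inr a then a%:Z else (cols c)%:Z)
  else vrun (pos c) (if s is inl d then (rows c)%:Z - d%:Z else (rows c)%:Z).

Fixpoint walk_of (c : code) : walk :=
  if c is s :: c' then rcons (walk_of c' ++ approach c' s) (pos c) else [::].

Lemma last_hrun x y x' : last (x, y) (hrun (x, y) x') = (x', y).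
Proof. by rewrite /hrun /=; case: leP => h; rewrite last_run /=; congr pair; lia. Qed.

Lemma last_vrun x y y' : last (x, y) (vrun (x, y) y') = (x, y').
Proof. by rewrite /vrun /=; case: leP => h; rewrite last_run /=; congr pair; lia. Qed.

Lemma mem_hrun (x y x' a b : int) : (a, b) \in hrun (x, y) x' ->
  b = y /\ (x < a <= x' \/ x' <= a < x)%R.
Proof. by rewrite /hrun /=; case: ifP => h; rewrite mem_run; lia. Qed.

Lemma mem_vrun (x y y' a b : int) : (a, b) \in vrun (x, y) y' ->
  a = x /\ (y < b <= y' \/ y' <= b < y)%R.
Proof. by rewrite /vrun /=; case: ifP => h; rewrite mem_run; lia. Qed.

Lemma last_walk_of c : last 0 (walk_of c) = pos c.
Proof. by case: c => // s c; rewrite /= last_rcons. Qed.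

Lemma rows_gt0 c : on_row c -> (0 < rows c)%N.
Proof. by case: c => [|[]]. Qed.

Lemma pos_row c : on_row c -> (pos c).2 = (rows c)%:Z.
Proof. by case: c => [|[]] //= a c _; lia. Qed.

Lemma pos_col c : ~~ on_row c -> (pos c).1 = (cols c)%:Z.
Proof. by case: c => [|[]] //= a c _; lia. Qed.

Lemma pos_le c : admissible c ->
  (0 <= (pos c).1 <= (cols c)%:Z)%R /\ ((pos c).2 <= (rows c)%:Z)%R.
Proof.
case: c => [//|[d|a] c] /= /andP[_]; first by move=> _; split; lia.
by case: (on_row c) => h; split; lia.
Qed.

(** The endpoint is alone in its extreme row or column, so the next run is prudent in both
    directions. The sites exhibited in the last column and in the top row serve later to block steps
    back into the box. *)
Definition fits (c : code) : Prop :=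
  [/\ valid (walk_of c),
      forall a b : int, (a, b) \in visited (walk_of c) ->
        (0 <= a <= (cols c)%:Z /\ b <= (rows c)%:Z)%R,
      on_row c ->
        (forall a b : int, (a, b) \in visited (walk_of c) -> b = (rows c)%:Z ->
           a = (pos c).1) /\
        (exists2 b : int, (1 <= b)%R & ((cols c)%:Z, b) \in visited (walk_of c)) &
      ~~ on_row c ->
        (forall a b : int, (a, b) \in visited (walk_of c) -> a = (cols c)%:Z ->
           b = (pos c).2) /\
        (exists a : int, (a, (rows c)%:Z) \in visited (walk_of c))].

Lemma walk_of_fits c : admissible c -> fits c.
Proof.
elim: c => [_|s c IHc].
  split=> //; first exact: valid_nil.
  - by move=> a b; rewrite mem_seq1 siteE => /andP[/eqP-> /eqP->].
  - split=> [a b|]; last by exists 0; rewrite mem_head.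
    by rewrite mem_seq1 siteE => /andP[/eqP-> /eqP->].
move=> adm; have adm_c : admissible c by case: s adm => n /= /andP[].
have [vc box rowc colc] := IHc adm_c; have [px py] := pos_le adm_c.
have lc := last_walk_of c; have pr := @pos_row c; have pc := @pos_col c.
case posE: (pos c) lc px py pr pc rowc colc => [x y] lc /= px py pr pc rowc colc.
have [rc|rc] := boolP (on_row c).
  have {colc pc} := pr rc; have [row_c [b0 b0_gt b0_c]] := rowc rc => yE.
  have run_c t : (0 <= t <= (cols c)%:Z)%R ->
      valid (walk_of c ++ hrun (x, y) t) /\
      last 0 (walk_of c ++ hrun (x, y) t) = (t, y).
    move=> ht; split; last by rewrite last_cat lc last_hrun.
    rewrite /hrun /=; case: leP => h.
      apply: valid_east => // a b hab; last by case: (box _ _ hab); lia.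
      by move=> hb; rewrite (row_c _ _ hab) //; lia.
    apply: valid_west => // a b hab; last by case: (box _ _ hab); lia.
    by move=> hb; rewrite (row_c _ _ hab) //; lia.
  have mem_c t a b : (0 <= t <= (cols c)%:Z)%R ->
      (a, b) \in visited (walk_of c ++ hrun (x, y) t) ->
      (0 <= a <= (cols c)%:Z /\ b <= (rows c)%:Z)%R.
    by move=> ht; rewrite visited_cat => /orP[/box//|/mem_hrun]; lia.
  case: s adm => [d|n] /=; rewrite rc adm_c /=; [move/eqP=> -> | move=> n_le].
    have hR : (0 <= (cols c)%:Z <= (cols c)%:Z)%R by lia.
    have [v1 l1] := run_c _ hR; have m1 := mem_c _ _ _ hR.
    rewrite /fits /= /approach rc posE subr0 -yE.
    split=> //.
    - apply/validS; split=> //; apply: good_east l1 _ _ => [a b /m1|]; first lia.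
      by right=> a b /m1; lia.
    - by move=> a b; rewrite visited_rcons siteE => /orP[/m1|]; lia.
    - move=> _; split=> [a b|].
        by rewrite visited_rcons siteE => /orP[/m1|]; lia.
      by exists x; rewrite visited_rcons visited_cat -lc last_visited.
  have hn : (0 <= n%:Z <= (cols c)%:Z)%R by lia.
  have [v1 l1] := run_c _ hn; have m1 := mem_c _ _ _ hn.
  rewrite /fits /= /approach rc posE -yE.
  split=> //.
  - apply/validS; split=> //; apply: good_north l1 _ _ => [a b /m1|]; first lia.
    by right=> a b /m1; lia.
  - by move=> a b; rewrite visited_rcons siteE => /orP[/m1|]; lia.
  - move=> _; split=> [a b|].
      by rewrite visited_rcons siteE => /orP[/m1|]; lia.
    by exists b0 => //; rewrite visited_rcons visited_cat b0_c.
have {rowc pr} := pc rc; have [col_c [a0 a0_c]] := colc rc => xE.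
have run_c t : (t <= (rows c)%:Z)%R ->
    valid (walk_of c ++ vrun (x, y) t) /\
    last 0 (walk_of c ++ vrun (x, y) t) = (x, t).
  move=> ht; split; last by rewrite last_cat lc last_vrun.
  rewrite /vrun /=; case: leP => h.
    apply: valid_north => // [a b hab|].
      by move=> hb; rewrite (col_c _ _ hab) //; lia.
    by left=> a b /box; lia.
  apply: valid_south => // [a b hab|].
    by move=> hb; rewrite (col_c _ _ hab) //; lia.
  by left=> a b /box; lia.
have mem_c t a b : (t <= (rows c)%:Z)%R ->
    (a, b) \in visited (walk_of c ++ vrun (x, y) t) ->
    (0 <= a <= (cols c)%:Z /\ b <= (rows c)%:Z)%R.
  by move=> ht; rewrite visited_cat => /orP[/box//|/mem_vrun]; lia.
case: s adm => [d|n] /=; rewrite (negbTE rc) adm_c /=; [move=> _ | move/eqP=> ->].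
  have hd : ((rows c)%:Z - d%:Z <= (rows c)%:Z)%R by lia.
  have [v1 l1] := run_c _ hd; have m1 := mem_c _ _ _ hd.
  rewrite /fits /= /approach (negbTE rc) posE -xE.
  split=> //.
  - apply/validS; split=> //; apply: good_east l1 _ _ => [a b /m1|]; first lia.
    by left=> a b /m1; lia.
  - by move=> a b; rewrite visited_rcons siteE => /orP[/m1|]; lia.
  - move=> _; split=> [a b|].
      by rewrite visited_rcons siteE => /orP[/m1|]; lia.
    by exists a0; rewrite visited_rcons visited_cat a0_c.
have hT : ((rows c)%:Z <= (rows c)%:Z)%R by lia.
have [v1 l1] := run_c _ hT; have m1 := mem_c _ _ _ hT.
rewrite /fits /= /approach (negbTE rc) posE -xE.
split=> //.
- apply/validS; split=> //; apply: good_north l1 _ _ => [a b /m1|]; first lia.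
  by right=> a b /m1; lia.
- by move=> a b; rewrite visited_rcons siteE => /orP[/m1|]; lia.
- move=> _; split=> [a b|].
    by rewrite visited_rcons siteE => /orP[/m1|]; lia.
  by exists ((rows c)%:Z + 1); rewrite ?visited_rcons ?xE ?eqxx ?orbT //; lia.
Qed.

(** * The shoelace sum of the walk of a code *)

Lemma shoelace_cat p u v : shoelace p (u ++ v) = shoelace p u + shoelace (last p u) v.
Proof.
rewrite /shoelace; elim: u p => [|a u IHu] p /=; first by rewrite big_nil add0r.
by rewrite !big_cons IHu addrA.
Qed.

Lemma shoelace_rcons p u q :
  shoelace p (rcons u q) = shoelace p u + (last p u).1 * (q.2 - (last p u).2).
Proof. by rewrite -cats1 shoelace_cat /shoelace /= big_seq1. Qed.

Lemma shoelace_vert x y dy k : shoelace (x, y) (run 0 dy (x, y) k) = x * dy * k%:Z.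
Proof.
elim: k => [|k IHk]; first by rewrite /shoelace big_nil mulr0.
by rewrite runS shoelace_rcons IHk last_run /=; ring.
Qed.

Lemma shoelace_horiz x y dx k : shoelace (x, y) (run dx 0 (x, y) k) = 0.
Proof.
elim: k => [|k IHk]; first by rewrite /shoelace big_nil.
by rewrite runS shoelace_rcons IHk last_run /=; ring.
Qed.

Lemma shoelace_hrun x y x' : shoelace (x, y) (hrun (x, y) x') = 0.
Proof. by rewrite /hrun; case: ifP => _; rewrite shoelace_horiz. Qed.

Lemma shoelace_vrun x y y' : shoelace (x, y) (vrun (x, y) y') = x * (y' - y).
Proof.
rewrite /vrun /=; case: leP => h; rewrite shoelace_vert.
  by rewrite mulr1 gez0_abs // subr_ge0.
by rewrite gtz0_abs ?subr_gt0 //; ring.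
Qed.

(* The closing part of the curve turns the left-hand side into the weight. *)
Lemma shoelace_walk_of c : admissible c ->
  shoelace 0 (walk_of c) =
  (weight c)%:Z - ((pos c).1 + 1) * ((rows c)%:Z - (pos c).2) - (pos c).2.
Proof.
elim: c => [_|s c IHc]; first by rewrite /shoelace big_nil /=; lia.
move=> adm; have adm_c : admissible c by case: s adm => n /= /andP[].
have pr := @pos_row c; have pc := @pos_col c.
rewrite /= shoelace_rcons shoelace_cat {}IHc // last_cat last_walk_of /approach.
case: (pos c) pr pc => x y /= pr pc.
have [rc|rc] := boolP (on_row c).
  rewrite pr // last_hrun shoelace_hrun.
  case: s adm => [d|n] /=; rewrite rc adm_c /=; [move/eqP=> -> | move=> _].
    by ring.
  by rewrite -[n.+1]addn1 -[(rows c).+1]addn1 !PoszD; ring.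
rewrite pc // last_vrun shoelace_vrun.
case: s adm => [d|n] /=; rewrite (negbTE rc) adm_c /=; [move=> _ | move/eqP=> ->].
  by rewrite !PoszD; ring.
by rewrite -[(cols c).+1]addn1 -[(rows c).+1]addn1 !PoszD; ring.
Qed.

(** Reads the code back from the walk. The state holds the east and north bounds so far and the
    code; only sites beyond these bounds are recorded, so the closing part of a polygon leaves the
    code unchanged. *)
Definition scan (st : int * int * code) (q : site) : int * int * code :=
  let: (R, T, c) := st in
  if (R < q.1)%R then (q.1, T, inl `|(T - q.2)%R|%N :: c)
  else if (T < q.2)%R then (R, q.2, inr `|q.1|%N :: c) else st.

Definition decode (w : walk) : code := (foldl scan (0, 0, [::]) w).2.

Lemma scan_box (R T : int) c r :
  (forall a b : int, (a, b) \in r -> (a <= R)%R /\ (b <= T)%R) ->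
  foldl scan (R, T, c) r = (R, T, c).
Proof.
elim: r => [//|[a b] r IHr] h /=.
have [ha hb] := h a b (mem_head _ _).
rewrite ltNge ha ltNge hb /=; apply: IHr => a' b' r'.
by apply: h; rewrite inE r' orbT.
Qed.

Lemma scan_walk_of c : admissible c ->
  foldl scan (0, 0, [::]) (walk_of c) = ((cols c)%:Z, (rows c)%:Z, c).
Proof.
elim: c => [//|s c IHc].
move=> adm; have adm_c : admissible c by case: s adm => n /= /andP[].
have pr := @pos_row c; have pc := @pos_col c; have [px py] := pos_le adm_c.
rewrite /= -cats1 !foldl_cat IHc //.
case posE: (pos c) pr pc px py => [x y] /= pr pc px py.
rewrite scan_box; last first.
  move=> a b; rewrite /approach posE; case: ifP => [rc|/negbT rc].
    have := pr rc; case: s adm => [d|n] /=; rewrite rc adm_c /=.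
      by move=> _ ? /mem_hrun; lia.
    by move=> hn ? /mem_hrun; lia.
  by have := pc rc; case: s {adm} => [d|n] /= ? /mem_vrun; lia.
case: s adm => [d|n] /=; rewrite adm_c => hs.
  have -> : ((cols c)%:Z < (cols c)%:Z + 1)%R by lia.
  by congr (_, _, inl _ :: _); lia.
have -> : ((cols c)%:Z < n%:Z)%R = false.
  by move: hs; case: (on_row c) => /=; lia.
have -> : ((rows c)%:Z < (rows c)%:Z + 1)%R by lia.
by congr (_, _, _); lia.
Qed.

(** * Confined walks *)

Lemma valid_walk w : valid w -> is_walk w. Proof. by case=> -[]. Qed.

Lemma valid_uniq w : valid w -> uniq (visited w). Proof. by case=> -[]. Qed.

Lemma valid_catl u r : valid (u ++ r) -> valid u.
Proof.
by elim/last_ind: r => [|r q IHr]; rewrite ?cats0 // -rcons_cat => /validS[/IHr].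
Qed.

(** Discrete intermediate values: the height changes by at most one per step. *)
Lemma path_level p w (a b y : int) : path adjacent p w -> (a, b) \in p :: w ->
  (p.2 <= y <= b \/ b <= y <= p.2)%R -> exists a', (a', y) \in p :: w.
Proof.
elim: w p => [|q w IHw] [px py] /=.
  rewrite mem_seq1 => _ /eqP[_ ->] h; exists px; rewrite mem_seq1.
  by apply/eqP; congr pair; lia.
case/andP=> /adjacentP /= adj pw; rewrite inE => /predU1P[[_ ->]|ab_w] h.
  by exists px; rewrite inE; apply/orP; left; apply/eqP; congr pair; lia.
have [->|ney] := eqVneq y py; first by exists px; rewrite mem_head.
have [|a' a'_w] := IHw q pw ab_w; last by exists a'; rewrite inE a'_w orbT.
by case: adj => ->  /=; lia.
Qed.

Lemma walk_level w (a1 b1 a2 b2 y : int) : is_walk w ->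
  (a1, b1) \in visited w -> (a2, b2) \in visited w -> (b1 <= y <= b2)%R ->
  exists a, (a, y) \in visited w.
Proof.
move=> ww h1 h2 h; have [y0|y0] := leP 0 y.
  by apply: path_level h2 _ => //=; lia.
by apply: path_level h1 _ => //=; lia.
Qed.

Lemma last_approach c s : admissible (s :: c) ->
  last 0 (walk_of c ++ approach c s) =
  match s with
  | inl d => ((cols c)%:Z, (rows c)%:Z - d%:Z)
  | inr a => (a%:Z, (rows c)%:Z)
  end.
Proof.
move=> adm; rewrite last_cat last_walk_of /approach.
have pr := @pos_row c; have pc := @pos_col c; case: (pos c) pr pc => x y /= pr pc.
have [rc|rc] := boolP (on_row c).
  rewrite last_hrun pr //; case: s adm => [d|n] //=.
  by rewrite rc => /andP[_ /eqP->]; rewrite subr0.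
rewrite last_vrun pc //; case: s adm => [d|n] //=.
by rewrite (negbTE rc) => /andP[_ /eqP->].
Qed.

(** The site from which the last column was entered; it forbids an immediate step back. [entry_row]
    plays the same role for the top row. *)
Lemma entry_col c : admissible c -> ~~ on_row c -> (0 < cols c)%N ->
  ((cols c)%:Z - 1, (pos c).2) \in visited (walk_of c).
Proof.
case: c => [|[d|a] c] // adm _ _; rewrite /= visited_rcons.
have -> : (cols c).+1%:Z - 1 = (cols c)%:Z by lia.
by have := last_visited (walk_of c ++ approach c (inl d)); rewrite last_approach // => ->.
Qed.

Lemma entry_row c : admissible c -> on_row c ->
  ((pos c).1, (rows c)%:Z - 1) \in visited (walk_of c).
Proof.
case: c => [|[d|a] c] // adm _; rewrite /= visited_rcons.
have -> : (rows c).+1%:Z - 1 = (rows c)%:Z by lia.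
by have := last_visited (walk_of c ++ approach c (inr a)); rewrite last_approach // => ->.
Qed.

(* The walks in the half-plane [x >= 0] consist of the walk of a code followed
   by a straight run that does not enlarge the box upwards or eastwards. *)
Inductive confined : walk -> Prop :=
| Confined_north c k of admissible c & ~~ on_row c &
    ((pos c).2 + k%:Z <= (rows c)%:Z)%R : confined (walk_of c ++ run 0 1 (pos c) k)
| Confined_south c k of admissible c & ~~ on_row c :
    confined (walk_of c ++ run 0 (-1) (pos c) k)
| Confined_east c k of admissible c & on_row c &
    ((pos c).1 + k%:Z <= (cols c)%:Z)%R : confined (walk_of c ++ run 1 0 (pos c) k)
| Confined_west c k of admissible c & on_row c & (k%:Z <= (pos c).1)%R :
    confined (walk_of c ++ run (-1) 0 (pos c) k).

Lemma confined_walk_of c : admissible c -> confined (walk_of c).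
Proof.
move=> adm; have [h1 h2] := pos_le adm.
have [rc|rc] := boolP (on_row c).
  by have := @Confined_east c 0 adm rc; rewrite cats0; apply; lia.
by have := @Confined_south c 0 adm rc; rewrite cats0.
Qed.

Lemma good_adjacent w q (x y : int) : good w q -> last 0 w = (x, y) ->
  [\/ q = (x, y + 1), q = (x, y - 1), q = (x + 1, y) | q = (x - 1, y)].
Proof. by case/and4P=> /adjacentP + _ _ _ lw; rewrite lw. Qed.

Lemma good_free w q (x y a b : int) : good w q -> last 0 w = (x, y) ->
  (a, b) \in visited w -> ~~ ahead (x, y) q (a, b).
Proof. by case/and4P=> _ /allP free _ _ lw /free; rewrite lw. Qed.

Lemma valid_ends w (x y : int) : valid w -> last 0 w = (x, y) ->
  [\/ forall a b : int, (a, b) \in visited w -> (b <= y)%R,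
      forall a b : int, (a, b) \in visited w -> (a <= x)%R |
      forall a b : int, (a, b) \in visited w -> (x <= a)%R].
Proof.
move=> [_ [/(_ (size w) (leqnn _)) + _]] lw; rewrite take_size.
by move/ends_on_NEW_sideP; rewrite lw => -[] h;
  [constructor 1|constructor 2|constructor 3] => a b /h.
Qed.

Lemma good_ends w (x y : int) : good w (x, y) ->
  [\/ forall a b : int, (a, b) \in visited w -> (b <= y)%R,
      forall a b : int, (a, b) \in visited w -> (a <= x)%R |
      forall a b : int, (a, b) \in visited w -> (x <= a)%R].
Proof.
case/and4P=> _ _ /ends_on_NEW_sideP + _; rewrite last_rcons => -[] h;
  [constructor 1|constructor 2|constructor 3] => a b ab;
  by apply: (h (a, b)); rewrite visited_rcons ab.
Qed.

Lemma confined_step_north c k q : admissible c -> ~~ on_row c ->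
  ((pos c).2 + k%:Z <= (rows c)%:Z)%R ->
  good (walk_of c ++ run 0 1 (pos c) k) q -> (0 <= q.1)%R ->
  confined (rcons (walk_of c ++ run 0 1 (pos c) k) q).
Proof.
move=> adm rc; have [vc box _ /(_ rc) [colc [a0 a0_c]]] := walk_of_fits adm.
have lc := last_walk_of c; have pc := pos_col rc; have [px py] := pos_le adm.
have := @entry_col c adm rc.
case posE: (pos c) lc pc px py colc => [x y] lc /= pc px py colc entry hk g q0.
have pos_c : (x, y) \in visited (walk_of c) by rewrite -lc last_visited.
have lw := last_cat_run 0 1 k lc.
have free a b := good_free (a := a) (b := b) g lw.
have := good_adjacent g lw; rewrite mul0r addr0 mul1r in lw free * => -[] eq.
- have [h|h] := leP (y + k.+1%:Z) (rows c)%:Z.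
    suff -> : rcons (walk_of c ++ run 0 1 (x, y) k) q = walk_of c ++ run 0 1 (pos c) k.+1.
      by apply: Confined_north; rewrite ?posE.
    by rewrite posE runS -rcons_cat eq /=; congr rcons; congr pair; lia.
  suff -> : rcons (walk_of c ++ run 0 1 (x, y) k) q = walk_of (inr (cols c) :: c).
    by apply: confined_walk_of; rewrite /= adm (negbTE rc) eqxx.
  rewrite /= /approach (negbTE rc) posE /vrun /= py eq; congr (rcons (_ ++ _) _).
    by congr run; lia.
  by congr pair; lia.
- have [k0|k0] := posnP k; last first.
    have : (x, y + k%:Z - 1) \in visited (walk_of c ++ run 0 1 (x, y) k).
      have [->|k1] := eqVneq k 1%N; first by rewrite visited_cat addrK pos_c.
      by rewrite visited_cat mem_run; apply/orP; right; lia.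
    by move/free; rewrite eq /ahead /=; lia.
  suff -> : rcons (walk_of c ++ run 0 1 (x, y) k) q = walk_of c ++ run 0 (-1) (pos c) 1.
    exact: Confined_south.
  by rewrite k0 cats0 -cats1 posE eq /run /=; congr (_ ++ [:: (_, _)]); lia.
- suff -> : rcons (walk_of c ++ run 0 1 (x, y) k) q =
      walk_of (inl `|((rows c)%:Z - (y + k%:Z))%R|%N :: c).
    by apply: confined_walk_of; rewrite /= adm (negbTE rc).
  rewrite /= /approach (negbTE rc) posE /vrun /= eq; case: ifP => h; last lia.
  congr (rcons (_ ++ _) _); first by congr run; lia.
  by congr pair; lia.
(* West is blocked. For an empty run this is the site just left. Otherwise the walk also has a site
   in its top row, hence one at the present height; it cannot be in the last column, where only the
   start of the run was visited, so it lies to the west. *)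
- exfalso; rewrite eq /= in q0.
  have [k0|k0] := posnP k.
    have /free : (x - 1, y) \in visited (walk_of c ++ run 0 1 (x, y) k).
      by rewrite visited_cat pc entry //; lia.
    by rewrite eq /ahead /=; lia.
  have [|a a_c] := walk_level (y := y + k%:Z) (valid_walk vc) pos_c a0_c; first lia.
  have [ha _] := box _ _ a_c.
  have ax : a != x by apply/eqP => ax; have := colc _ _ a_c; lia.
  have /free : (a, y + k%:Z) \in visited (walk_of c ++ run 0 1 (x, y) k).
    by rewrite visited_cat a_c.
  by rewrite eq /ahead /=; lia.
Qed.

Lemma confined_step_south c k q : admissible c -> ~~ on_row c ->
  valid (rcons (walk_of c ++ run 0 (-1) (pos c) k) q) -> (0 <= q.1)%R ->
  confined (rcons (walk_of c ++ run 0 (-1) (pos c) k) q).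
Proof.
move=> adm rc /validS[vw g].
have [k0|k0] := posnP k.
  move: g; rewrite k0 => g; apply: (confined_step_north (k := 0)) => //.
  by have [_ +] := pos_le adm; lia.
have [vc box _ /(_ rc) [colc _]] := walk_of_fits adm.
have lc := last_walk_of c; have pc := pos_col rc; have [px py] := pos_le adm.
case posE: (pos c) vw g lc pc px py colc => [x y] vw g lc /= pc px py colc q0.
have pos_c : (x, y) \in visited (walk_of c) by rewrite -lc last_visited.
have lw := last_cat_run 0 (-1) k lc.
have free a b := good_free (a := a) (b := b) g lw.
have nf : ~~ forbidden_step (walk_of c ++ run 0 (-1) (x, y) k) q by case/and4P: g.
have := good_adjacent g lw; rewrite mul0r addr0 mulN1r in lw free * => -[] eq.
- have : (x, y - k%:Z + 1) \in visited (walk_of c ++ run 0 (-1) (x, y) k).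
    have [->|k1] := eqVneq k 1%N; first by rewrite visited_cat subrK pos_c.
    by rewrite visited_cat mem_run; apply/orP; right; lia.
  by move/free; rewrite eq /ahead /=; lia.
- suff -> : rcons (walk_of c ++ run 0 (-1) (x, y) k) q = walk_of c ++ run 0 (-1) (pos c) k.+1.
    exact: Confined_south.
  by rewrite posE runS -rcons_cat eq /=; congr rcons; congr pair; lia.
- suff -> : rcons (walk_of c ++ run 0 (-1) (x, y) k) q =
      walk_of (inl `|((rows c)%:Z - (y - k%:Z))%R|%N :: c).
    by apply: confined_walk_of; rewrite /= adm (negbTE rc).
  rewrite /= /approach (negbTE rc) posE /vrun /= eq; case: ifP => h; first lia.
  congr (rcons (_ ++ _) _); first by congr run; lia.
  by congr pair; lia.
(* This is where the convention on forbidden steps enters. Prudence puts all earlier sites above the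
   present row. The new site can then only be on the west side of the box, in column 0, so the box
   has width one and the step runs from its south-east to its south-west corner. *)
- exfalso; rewrite eq /= in q0.
  have above a b : (a, b) \in visited (walk_of c) -> (y - k%:Z < b)%R.
    move=> ab_c; rewrite ltNge; apply/negP => hb.
    have [|a' a'_c] := walk_level (y := y - k%:Z) (valid_walk vc) ab_c pos_c; first lia.
    have [ha _] := box _ _ a'_c.
    have ax : a' != x by apply/eqP => ax; have := colc _ _ a'_c; lia.
    have /free : (a', y - k%:Z) \in visited (walk_of c ++ run 0 (-1) (x, y) k).
      by rewrite visited_cat a'_c.
    by rewrite eq /ahead /=; lia.
  have pos_w : (x, y) \in visited (walk_of c ++ run 0 (-1) (x, y) k).
    by rewrite visited_cat pos_c.
  have R1 : (cols c)%:Z = 1.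
    have := mem_head 0 (walk_of c ++ run 0 (-1) (x, y) k); rewrite -/(visited _) => w0.
    by move: g; rewrite eq => /good_ends[] h; have := h _ _ pos_w; have := h 0 0 w0 => /=; lia.
  case/negP: nf; apply/forbidden_stepP; rewrite lw eq /=; split=> //.
  - by right.
  - move=> [a b]; rewrite visited_cat mem_run => /orP[h|/=]; last lia.
    by have := above _ _ h; have := box _ _ h => /=; lia.
  - by exists 0; rewrite ?mem_head //=; lia.
  - by exists (x, y) => //=; lia.
Qed.

Lemma mem_origin w : (0, 0) \in visited w.
Proof. exact: mem_head. Qed.

Lemma confined_step_east c k q : admissible c -> on_row c ->
  ((pos c).1 + k%:Z <= (cols c)%:Z)%R ->
  good (walk_of c ++ run 1 0 (pos c) k) q -> (0 <= q.1)%R ->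
  confined (rcons (walk_of c ++ run 1 0 (pos c) k) q).
Proof.
move=> adm rc; have [vc box /(_ rc) [rowc [b0 b0_gt b0_c]] _] := walk_of_fits adm.
have lc := last_walk_of c; have pr := pos_row rc; have [px py] := pos_le adm.
have := entry_row adm rc; have T0 := rows_gt0 rc.
case posE: (pos c) lc pr px py rowc => [x y] lc /= pr px py rowc entry hk g q0.
have pos_c : (x, y) \in visited (walk_of c) by rewrite -lc last_visited.
have lw := last_cat_run 1 0 k lc.
have free a b := good_free (a := a) (b := b) g lw.
have := good_adjacent g lw; rewrite mul0r addr0 mul1r in lw free * => -[] eq.
- suff -> : rcons (walk_of c ++ run 1 0 (x, y) k) q =
      walk_of (inr `|(x + k%:Z)%R|%N :: c).
    by apply: confined_walk_of; rewrite /= adm rc /=; lia.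
  rewrite /= /approach rc posE /hrun /= eq; case: ifP => h; last lia.
  congr (rcons (_ ++ _) _); first by congr run; lia.
  by congr pair; lia.
(* After a nonempty run, a step south leaves the top row and is not in column 0, so it would have to
   be on the east side; there an older site of the last column lies straight below. *)
- exfalso; have in_c a b : (a, b) \in visited (walk_of c) -> ~~ ahead (x + k%:Z, y) q (a, b).
    by move=> ab; apply: free; rewrite visited_cat ab.
  have [k0|k0] := posnP k.
    by have := in_c _ _ entry; rewrite eq /ahead /=; lia.
  move: g; rewrite eq => /good_ends[] h.
  + by have := h x y; rewrite visited_cat pos_c; lia.
  + have := h (cols c)%:Z b0; rewrite visited_cat b0_c => /(_ isT) R_le.
    have [_ b0T] := box _ _ b0_c; have b0y : b0 != y.
      by apply/eqP => e; have := rowc _ _ b0_c; lia.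
    by have := in_c _ _ b0_c; rewrite eq /ahead /=; lia.
  + by have := h _ _ (mem_origin _); lia.
- have [h|h] := leP (x + k.+1%:Z) (cols c)%:Z.
    suff -> : rcons (walk_of c ++ run 1 0 (x, y) k) q = walk_of c ++ run 1 0 (pos c) k.+1.
      by apply: Confined_east; rewrite ?posE.
    by rewrite posE runS -rcons_cat eq /=; congr rcons; congr pair; lia.
  suff -> : rcons (walk_of c ++ run 1 0 (x, y) k) q = walk_of (inl 0%N :: c).
    by apply: confined_walk_of; rewrite /= adm rc.
  rewrite /= /approach rc posE /hrun /= eq; case: ifP => h'; last lia.
  congr (rcons (_ ++ _) _); first by congr run; lia.
  by congr pair; lia.
- have [k0|k0] := posnP k; last first.
    have : (x + k%:Z - 1, y) \in visited (walk_of c ++ run 1 0 (x, y) k).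
      have [->|k1] := eqVneq k 1%N; first by rewrite visited_cat addrK pos_c.
      by rewrite visited_cat mem_run; apply/orP; right; lia.
    by move/free; rewrite eq /ahead /=; lia.
  suff -> : rcons (walk_of c ++ run 1 0 (x, y) k) q = walk_of c ++ run (-1) 0 (pos c) 1.
    by apply: Confined_west => //; rewrite posE /=; move: q0; rewrite eq /=; lia.
  by rewrite k0 cats0 -cats1 posE eq /run /=; congr (_ ++ [:: (_, _)]); lia.
Qed.

Lemma confined_step_west c k q : admissible c -> on_row c ->
  (k%:Z <= (pos c).1)%R ->
  good (walk_of c ++ run (-1) 0 (pos c) k) q -> (0 <= q.1)%R ->
  confined (rcons (walk_of c ++ run (-1) 0 (pos c) k) q).
Proof.
move=> adm rc.
have [k0|k0] := posnP k.
  rewrite k0 => _ g; apply: (confined_step_east (k := 0)) => //.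
  by have [+ _] := pos_le adm; lia.
have [vc box /(_ rc) [rowc [b0 b0_gt b0_c]] _] := walk_of_fits adm.
have lc := last_walk_of c; have pr := pos_row rc; have [px py] := pos_le adm.
have T0 := rows_gt0 rc.
case posE: (pos c) lc pr px py rowc => [x y] lc /= pr px py rowc hk g q0.
have pos_c : (x, y) \in visited (walk_of c) by rewrite -lc last_visited.
have lw := last_cat_run (-1) 0 k lc.
have free a b := good_free (a := a) (b := b) g lw.
have := good_adjacent g lw; rewrite mul0r addr0 mulN1r in lw free * => -[] eq.
- suff -> : rcons (walk_of c ++ run (-1) 0 (x, y) k) q =
      walk_of (inr `|(x - k%:Z)%R|%N :: c).
    by apply: confined_walk_of; rewrite /= adm rc /=; lia.
  rewrite /= /approach rc posE /hrun /= eq; case: ifP => h; first lia.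
  congr (rcons (_ ++ _) _); first by congr run; lia.
  by congr pair; lia.
(* A step south could only stay on the west side, in column 0, where the origin lies straight
   below. *)
- exfalso; move: g; rewrite eq => /good_ends[] h.
  + by have := h x y; rewrite visited_cat pos_c; lia.
  + by have := h x y; rewrite visited_cat pos_c; lia.
  + have := h _ _ (mem_origin _).
    by have := free _ _ (mem_origin _); rewrite eq /ahead /=; lia.
- have : (x - k%:Z + 1, y) \in visited (walk_of c ++ run (-1) 0 (x, y) k).
    have [->|k1] := eqVneq k 1%N; first by rewrite visited_cat subrK pos_c.
    by rewrite visited_cat mem_run; apply/orP; right; lia.
  by move/free; rewrite eq /ahead /=; lia.
- suff -> : rcons (walk_of c ++ run (-1) 0 (x, y) k) q = walk_of c ++ run (-1) 0 (pos c) k.+1.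
    by apply: Confined_west; rewrite ?posE //=; move: q0; rewrite eq /=; lia.
  by rewrite posE runS -rcons_cat eq /=; congr rcons; congr pair; lia.
Qed.

Lemma confined_valid w : valid w ->
  (forall a b : int, (a, b) \in visited w -> (0 <= a)%R) -> confined w.
Proof.
elim/last_ind: w => [_ _|w [a b] IHw vwq h]; first exact: (confined_walk_of (c := [::])).
have /validS[vw g] := vwq.
have q0 : (0 <= (a, b).1)%R by apply: (h a b); rewrite visited_rcons eqxx orbT.
have cw : confined w by apply: IHw => // a' b' ab; apply: (h a' b'); rewrite visited_rcons ab.
case: cw vwq g => [c k adm rc hk|c k adm rc|c k adm rc hk|c k adm rc hk] vwq g.
- exact: confined_step_north.
- exact: confined_step_south.
- exact: confined_step_east.
- exact: confined_step_west.
Qed.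

Definition to_west (c : code) : walk := walk_of c ++ run (-1) 0 (pos c) `|(pos c).1|%N.

Lemma cols0_nil c : admissible c -> ~~ on_row c -> cols c = 0%N -> c = [::].
Proof. by case: c => [|[]]. Qed.

(** A nonempty code whose latest symbol is an east step puts the walk in column [cols c > 0], and
    the vertical run keeps it there. So column 0 is occupied either during the initial descent or in
    the top row. *)
Lemma confined_left w (y : int) : confined w -> last 0 w = (0, y) ->
  (exists k, w = run 0 (-1) (0, 0) k) \/
  exists c, [/\ admissible c, on_row c, y = (rows c)%:Z & w = to_west c].
Proof.
case=> [c k adm rc hk|c k adm rc|c k adm rc hk|c k adm rc hk];
  have [px py] := pos_le adm; have lc := last_walk_of c.
- have pc := pos_col rc; case posE: (pos c) lc => [x y'] lc.
  rewrite (last_cat_run _ _ _ lc) => -[e1 e2].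
  have c0 : c = [::] by apply: cols0_nil => //; move: pc; rewrite posE /=; lia.
  move: posE hk; rewrite c0 /= => -[<- <-] /= hk; left; exists 0%N.
  by have -> : k = 0%N by lia.
- have pc := pos_col rc; case posE: (pos c) lc => [x y'] lc.
  rewrite (last_cat_run _ _ _ lc) => -[e1 e2].
  have c0 : c = [::] by apply: cols0_nil => //; move: pc; rewrite posE /=; lia.
  by move: posE; rewrite c0 /= => -[<- <-]; left; exists k.
- have pr := pos_row rc; case posE: (pos c) lc => [x y'] lc.
  rewrite (last_cat_run _ _ _ lc) => -[e1 e2]; right; exists c.
  move: px pr; rewrite posE /= => px pr; split=> //; first lia.
  rewrite /to_west posE /=.
  have -> : x = 0 by lia.
  by have -> : k = 0%N by lia.
- have pr := pos_row rc; case posE: (pos c) lc => [x y'] lc.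
  rewrite (last_cat_run _ _ _ lc) => -[e1 e2]; right; exists c.
  move: px pr; rewrite posE /= => px pr; split=> //; first lia.
  rewrite /to_west posE /=.
  by have -> : k = `|x|%N by lia.
Qed.

(** The walk is split at its first step to a negative abscissa: what precedes is confined and ends
    in column 0, so [confined_left] describes it. *)
Lemma crossing w : valid w -> (exists2 a : int, (a < 0)%R & exists b, (a, b) \in visited w) ->
  exists u y r, [/\ w = u ++ (-1, y) :: r, last 0 u = (0, y),
    (forall a b : int, (a, b) \in visited u -> (0 <= a)%R) &
    (exists k, u = run 0 (-1) (0, 0) k) \/
    exists c, [/\ admissible c, on_row c, y = (rows c)%:Z & u = to_west c]].
Proof.
elim/last_ind: w => [_ [a a0 [b]]|w q IHw /validS[vw g] [a a0 [b]]].
  by rewrite mem_seq1 => /eqP[e _]; move: a0; rewrite e.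
have [neg _|nneg] := pselect (exists2 a : int, (a < 0)%R & exists b, (a, b) \in visited w).
  have [u [y [r [-> lu hu hh]]]] := IHw vw neg.
  by exists u, y, (rcons r q); rewrite rcons_cat.
have {}nneg a' b' : (a', b') \in visited w -> (0 <= a')%R.
  by move=> ab; rewrite leNgt; apply/negP => ?; apply: nneg; exists a' => //; exists b'.
rewrite visited_rcons => /orP[/nneg|/eqP eq]; first lia.
case lw: (last 0 w) => [x y].
have x0 : (0 <= x)%R by apply: (nneg x y); rewrite -lw last_visited.
have := good_adjacent g lw; rewrite -eq => -[] [ea eb]; try lia.
have {ea}[ea ex] : a = -1 /\ x = 0 by lia.
exists w, y, [::]; rewrite cats1 ea eb; split=> //; first by rewrite lw ex.
by apply: confined_left; [exact: confined_valid | rewrite lw ex].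
Qed.

(** * Classification of the polygons *)

(* Up to reflection, a 3-sided prudent polygon is a [polyC] if it ends at [(-1, 0)]
   by a south step, a [polyA] if it ends at [(0, 1)] by a west step, and a [polyB]
   if it ends at [(1, 0)] by a north step. *)
Definition polyC (c : code) : walk :=
  rcons (to_west c) (-1, (rows c)%:Z) ++ run 0 (-1) (-1, (rows c)%:Z) (rows c).

(** Ending in row 1, the walk records a single north step, made in the last column after all the
    east steps. *)
Definition codeA (ds : seq nat) : code := inr (size ds) :: [seq inl d | d <- ds].

Definition polyA (ds : seq nat) : walk := to_west (codeA ds).

Definition polyB (k : nat) : walk := walk_of [:: inl k] ++ run 0 1 (1, - k%:Z) k.

Lemma last_to_west c : admissible c -> on_row c -> last 0 (to_west c) = (0, (rows c)%:Z).
Proof.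
move=> adm rc; have [px _] := pos_le adm; have pr := pos_row rc.
rewrite /to_west last_cat last_walk_of last_run.
by case: (pos c) px pr => x y /= px pr; congr pair; lia.
Qed.

Lemma mem_to_west c (a b : int) : admissible c -> on_row c ->
  (a, b) \in visited (to_west c) -> (0 <= a <= (cols c)%:Z /\ b <= (rows c)%:Z)%R.
Proof.
move=> adm rc; have [_ box _ _] := walk_of_fits adm.
have [px _] := pos_le adm; have pr := pos_row rc.
rewrite /to_west visited_cat => /orP[/box//|].
by case: (pos c) px pr => x y /= px pr; rewrite mem_run; lia.
Qed.

(* The part of the column [x = -1] below [(-1, T)] can only be entered from
   [(-1, T)] itself. *)
Lemma no_return c w r : admissible c -> on_row c ->
  w = rcons (to_west c) (-1, (rows c)%:Z) ++ (-1, (rows c)%:Z + 1) :: r ->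
  valid w ->
  (forall a b : int, (a, b) \in visited w -> (-1 <= a)%R /\ (a = -1 -> (0 <= b)%R)) ->
  forall b : int, (b < (rows c)%:Z)%R -> (-1, b) \notin visited w.
Proof.
move=> adm rc; have [vc box _ _] := walk_of_fits adm.
have mw := mem_to_west adm rc; have lw := last_to_west adm rc; have T0 := rows_gt0 rc.
elim/last_ind: r w => [|r [a' b'] IHr] w -> vw low b b_lt.
  rewrite visited_cat visited_rcons !siteE mem_seq1 siteE.
  by apply/negP; case: (boolP (_ \in _)) => [/mw|_] /=; lia.
move: vw low; rewrite -rcons_cons -rcons_cat.
set v := rcons (to_west c) _ ++ _ => vvq low; have /validS[vv g] := vvq.
have low' (a1 b1 : int) : (a1, b1) \in visited v -> (-1 <= a1)%R /\ (a1 = -1 -> (0 <= b1)%R).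
  by move=> h; apply: low; rewrite visited_rcons h.
have nv b1 : (b1 < (rows c)%:Z)%R -> (-1, b1) \notin visited v by apply: IHr.
have sub_v s : s \in visited (to_west c) -> s \in visited v.
  by move=> h; rewrite visited_cat visited_rcons h.
have pos_v : (0, (rows c)%:Z) \in visited v by apply: sub_v; rewrite -lw last_visited.
rewrite visited_rcons negb_or nv //=; apply/negP => /eqP[ea eb].
rewrite -{}ea -{}eb {a' b'} in vvq low g.
have [_ /(_ erefl) b0] : (-1 <= -1 :> int)%R /\ (-1 = -1 :> int -> (0 <= b)%R).
  by apply: low; rewrite visited_rcons eqxx orbT.
case lv: (last 0 v) => [x y].
have xy_r : (x, y) \in (-1, (rows c)%:Z + 1) :: r by rewrite -lv /v last_cat /= mem_last.
have xy_v : (x, y) \in visited v by rewrite -lv last_visited.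
have fresh s : s \in visited (rcons (to_west c) (-1, (rows c)%:Z)) -> s != (x, y).
  move=> s_w; apply/eqP => e; have := valid_uniq vv.
  rewrite /visited /v -cat_cons cat_uniq => /and3P[_ /hasPn/(_ _ xy_r)/=+ _].
  by rewrite -e -/(visited _) s_w.
have := low' _ _ xy_v.
have [] := good_adjacent g lv; move=> [ea eb].
- by move=> _; have := nv y; rewrite -ea in xy_v; rewrite xy_v; lia.
- move=> _; have [yT|yT] := eqVneq y (rows c)%:Z.
    have := fresh (-1, (rows c)%:Z); rewrite visited_rcons eqxx orbT siteE.
    by move/(_ isT); lia.
  by have := nv y; rewrite -ea in xy_v; rewrite xy_v; lia.
- lia.
(* The column would be entered from [(0, b)], at a height already crossed by the coded walk. That
   site is below the top and has [(-1, rows c)] to its west, so it would have to be on the east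
   side; then the coded walk met this height in column 0, at the very same site. *)
- move=> _; have x0 : x = 0 by lia.
  have yb : y = b by lia.
  case: (valid_ends vv lv) => h.
  + by have := h _ _ pos_v; lia.
  + have T_c : (0, 0) \in visited (walk_of c) by exact: mem_origin.
    have [a a_c] : exists a, (a, b) \in visited (walk_of c).
      have := last_walk_of c; have := pos_row rc; case: (pos c) => px py /= -> lc.
      have p_c : (px, (rows c)%:Z) \in visited (walk_of c) by rewrite -lc last_visited.
      by apply: (walk_level (valid_walk vc) T_c p_c); lia.
    have a_t : (a, b) \in visited (to_west c) by rewrite visited_cat a_c.
    have := h _ _ (sub_v _ a_t); have := mw _ _ a_t => ha ha'.
    have := fresh (a, b); rewrite visited_rcons a_t => /(_ isT).
    by rewrite siteE; lia.
  + have : (-1, (rows c)%:Z) \in visited v by rewrite visited_cat visited_rcons eqxx orbT.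
    by move/h; lia.
Qed.

Lemma classifyC (w : walk) : valid (rcons w (-1, 0)) -> last 0 w = (-1, 1) ->
  exists c, [/\ admissible c, on_row c & rcons w (-1, 0) = polyC c].
Proof.
move=> vwq lw; have /validS[vw g] := vwq.
have last_w : (-1, 1) \in visited w by rewrite -lw last_visited.
have low (a b : int) : (a, b) \in visited w -> a = -1 -> (1 <= b)%R.
  by move=> ab ea; have := good_free g lw ab; rewrite /ahead /=; lia.
(* The endpoint is below [(-1, 1)] and west of the origin, so it must be on the west side. *)
have west (a b : int) : (a, b) \in visited w -> (-1 <= a)%R.
  case: (good_ends g) => h; last exact: h.
    by have := h _ _ last_w; lia.
  by have := h _ _ (mem_origin w); lia.
have [|u [y [r [w_def lu u_ge hu]]]] := crossing vw.
  by exists (-1) => //; exists 1.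
have y1 : (1 <= y)%R.
  by apply: (low (-1)) => //; rewrite w_def visited_cat mem_head orbT.
case: hu => [[k u_def]|[c [adm rc y_def u_def]]].
  by move: lu y1; rewrite u_def last_run /= => -[*]; lia.
exists c; split=> //.
have [vc box _ _] := walk_of_fits adm; have mw := mem_to_west adm rc.
have lt := last_to_west adm rc; have T0 := rows_gt0 rc.
set base := rcons (to_west c) (-1, (rows c)%:Z).
have {w_def} w_def : rcons w (-1, 0) = base ++ rcons r (-1, 0).
  by rewrite w_def u_def y_def /base cat_rcons rcons_cat.
have vis (a b : int) : (a, b) \in visited (rcons w (-1, 0)) -> (-1 <= a)%R /\ (a = -1 -> (0 <= b)%R).
  rewrite visited_rcons siteE => /orP[ab|]; last lia.
  by split; [exact: west ab | move=> /(low _ _ ab); lia].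
have level (b : int) : (0 <= b <= (rows c)%:Z)%R -> exists2 a : int, (0 <= a)%R & (a, b) \in visited base.
  move=> hb; have := last_walk_of c; have := pos_row rc; case: (pos c) => px py /= -> lc.
  have p_c : (px, (rows c)%:Z) \in visited (walk_of c) by rewrite -lc last_visited.
  have [a a_c] := walk_level (valid_walk vc) (mem_origin _) p_c hb.
  exists a; first by have := box _ _ a_c; lia.
  by rewrite visited_rcons visited_cat a_c.
have last_base : last 0 base = (-1, (rows c)%:Z) by rewrite last_rcons.
(* The descent is forced: a first step north is excluded by [no_return], a later one would go back,
   a step east would face the coded walk at that height, and a step west would leave the box found
   above. *)
have down i : (i <= rows c)%N ->
    exists r', rcons w (-1, 0) = base ++ run 0 (-1) (-1, (rows c)%:Z) i ++ r'.
  elim: i => [|i IHi] hi; first by exists (rcons r (-1, 0)).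
  have [|[|q r'] e] := IHi; first exact: ltnW.
    have := last_rcons 0 w (-1, 0); rewrite e cats0 (last_cat_run _ _ _ last_base).
    by move=> -[*]; lia.
  move: vwq vis; rewrite e catA => vwq vis.
  have := valid_catl (u := rcons (base ++ run 0 (-1) (-1, (rows c)%:Z) i) q) (r := r').
  rewrite cat_rcons => /(_ vwq) /validS[_ gq].
  have lb := last_cat_run 0 (-1) i last_base.
  have q_vis : q \in visited ((base ++ run 0 (-1) (-1, (rows c)%:Z) i) ++ q :: r').
    by rewrite visited_cat mem_head orbT.
  have free (a b : int) := good_free (a := a) (b := b) gq lb.
  case: (good_adjacent gq lb) => eq.
  + have [i0|i0] := posnP i.
      exfalso; move: e vwq vis; rewrite i0 /= => e vwq vis.
      have := no_return adm rc (erefl _) (r := r'); rewrite -/base.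
      have -> : (-1, (rows c)%:Z + 1) = q by rewrite eq i0; congr pair; lia.
      rewrite cats0 in vwq vis.
      move=> /(_ vwq vis 0); rewrite -[base ++ _]/(base ++ [::] ++ q :: r') -e.
      by rewrite visited_rcons eqxx orbT /=; lia.
    have : (-1, (rows c)%:Z - i%:Z + 1) \in
        visited (base ++ run 0 (-1) (-1, (rows c)%:Z) i).
      have [->|i1] := eqVneq i 1%N.
        by rewrite visited_cat subrK -last_base last_visited.
      by rewrite visited_cat mem_run; apply/orP; right; lia.
    by move/free; rewrite eq /ahead /=; lia.
  + exists r'; rewrite runS -cats1 -!catA /=; congr (_ ++ (_ ++ _ :: _)).
    by rewrite eq; congr pair; lia.
  + have [|a a0 a_b] := level ((rows c)%:Z - i%:Z); first lia.
    have : (a, (rows c)%:Z - i%:Z) \in visited (base ++ run 0 (-1) (-1, (rows c)%:Z) i).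
      by rewrite visited_cat a_b.
    by move/free; rewrite eq /ahead /=; lia.
  + by have [] := vis (-1 + 0 * i%:Z - 1) ((rows c)%:Z + -1 * i%:Z); rewrite -?eq //; lia.
have [//|r' e] := down (rows c).
rewrite e /polyC -/base; case/lastP: r' e => [|r' q] e; first by rewrite cats0.
have := valid_uniq vwq; rewrite /visited e catA -rcons_cat -rcons_cons rcons_uniq.
have -> : q = (-1, 0) by have := last_rcons 0 w (-1, 0); rewrite e catA last_cat last_rcons.
have := last_visited (base ++ run 0 (-1) (-1, (rows c)%:Z) (rows c)).
rewrite (last_cat_run _ _ _ last_base) => h.
move: h; have -> : (-1 + 0 * (rows c)%:Z, (rows c)%:Z + -1 * (rows c)%:Z) = (-1, 0) :> site.
  by congr pair; lia.
by rewrite /visited => h /andP[/negP[]]; rewrite -cat_cons mem_cat h.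
Qed.

Lemma rows0_code c : rows c = 0%N ->
  exists2 ds, c = [seq inl d | d <- ds] & cols c = size ds.
Proof.
elim: c => [|[d|a] c IHc] //=; first by exists [::].
by move=> /IHc[ds -> e]; exists (d :: ds); rewrite //= e.
Qed.

(** Its head tells on which side the walk first leaves column 0, and so separates a walk from its
    reflection. *)
Definition off_axis (w : walk) : walk := [seq p <- w | p.1 != 0].

Lemma off_axis_run k r : off_axis (run 0 (-1) (0, 0) k ++ r) = off_axis r.
Proof.
rewrite /off_axis filter_cat; suff -> : [seq p <- run 0 (-1) (0, 0) k | p.1 != 0] = [::] by [].
by rewrite -(filter_pred0 (run 0 (-1) (0, 0) k)); apply: eq_in_filter => -[a b]; rewrite mem_run /=; lia.
Qed.

Lemma off_axis_mirror w : off_axis (map mirror w) = map mirror (off_axis w).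
Proof. by rewrite /off_axis filter_map; congr map; apply: eq_filter => p /=; rewrite oppr_eq0. Qed.

Lemma confined_top (w : walk) : last 0 w = (1, 1) -> confined (rcons w (0, 1)) ->
  exists2 ds, ds != [::] & rcons w (0, 1) = polyA ds.
Proof.
move=> lw; move E: (rcons w (0, 1)) => v cv.
have lv : last 0 v = (0, 1) by rewrite -E last_rcons.
have no_walk c : admissible c -> on_row c -> v = walk_of c -> (pos c).1 = 0 -> False.
  move=> adm; case: c adm => [|[d|a] c] // adm _ vE [a0].
  have := last_approach adm; move: vE => /=; rewrite -E => /rcons_inj[<- _ _].
  by rewrite lw => -[]; lia.
case: v / cv lv E no_walk => [c k adm rc hk|c k adm rc|c k adm rc hk|c k adm rc hk];
  have lc := last_walk_of c.
- have pc := pos_col rc; case posE: (pos c) lc hk pc => [x y] lc /= hk pc.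
  rewrite (last_cat_run _ _ _ lc) => -[e1 e2].
  have c0 : c = [::] by apply: cols0_nil => //; lia.
  by move: posE hk; rewrite c0 /= => -[_ ye] hk; lia.
- have pc := pos_col rc; case posE: (pos c) lc pc => [x y] lc /= pc.
  rewrite (last_cat_run _ _ _ lc) => -[e1 e2].
  have c0 : c = [::] by apply: cols0_nil => //; lia.
  by move: posE; rewrite c0 /= => -[_ ye]; lia.
- have [px _] := pos_le adm; have pr := pos_row rc.
  case posE: (pos c) lc hk px pr => [x y] lc /= hk px pr.
  rewrite (last_cat_run _ _ _ lc) => -[e1 e2] _ no_walk; exfalso.
  by apply: (no_walk c) => //; [have -> : k = 0%N by lia | rewrite posE /=; lia]; rewrite ?cats0.
have [px _] := pos_le adm; have pr := pos_row rc.
case posE: (pos c) lc hk px pr => [x y] lc /= hk px pr.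
rewrite (last_cat_run _ _ _ lc) => -[e1 e2] _ no_walk.
have [k0|k0] := posnP k.
  exfalso; apply: (no_walk c) => //; first by rewrite k0 cats0.
  by rewrite posE /=; lia.
case: c adm rc posE {lc no_walk hk} px pr => [|[d|a] c] //= adm _ [ax Ty] px pr.
have rc0 : rows c = 0%N by lia.
have [ds c_def sz] := rows0_code rc0; exists ds.
  by apply/eqP => ds0; move: adm; rewrite c_def ds0 /=; lia.
have nrow : ~~ on_row c by rewrite c_def; case: (ds).
have a_def : a = size ds by move: adm; rewrite (negbTE nrow) => /andP[_ /eqP->].
rewrite /polyA /codeA -c_def -a_def /to_west /= -ax -Ty.
by have -> : k = a by lia.
Qed.

Lemma crossing_row c w r (y : int) : admissible c -> on_row c ->
  w = to_west c ++ (-1, y) :: r -> y = (rows c)%:Z ->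
  (0, y) \in visited w /\ (1 <= y)%R.
Proof.
move=> adm rc -> ->; have := last_to_west adm rc => lt.
split; last by have := rows_gt0 rc; lia.
by rewrite visited_cat -lt last_visited.
Qed.

(** Suppose that the walk visits a negative abscissa; then its endpoint must be on the north side.
    The walk and its reflection both cross column 0. A crossing along a top row passes through some
    [(0, y)] with [y >= 1], hence through [(0, 1)], too early; and the initial descent cannot first
    leave the axis on both sides. So the walk is confined. *)
Lemma classifyA (w : walk) : valid (rcons w (0, 1)) -> last 0 w = (1, 1) ->
  exists2 ds, ds != [::] & rcons w (0, 1) = polyA ds.
Proof.
move=> vwq lw; have /validS[vw g] := vwq.
have last_w : (1, 1) \in visited w by rewrite -lw last_visited.
have fresh : (0, 1) \notin visited w.
  by have := valid_uniq vwq; rewrite /visited -rcons_cons rcons_uniq => /andP[].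
have [neg|nneg] := pselect (exists2 a : int, (a < 0)%R & exists b, (a, b) \in visited w).
  exfalso; case: (good_ends g) => h.
  - have axis b : (1 <= b)%R -> (0, b) \in visited w -> False.
      by move=> b1 b_w; case/negP: fresh; have <- : b = 1 by have := h _ _ b_w; lia.
    have [u [y [r [w_def _ _ [[k u_def]|[c [adm rc y_def u_def]]]]]]] := crossing vw neg; last first.
      have wE : w = to_west c ++ (-1, y) :: r by rewrite w_def u_def.
      by have [h1 h2] := crossing_row adm rc wE y_def; apply: axis h2 h1.
    have [|u' [y' [r' [w_def' _ _ hu]]]] := crossing (valid_mirror vw).
      by exists (-1) => //; exists 1; rewrite mem_mirror.
    case: hu => [[k' u_def']|[c [adm rc y_def u_def']]].
      have : off_axis (map mirror w) = (-1, y') :: off_axis r'.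
        by rewrite w_def' u_def' off_axis_run.
      by rewrite off_axis_mirror w_def u_def off_axis_run.
    have wE : map mirror w = to_west c ++ (-1, y') :: r' by rewrite w_def' u_def'.
    have [] := crossing_row adm rc wE y_def.
    by rewrite mem_mirror /mirror /= oppr0 => h1 h2; apply: axis h2 h1.
  - by have := h _ _ last_w; lia.
  - by case: neg => a a0 [b ab]; have := h _ _ ab; lia.
apply: confined_top => //; apply: confined_valid => // a b.
rewrite visited_rcons siteE => /orP[ab|]; last lia.
by rewrite leNgt; apply/negP => ?; apply: nneg; exists a => //; exists b.
Qed.

Lemma confined_bottom (w : walk) : last 0 w = (1, -1) -> confined (rcons w (1, 0)) ->
  exists2 k, (0 < k)%N & rcons w (1, 0) = polyB k.
Proof.
move=> lw; move E: (rcons w (1, 0)) => v cv.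
have lv : last 0 v = (1, 0) by rewrite -E last_rcons.
have col c : admissible c -> ~~ on_row c -> cols c = 1%N -> ((pos c).2 <= 0)%R ->
    exists2 d, c = [:: inl d] & pos c = (1, - d%:Z).
  case: c => [|[d|a] c] //= /andP[adm hd] _ [c0].
  have [rc|rc] := boolP (on_row c).
    by move: hd; rewrite rc /= => /eqP->; have := rows_gt0 rc; lia.
  rewrite (cols0_nil adm rc c0) /= => _; exists d => //.
  by congr pair; lia.
case: v / cv lv E => [c k adm rc hk|c k adm rc|c k adm rc hk|c k adm rc hk];
  have lc := last_walk_of c.
- have pc := pos_col rc; case posE: (pos c) lc hk pc => [x y] lc /= hk pc.
  rewrite (last_cat_run _ _ _ lc) => -[e1 e2].
  have [||d c_def] := col c adm rc; rewrite ?posE /=; try lia.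
  move=> [-> yd] E; have kd : k = d by lia.
  exists d; last by rewrite /polyB c_def yd kd.
  rewrite lt0n; apply/eqP => d0; move: E; rewrite c_def kd d0 cats0 => E.
  have : size (rcons w (1, 0)) = 1%N by rewrite E.
  by rewrite size_rcons => -[/size0nil w0]; move: lw; rewrite w0.
- have pc := pos_col rc; case posE: (pos c) lc pc => [x y] lc /= pc.
  case: k => [|k].
    rewrite cats0 lc => -[x1 y0] E; exfalso.
    have [||d c_def] := col c adm rc; rewrite ?posE /=; try lia.
    move=> [_ yd]; have d0 : d = 0%N by lia.
    have : size (rcons w (1, 0)) = 1%N by rewrite E c_def d0.
    by rewrite size_rcons => -[/size0nil w0]; move: lw; rewrite w0.
  rewrite (last_cat_run _ _ _ lc) runS -rcons_cat => -[e1 e2] /rcons_inj[wE _ _].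
  by move: lw; rewrite wE (last_cat_run _ _ _ lc) => -[*]; lia.
- have pr := pos_row rc; have := rows_gt0 rc.
  case posE: (pos c) lc hk pr => [x y] lc /= hk pr T0.
  by rewrite (last_cat_run _ _ _ lc) => -[*]; lia.
- have pr := pos_row rc; have := rows_gt0 rc.
  case posE: (pos c) lc hk pr => [x y] lc /= hk pr T0.
  by rewrite (last_cat_run _ _ _ lc) => -[*]; lia.
Qed.

(** By prudence of the last step, column 1 is visited only below row 0. So the reflected walk
    crosses the axis below row 0, which happens only from its initial descent: the walk first leaves
    the axis eastwards. *)
Lemma classifyB (w : walk) : valid (rcons w (1, 0)) -> last 0 w = (1, -1) ->
  exists2 k, (0 < k)%N & rcons w (1, 0) = polyB k.
Proof.
move=> vwq lw; have /validS[vw g] := vwq.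
have last_w : (1, -1) \in visited w by rewrite -lw last_visited.
have low (b : int) : (1, b) \in visited w -> (b < 0)%R.
  by move=> ab; have := good_free g lw ab; rewrite /ahead /=; lia.
have [|u' [y' [r' [w_def' _ _ hu]]]] := crossing (valid_mirror vw).
  by exists (-1) => //; exists (-1); rewrite mem_mirror.
have y'0 : (y' < 0)%R.
  apply: low; have : (-1, y') \in visited (map mirror w).
    by rewrite w_def' visited_cat mem_head orbT.
  by rewrite mem_mirror /mirror /= opprK.
case: hu => [[k' u_def']|[c [adm rc y_def u_def']]]; last first.
  by have [_ ] := crossing_row adm rc (erefl _) y_def (r := r'); lia.
have off_w : off_axis w = (1, y') :: map mirror (off_axis r').
  apply: (inv_inj (f := map mirror)); first exact: mapK mirrorK.
  by rewrite -off_axis_mirror w_def' u_def' off_axis_run /= (mapK mirrorK).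
apply: confined_bottom => //; apply: confined_valid => // a b.
rewrite visited_rcons siteE => /orP[ab|]; last lia.
rewrite leNgt; apply/negP => a0.
have [|u [y [r [w_def _ _ hu]]]] := crossing vw; first by exists a => //; exists b.
case: hu => [[k u_def]|[c [adm rc y_def u_def]]].
  by move: off_w; rewrite w_def u_def off_axis_run.
(* A later crossing to the west would leave a site of the axis at height at least 1, and one such in
   the last column, with [0 < cols c]. Then [(1, 0)] is on neither the north nor the east side, and
   the origin keeps it off the west side. *)
have wE : w = to_west c ++ (-1, y) :: r by rewrite w_def u_def.
have [yw y1] := crossing_row adm rc wE y_def.
have [_ _ /(_ rc) [_ [b0 b0_gt b0_c]] _] := walk_of_fits adm.
have R_w : ((cols c)%:Z, b0) \in visited w.
  by rewrite w_def u_def visited_cat visited_cat b0_c.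
have R1 : (0 < cols c)%N.
  rewrite lt0n; apply/eqP => R0; move: off_w; rewrite w_def /off_axis filter_cat.
  suff -> : [seq p <- u | p.1 != 0] = [::] by [].
  rewrite -(filter_pred0 u); apply: eq_in_filter => -[a1 b1]; rewrite u_def => h.
  have h1 : (a1, b1) \in visited (to_west c) by rewrite inE h orbT.
  by have [+ _] := mem_to_west adm rc h1 => /=; lia.
case: (good_ends g) => h.
- by have := h _ _ yw; lia.
- have := h _ _ R_w => R_le; have R_eq : (cols c)%:Z = 1 by lia.
  by have := low b0; rewrite -R_eq => /(_ R_w); lia.
- by have := h _ _ (mem_origin w); lia.
Qed.

(** The endpoint can only be on the west side, so the walk is confined; but a confined walk ending
    in column 0 below row 0 is still in its initial descent and never visits [(1, -1)]. *)
Lemma classifyD (w : walk) : valid (rcons w (0, -1)) -> last 0 w = (1, -1) -> False.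
Proof.
move=> vwq lw; have /validS[vw g] := vwq.
have last_w : (1, -1) \in visited w by rewrite -lw last_visited.
case: (good_ends g) => h.
- by have := h _ _ (mem_origin w); lia.
- by have := h _ _ last_w; lia.
have cv : confined (rcons w (0, -1)).
  apply: confined_valid => // a b; rewrite visited_rcons siteE => /orP[/h//|]; lia.
move E: (rcons w (0, -1)) cv => v cv.
have lv : last 0 v = (0, -1) by rewrite -E last_rcons.
have {last_w E} : (1, -1) \in visited v by rewrite -E visited_rcons last_w.
case: v / cv lv => [c k adm rc hk|c k adm rc|c k adm rc hk|c k adm rc hk];
  have lc := last_walk_of c.
- have pc := pos_col rc; case posE: (pos c) lc pc => [x y] lc /= pc.
  rewrite (last_cat_run _ _ _ lc) => -[e1 e2].
  have [_ box _ _] := walk_of_fits adm.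
  by rewrite visited_cat mem_run => /orP[/box|]; lia.
- have pc := pos_col rc; case posE: (pos c) lc pc => [x y] lc /= pc.
  rewrite (last_cat_run _ _ _ lc) => -[e1 e2].
  have [_ box _ _] := walk_of_fits adm.
  by rewrite visited_cat mem_run => /orP[/box|]; lia.
- have pr := pos_row rc; case posE: (pos c) lc pr => [x y] lc /= pr.
  by rewrite (last_cat_run _ _ _ lc) => -[*]; lia.
- have pr := pos_row rc; case posE: (pos c) lc pr => [x y] lc /= pr.
  by rewrite (last_cat_run _ _ _ lc) => -[*]; lia.
Qed.

Definition basic (w : walk) : Prop :=
  [\/ exists c, [/\ admissible c, on_row c & w = polyC c],
      exists2 ds, ds != [::] & w = polyA ds |
      exists2 k, (0 < k)%N & w = polyB k].

(** Prudence forbids a last step heading towards the origin, so that step starts at a diagonal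
    neighbour of the origin. This leaves eight cases, reflected two by two. *)
Lemma classification w : prudent_polygon w -> three_sided w ->
  basic w \/ basic (map mirror w).
Proof.
move=> [pw sz adj] tw; have vw : valid w by split.
case/lastP: w {pw tw} sz adj vw => [//|w e].
case/lastP: w => [//|w p] _; rewrite last_rcons => adj vw.
have lw : last 0 (rcons w p) = p by rewrite last_rcons.
have /validS[_ g] := vw.
have mvw : valid (rcons (map mirror (rcons w p)) (mirror e)).
  by rewrite -map_rcons; apply: valid_mirror.
have mlw : last 0 (map mirror (rcons w p)) = mirror p by rewrite last_mirror lw.
have np : p != (0, 0).
  apply/eqP => p0; have := valid_uniq vw.
  rewrite /visited -rcons_cons rcons_uniq => /andP[_ /= /andP[]].
  by rewrite mem_rcons p0 mem_head.
case: p g lw mlw np vw mvw => [px py] g lw mlw np vw mvw.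
have nahead := good_free g lw (mem_origin _).
have := good_adjacent g lw; case: e adj g vw mvw nahead => [ex ey] adj g vw mvw nahead.
rewrite map_rcons.
case/adjacentP: adj => /= -[e1 e2] [] [ep1 ep2];
  rewrite ?siteE /ahead /= in np nahead; subst; try lia;
  [have [ex ey] : px = -1 /\ py = -1 by lia | have [ex ey] : px = 1 /\ py = -1 by lia
  |have [ex ey] : px = -1 /\ py = 1 by lia | have [ex ey] : px = 1 /\ py = 1 by lia
  |have [ex ey] : px = -1 /\ py = -1 by lia | have [ex ey] : px = -1 /\ py = 1 by lia
  |have [ex ey] : px = 1 /\ py = -1 by lia | have [ex ey] : px = 1 /\ py = 1 by lia];
  subst px py.
- by case: (classifyD mvw).
- by case: (classifyD vw).
- by right; constructor 2; apply: classifyA.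
- by left; constructor 2; apply: classifyA.
- by right; constructor 3; apply: classifyB.
- by left; constructor 1; apply: classifyC.
- by left; constructor 3; apply: classifyB.
- by right; constructor 1; apply: classifyC.
Qed.

(** * The polygons of each kind *)

Definition polygon3 (w : walk) : Prop :=
  [/\ valid w, (1 < size w)%N & adjacent (last 0 w) 0].

Definition area (w : walk) : nat := absz (shoelace 0 (rcons w 0)).

Lemma shoelace_mirror p w :
  shoelace (mirror p) (map mirror w) = - shoelace p w.
Proof.
rewrite /shoelace; elim: w p => [|q w IHw] p /=; first by rewrite !big_nil oppr0.
by rewrite !big_cons IHw /= opprD mulNr.
Qed.

Lemma area_mirror w : area (map mirror w) = area w.
Proof.
rewrite /area; have -> : rcons (map mirror w) 0 = map mirror (rcons w 0).
  by rewrite map_rcons mirror0.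
by rewrite -{1}mirror0 shoelace_mirror abszN.
Qed.

Lemma polygon3_mirror w : polygon3 w -> polygon3 (map mirror w).
Proof.
case=> vw sw aw; split; [exact: valid_mirror | by rewrite size_map |].
by rewrite last_mirror -mirror0 adjacent_mirror.
Qed.

Lemma polygons3E n w : polygons3 n w <-> polygon3 w /\ area w = n.
Proof.
have ha : polygon3 w -> has_area w (area w).
  case=> -[[ww uw pw] tw] sw aw; exact: polygon_area.
split=> [[[pw sw aw] tw han]|[[[pw tw] sw aw] <-]]; last first.
  by split; [split | | apply: ha; split].
have pgw : polygon3 w by split.
split=> //; apply/card_eq_II.
by apply: card_eq_trans han; rewrite card_eq_sym; apply: ha.
Qed.

Lemma valid_to_west c : admissible c -> on_row c -> valid (to_west c).
Proof.
move=> adm rc; have [vc box /(_ rc) [rowc _] _] := walk_of_fits adm.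
have lc := last_walk_of c; have pr := pos_row rc; rewrite /to_west.
case: (pos c) lc rowc pr => x y lc /= rowc pr.
apply: valid_west => // a b ab; last by have := box _ _ ab; lia.
by move=> e; rewrite (rowc _ _ ab) //; lia.
Qed.

Lemma scan_to_west c : admissible c -> on_row c ->
  foldl scan (0, 0, [::]) (to_west c) = ((cols c)%:Z, (rows c)%:Z, c).
Proof.
move=> adm rc; have [px _] := pos_le adm; have pr := pos_row rc.
rewrite /to_west foldl_cat scan_walk_of //; apply: scan_box => a b.
by case: (pos c) px pr => x y /= px pr; rewrite mem_run; lia.
Qed.

Lemma shoelace_to_west c : admissible c -> on_row c ->
  shoelace 0 (to_west c) = (weight c)%:Z - (rows c)%:Z.
Proof.
move=> adm rc; rewrite /to_west shoelace_cat last_walk_of shoelace_walk_of //.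
have := pos_row rc; case: (pos c) => x y /= ->.
by rewrite shoelace_horiz subrr mulr0 subr0 addr0.
Qed.

Lemma last_polyC c : last 0 (polyC c) = (-1, 0).
Proof.
rewrite /polyC last_cat last_rcons last_run /=.
by congr pair; lia.
Qed.

Lemma polygon3_polyC c : admissible c -> on_row c -> polygon3 (polyC c).
Proof.
move=> adm rc; have T0 := rows_gt0 rc.
have lt := last_to_west adm rc; have mt := mem_to_west adm rc.
have vt := valid_to_west adm rc.
have v1 : valid (rcons (to_west c) (-1, (rows c)%:Z)).
  apply/validS; split=> //; have := good_west lt; rewrite sub0r; apply.
    by move=> a b /mt; lia.
  by left=> a b /mt; lia.
split; last by rewrite last_polyC.
  apply: valid_south => //; first by rewrite last_rcons.
    by move=> a b; rewrite visited_rcons siteE => /orP[/mt|]; lia.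
  by right=> a b; rewrite visited_rcons siteE => /orP[/mt|]; lia.
by rewrite /polyC size_cat size_rcons size_map size_iota; lia.
Qed.

Lemma area_polyC c : admissible c -> on_row c -> area (polyC c) = weight c.
Proof.
move=> adm rc; rewrite /area shoelace_rcons last_polyC /polyC shoelace_cat.
rewrite shoelace_rcons last_rcons shoelace_vert last_to_west // shoelace_to_west //=.
by lia.
Qed.

Lemma decode_polyC c : admissible c -> on_row c -> decode (polyC c) = c.
Proof.
move=> adm rc; rewrite /decode /polyC cat_rcons foldl_cat scan_to_west //.
rewrite scan_box // => a b; rewrite inE siteE mem_run; lia.
Qed.

Lemma admissible_inl ds : admissible [seq inl d | d <- ds].
Proof. by elim: ds => //= d ds ->; case: ds. Qed.

Lemma on_row_inl ds : on_row [seq inl d | d <- ds] = false.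
Proof. by case: ds. Qed.

Lemma cols_inl ds : cols [seq inl d | d <- ds] = size ds.
Proof. by elim: ds => //= d ds ->. Qed.

Lemma rows_inl ds : rows [seq inl d | d <- ds] = 0%N.
Proof. by elim: ds => //= d ds ->. Qed.

Lemma weight_inl ds : weight [seq inl d | d <- ds] = sumn ds.
Proof. by elim: ds => //= d ds ->; rewrite addnC. Qed.

Lemma admissible_codeA ds : admissible (codeA ds).
Proof. by rewrite /= admissible_inl on_row_inl cols_inl eqxx. Qed.

Lemma last_polyA ds : last 0 (polyA ds) = (0, 1).
Proof. by rewrite last_to_west ?admissible_codeA //= rows_inl. Qed.

Lemma pos_codeA ds : pos (codeA ds) = ((size ds)%:Z, 1).
Proof. by rewrite /= rows_inl. Qed.

Lemma polygon3_polyA ds : ds != [::] -> polygon3 (polyA ds).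
Proof.
move=> ds0; split; last by rewrite last_polyA.
  by apply: valid_to_west; rewrite ?admissible_codeA.
rewrite /polyA /to_west size_cat pos_codeA /= size_rcons size_map size_iota.
by case: ds ds0 => //= *; lia.
Qed.

Lemma area_polyA ds : area (polyA ds) = (sumn ds + size ds)%N.
Proof.
rewrite /area shoelace_rcons last_polyA shoelace_to_west ?admissible_codeA //=.
by rewrite weight_inl rows_inl; lia.
Qed.

Lemma decode_polyA ds : decode (polyA ds) = codeA ds.
Proof. by rewrite /decode scan_to_west ?admissible_codeA. Qed.

Lemma last_polyB k : last 0 (polyB k) = (1, 0).
Proof.
rewrite /polyB last_cat last_walk_of /= add0r sub0r last_run /=.
by congr pair; lia.
Qed.

Lemma polygon3_polyB k : (0 < k)%N -> polygon3 (polyB k).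
Proof.
move=> k0; have adm : admissible [:: inl k] by [].
have [vc box _ /(_ isT) [colc _]] := walk_of_fits adm.
split; last by rewrite last_polyB.
  rewrite /polyB; apply: valid_north => //.
  - by rewrite last_walk_of /= add0r sub0r.
  - by move=> a b ab ea; rewrite (colc _ _ ab ea) /=; lia.
  - by left=> a b /box /=; lia.
by rewrite /polyB size_cat /= size_rcons size_map size_iota; lia.
Qed.

Lemma area_polyB k : area (polyB k) = k.
Proof.
have adm : admissible [:: inl k] by [].
rewrite /area shoelace_rcons last_polyB /polyB shoelace_cat last_walk_of.
have -> : pos [:: inl k] = (1, - k%:Z) by rewrite /= add0r sub0r.
rewrite shoelace_vert shoelace_walk_of //=; lia.
Qed.

(* Separates the polygons of [basic] from their mirror images. *)
Definition upright (w : walk) : bool :=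
  [|| (last 0 w == (-1, 0)) && has (fun p => 0 < p.2)%R w,
      (last 0 w == (0, 1)) && has (fun p => 0 < p.1)%R w |
      (last 0 w == (1, 0)) && ~~ has (fun p => 0 < p.2)%R w].

Lemma has_mirror_snd w :
  has (fun p : site => 0 < p.2)%R (map mirror w) = has (fun p => 0 < p.2)%R w.
Proof. by rewrite has_map; apply: eq_has. Qed.

Lemma upright_polyC c : on_row c -> upright (polyC c) && ~~ upright (map mirror (polyC c)).
Proof.
move=> rc; have : has (fun p => 0 < p.2)%R (polyC c).
  apply/hasP; exists (-1, (rows c)%:Z); last by have := rows_gt0 rc => /=; lia.
  by rewrite /polyC mem_cat mem_rcons mem_head.
by rewrite /upright last_mirror has_mirror_snd last_polyC => ->.
Qed.

Lemma upright_polyA ds : ds != [::] ->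
  upright (polyA ds) && ~~ upright (map mirror (polyA ds)).
Proof.
move=> ds0; have adm := admissible_codeA ds.
have h1 : has (fun p => 0 < p.1)%R (polyA ds).
  apply/hasP; exists (pos (codeA ds)); last by rewrite pos_codeA /=; case: (ds) ds0.
  by rewrite /polyA /to_west mem_cat /= mem_rcons mem_head.
have h2 : has (fun p => 0 < p.1)%R (map mirror (polyA ds)) = false.
  apply/hasP => -[_ /mapP[[a b] ab ->]] /=; have := mem_to_west adm isT (a := a) (b := b).
  by rewrite inE ab orbT => /(_ isT); lia.
by rewrite /upright last_mirror last_polyA /= h1 h2.
Qed.

Lemma upright_polyB k : upright (polyB k) && ~~ upright (map mirror (polyB k)).
Proof.
have h : has (fun p => 0 < p.2)%R (polyB k) = false.
  apply/hasP => -[[a b]]; rewrite /polyB mem_cat => /orP[|]; last first.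
    by rewrite mem_run /=; lia.
  have [_ box _ _] := walk_of_fits (c := [:: inl k]) isT => ab /=.
  by have := box a b; rewrite inE ab orbT => /(_ isT) /=; lia.
by rewrite /upright last_mirror has_mirror_snd last_polyB h.
Qed.

(** * Enumeration of codes *)

(* [row_codes_from X R k n] lists the codes of weight [n] with [R] columns whose
   latest symbol is [inr], provided [X m] lists those of weight [m] whose latest
   symbol is not, and [n <= k]. *)
Fixpoint row_codes_from (X : nat -> seq code) (R k n : nat) : seq code :=
  if k is k'.+1 then
    (if (R < n)%N then [seq inr R :: c | c <- X (n - R.+1)%N] else [::]) ++
    flatten [seq [seq inr a :: c | c <- row_codes_from X R k' (n - a.+1)]
            | a <- iota 0 (minn R.+1 n)]
  else [::].

Fixpoint col_codes (R n : nat) : seq code :=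
  if R is R'.+1 then
    flatten [seq [seq inl d :: c | c <- col_codes R' (n - d)] | d <- iota 0 n.+1] ++
    [seq inl 0%N :: c | c <- row_codes_from (col_codes R') R' n n]
  else if n is 0 then [:: [::]] else [::].

Lemma col_codesS R n : col_codes R.+1 n =
  flatten [seq [seq inl d :: c | c <- col_codes R (n - d)] | d <- iota 0 n.+1] ++
  [seq inl 0%N :: c | c <- row_codes_from (col_codes R) R n n].
Proof. by []. Qed.

Definition row_codes (R n : nat) : seq code := row_codes_from (col_codes R) R n n.

Lemma cons_inj (T : Type) (x : T) : injective (cons x).
Proof. by move=> s s' [->]. Qed.

Lemma map_consP (T : eqType) (x y : T) (c : seq T) s :
  (y :: c \in [seq x :: c' | c' <- s]) = (y == x) && (c \in s).
Proof.
apply/mapP/andP => [[c' c's [-> ->]]|[/eqP-> cs]]; first by rewrite eqxx.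
by exists c.
Qed.

Lemma nil_map_cons (T : eqType) (x : T) s : ([::] \in [seq x :: c' | c' <- s]) = false.
Proof. by apply/mapP => -[]. Qed.

Lemma flatten_consP (T : eqType) (f : nat -> T) (g : nat -> seq (seq T)) r y c :
  reflect (exists2 a, a \in r & y = f a /\ c \in g a)
    (y :: c \in flatten [seq [seq f a :: c' | c' <- g a] | a <- r]).
Proof.
apply: (iffP flatten_mapP) => -[a ar].
  by rewrite map_consP => /andP[/eqP-> h]; exists a.
by move=> [-> h]; exists a; rewrite // map_consP eqxx.
Qed.

Lemma uniq_flatten_cons (T : eqType) (f : nat -> T) (g : nat -> seq (seq T)) r :
  injective f -> uniq r -> (forall a, a \in r -> uniq (g a)) ->
  uniq (flatten [seq [seq f a :: c' | c' <- g a] | a <- r]).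
Proof.
move=> f_inj; elim: r => //= a r IHr /andP[ar ur] ug.
rewrite cat_uniq (map_inj_uniq (@cons_inj _ _)) ug ?mem_head //= IHr //; last first.
  by move=> b br; apply: ug; rewrite inE br orbT.
rewrite andbT; apply/hasPn => -[|y c]; first by rewrite nil_map_cons.
case/flatten_consP => b br [-> _]; rewrite map_consP.
by apply/negP => /andP[/eqP/f_inj ba _]; rewrite -ba br in ar.
Qed.

Definition is_row (R n : nat) (c : code) : bool :=
  [&& admissible c, on_row c, cols c == R & weight c == n].

Definition is_col (R n : nat) (c : code) : bool :=
  [&& admissible c, ~~ on_row c, cols c == R & weight c == n].

Lemma mem_row_codes_from X R : (forall n c, (c \in X n) = is_col R n c) ->
  forall k n, (n <= k)%N -> forall c, (c \in row_codes_from X R k n) = is_row R n c.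
Proof.
move=> X_spec; elim=> [|k IHk] n nk c; rewrite [in RHS]/is_row.
  rewrite in_nil; apply/esym/negP => /and4P[_ rc _ /eqP cw].
  by case: c rc cw => [|[d|a] c] //= _; lia.
rewrite /= mem_cat.
case: c => [|s c].
  have -> : ([::] \in (if (R < n)%N then [seq inr R :: c | c <- X (n - R.+1)%N] else [::]))
      = false by case: ifP => _; rewrite ?nil_map_cons.
  by apply/flatten_mapP => -[a _]; rewrite nil_map_cons.
have -> : (s :: c \in (if (R < n)%N then [seq inr R :: c0 | c0 <- X (n - R.+1)%N] else [::]))
    = [&& (R < n)%N, s == inr R & is_col R (n - R.+1) c].
  by case: (R < n)%N; rewrite // map_consP X_spec.
apply/orP/idP => [[/and3P[Rn /eqP->]|]|].
- case/and4P=> adm nr /eqP cR /eqP cw /=; rewrite adm (negbTE nr) cR eqxx /=.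
  by rewrite cw; lia.
- case/flatten_consP => a; rewrite mem_iota add0n => /andP[_ a_lt] [->].
  rewrite IHk; last lia.
  move=> /and4P[adm rc /eqP cR /eqP cw] /=.
  by rewrite adm rc cR eqxx cw /=; lia.
case: s => [d|a]; rewrite /is_row /= ?andbF // => /and3P[/andP[adm hs] cR cw].
move: hs; have [rc|nr] := boolP (on_row c) => hs; last first.
  left; move/eqP: hs cw => ->; rewrite (eqP cR) => cw.
  by rewrite eqxx /is_col adm nr (eqP cR) eqxx /=; lia.
right; apply/flatten_consP; exists a; first by rewrite mem_iota; lia.
split=> //; rewrite IHk; last lia.
by rewrite /is_row adm rc cR /=; lia.
Qed.

Lemma uniq_row_codes_from X R : (forall n c, (c \in X n) = is_col R n c) ->
  (forall n, uniq (X n)) -> forall k n, (n <= k)%N -> uniq (row_codes_from X R k n).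
Proof.
move=> X_spec X_uniq; elim=> [//|k IHk] n nk /=.
rewrite cat_uniq; apply/and3P; split.
- by case: ifP => _ //; rewrite (map_inj_uniq (@cons_inj _ _)).
- apply/hasPn => -[|s c]; first by case: ifP => _; rewrite ?nil_map_cons.
  case/flatten_consP => a; rewrite mem_iota add0n => /andP[_ a_lt] [->].
  rewrite (mem_row_codes_from X_spec); last lia.
  move=> /and4P[_ rc _ _]; case: ifP => _ //.
  by rewrite map_consP X_spec /is_col rc !andbF.
- apply: uniq_flatten_cons => [a b [->]//||a]; first exact: iota_uniq.
  by rewrite mem_iota => h; apply: IHk; lia.
Qed.

Lemma col_codesP R n : uniq (col_codes R n) /\ forall c, (c \in col_codes R n) = is_col R n c.
Proof.
elim: R n => [|R IHR] n.
  split=> [|c]; first by case: n.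
  rewrite [in RHS]/is_col; case: n => [|n] /=.
    rewrite mem_seq1; case: c => [|[d|a] c] //=; last by rewrite andbF.
    by rewrite !andbF.
  rewrite in_nil; case: c => [|[d|a] c] //=; last by rewrite andbF.
  by rewrite !andbF.
have X_spec m c : (c \in col_codes R m) = is_col R m c by case: (IHR m).
have X_uniq m : uniq (col_codes R m) by case: (IHR m).
have F_spec := mem_row_codes_from X_spec (leqnn n).
split.
  rewrite col_codesS cat_uniq; apply/and3P; split.
  - apply: (@uniq_flatten_cons _ inl (fun d => col_codes R (n - d)) (iota 0 n.+1)).
    + by move=> a b [->].
    + exact: iota_uniq.
    + by move=> a _; apply: X_uniq.
  - apply/hasPn => -[|s c]; rewrite ?nil_map_cons // map_consP F_spec.
    case/and3P=> _ _ /andP[rc _]; apply/negP.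
    case/(@flatten_consP _ inl (fun d => col_codes R (n - d)) (iota 0 n.+1)) => d _ [_].
    by rewrite X_spec /is_col rc !andbF.
  - by rewrite (map_inj_uniq (@cons_inj _ _)) (uniq_row_codes_from X_spec X_uniq).
move=> c; rewrite [in RHS]/is_col col_codesS mem_cat.
case: c => [|s c].
  rewrite nil_map_cons orbF; apply/flatten_mapP => -[a _].
  by rewrite nil_map_cons.
rewrite map_consP F_spec; apply/orP/idP => [[]|].
- case/(@flatten_consP _ inl (fun d => col_codes R (n - d)) (iota 0 n.+1)) => d.
  rewrite mem_iota add0n => /andP[_ d_lt] [-> ].
  rewrite X_spec => /and4P[adm nr /eqP cR /eqP cw] /=.
  by rewrite adm (negbTE nr) cR eqxx cw /=; lia.
- case/andP=> /eqP->; move=> /and4P[adm rc /eqP cR /eqP cw] /=.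
  by rewrite adm implybT cR cw addn0 !eqxx.
case: s => [d|a] /=; rewrite ?andbF // => /and3P[/andP[adm hs] cR cw].
have [rc|nr] := boolP (on_row c).
  move: hs cw; rewrite rc /= => /eqP->; rewrite addn0 => cw; right.
  by rewrite eqxx /is_row adm rc cw andbT; lia.
left; apply/(@flatten_consP _ inl (fun d => col_codes R (n - d)) (iota 0 n.+1)).
exists d; first by rewrite mem_iota; lia.
by split=> //; rewrite X_spec /is_col adm nr /=; lia.
Qed.

Lemma row_codesP R n : uniq (row_codes R n) /\ forall c, (c \in row_codes R n) = is_row R n c.
Proof.
have X_spec m c : (c \in col_codes R m) = is_col R m c by case: (col_codesP R m).
have X_uniq m : uniq (col_codes R m) by case: (col_codesP R m).
split; first exact: uniq_row_codes_from.
exact: mem_row_codes_from.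
Qed.

(** The oldest north step of the latest block of north steps is made in the last column and alone
    weighs [cols c + 1]. Hence a given weight bounds the number of columns. *)
Lemma cols_lt_weight c : admissible c -> on_row c -> (cols c < weight c)%N.
Proof.
elim: c => [//|[d|a] c IHc] //= /andP[adm]; have [rc|nr] := boolP (on_row c) => h _.
  by have := IHc adm rc; lia.
by lia.
Qed.

Definition all_row_codes (n : nat) : seq code := flatten [seq row_codes R n | R <- iota 0 n].

Lemma mem_all_row_codes n c :
  (c \in all_row_codes n) = [&& admissible c, on_row c & weight c == n].
Proof.
apply/flatten_mapP/and3P => [[R _]|[adm rc /eqP cw]].
  by have [_ ->] := row_codesP R n; move=> /and4P[].
exists (cols c); first by have := cols_lt_weight adm rc; rewrite mem_iota; lia.
by have [_ ->] := row_codesP (cols c) n; rewrite /is_row adm rc cw !eqxx.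
Qed.

Lemma uniq_all_row_codes n : uniq (all_row_codes n).
Proof.
rewrite /all_row_codes; elim: (iota 0 n) (iota_uniq 0 n) => //= R r IHr /andP[Rr ur].
rewrite cat_uniq IHr // (row_codesP R n).1 andbT; apply/hasPn => c /flatten_mapP[R' R'r].
rewrite (row_codesP R' n).2 (row_codesP R n).2.
move=> /and4P[_ _ /eqP cR' _]; apply/negP => /and4P[_ _ /eqP cR _].
by move: Rr; rewrite -cR cR' R'r.
Qed.

(** The entries are the parts of a composition of [n], each lowered by one. The recursion either
    adds a new first part 1 or increases the first part. *)
Fixpoint compositions (n : nat) : seq (seq nat) :=
  if n is n'.+1 then
    [seq 0%N :: ds | ds <- compositions n'] ++
    pmap (fun ds => if ds is d :: ds' then Some (d.+1 :: ds') else None) (compositions n')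
  else [:: [::]].

Lemma compositionsP n : uniq (compositions n) /\
  forall ds, (ds \in compositions n) = (sumn ds + size ds == n)%N.
Proof.
pose up ds : option (seq nat) := if ds is d :: ds' then Some (d.+1 :: ds') else None.
elim: n => [|n [un IHn]].
  by split=> // -[|d ds] //; rewrite mem_seq1; apply/esym/negP => /eqP /=; lia.
have up_inv : ocancel up (fun ds => if ds is d.+1 :: ds' then d :: ds' else [::]) by case.
have memS ds : (ds \in pmap up (compositions n)) = if ds is d.+1 :: ds' then d :: ds' \in compositions n else false.
  apply/idP/idP; last first.
    by case: ds => [|[|d] ds] // h; rewrite mem_pmap; apply/mapP; exists (d :: ds).
  by rewrite mem_pmap => /mapP[[|d ds'] h] //= [->].
split.
  rewrite /= cat_uniq (map_inj_uniq (@cons_inj _ _)) un /=; apply/andP; split; last first.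
    exact: (pmap_uniq (g := fun ds => if ds is d.+1 :: ds' then d :: ds' else [::])).
  apply/hasPn => ds; rewrite -/up memS; case: ds => [|[|d] ds] // _.
  by rewrite map_consP.
move=> ds; rewrite /= mem_cat -/up memS.
case: ds => [|[|d] ds]; rewrite ?nil_map_cons ?map_consP ?eqxx ?orbF ?IHn //=; lia.
Qed.

Lemma size_compositions n : (0 < n)%N -> size (compositions n) = (2 ^ n.-1)%N.
Proof.
elim: n => [//|[|n] IHn] _ //; rewrite [compositions _]/= size_cat size_map size_pmap.
rewrite -/(compositions n.+1) (eq_in_count (a2 := predT)); last first.
  by move=> [|d ds] //; have [_ ->] := compositionsP n.+1.
by rewrite count_predT IHn // expnS mul2n addnn.
Qed.

(** * The complete list of polygons of given area *)

Definition basic_polygons (n : nat) : seq walk :=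
  [seq polyC c | c <- all_row_codes n] ++
  [seq polyA ds | ds <- compositions n & ds != [::]] ++
  (if (0 < n)%N then [:: polyB n] else [::]).

Lemma basic_polygonsP n w : reflect (basic w /\ area w = n) (w \in basic_polygons n).
Proof.
rewrite !mem_cat; apply: (iffP or3P) => [[]|[[]]].
- case/mapP=> c; rewrite mem_all_row_codes => /and3P[adm rc /eqP <-] ->.
  by split; [constructor 1; exists c | exact: area_polyC].
- case/mapP=> ds; rewrite mem_filter (compositionsP n).2 => /andP[ds0 /eqP <-] ->.
  by split; [constructor 2; exists ds | exact: area_polyA].
- case: ifP => // n0; rewrite mem_seq1 => /eqP ->.
  by split; [constructor 3; exists n | exact: area_polyB].
- move=> [c [adm rc ->]] <-; constructor 1; apply: map_f.
  by rewrite mem_all_row_codes adm rc area_polyC ?eqxx.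
- move=> [ds ds0 ->] <-; constructor 2; apply: map_f.
  by rewrite mem_filter ds0 (compositionsP _).2 area_polyA eqxx.
- by move=> [k k0 ->] <-; constructor 3; rewrite area_polyB k0 mem_head.
Qed.

Lemma uniq_basic_polygons n : uniq (basic_polygons n).
Proof.
rewrite /basic_polygons cat_uniq cat_uniq; apply/and3P; split.
- rewrite map_inj_in_uniq ?uniq_all_row_codes // => c c'.
  rewrite !mem_all_row_codes => /and3P[adm rc _] /and3P[adm' rc' _] e.
  by rewrite -(decode_polyC adm rc) e decode_polyC.
- apply/hasPn => w; rewrite mem_cat => h; apply/negP => /mapP[c _ w_def].
  have := last_polyC c; rewrite -w_def.
  by case/orP: h => [/mapP[ds _ ->]|]; [rewrite last_polyA|
    case: ifP => //; rewrite mem_seq1 => _ /eqP ->; rewrite last_polyB].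
apply/and3P; split.
- rewrite map_inj_uniq ?filter_uniq ?(compositionsP n).1 // => ds ds' e.
  have inl_inj : injective (@inl nat nat) by move=> d d' [->].
  have := decode_polyA ds; rewrite e decode_polyA => -[_ h].
  by apply/esym; apply: (inj_map inl_inj).
- apply/hasPn => w; case: ifP => // _; rewrite mem_seq1 => /eqP->.
  apply/negP => /mapP[ds _ e].
  by have := last_polyA ds; rewrite -e last_polyB.
- by case: ifP.
Qed.

Lemma basic_polygon3 w : basic w -> polygon3 w.
Proof.
case=> [[c [adm rc ->]]|[ds ds0 ->]|[k k0 ->]].
- exact: polygon3_polyC.
- exact: polygon3_polyA.
- exact: polygon3_polyB.
Qed.

Lemma basic_upright w : basic w -> upright w && ~~ upright (map mirror w).
Proof.
case=> [[c [adm rc ->]]|[ds ds0 ->]|[k k0 ->]].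
- exact: upright_polyC.
- exact: upright_polyA.
- exact: upright_polyB.
Qed.

Definition all_polygons (n : nat) : seq walk :=
  basic_polygons n ++ [seq map mirror w | w <- basic_polygons n].

Lemma mem_all_polygons n w : polygons3 n w <-> w \in all_polygons n.
Proof.
rewrite polygons3E mem_cat; split=> [[pw aw]|/orP[/basic_polygonsP[bw aw]|]].
- have [vw sw adj] := pw; have [pr tr] := vw.
  have pgw : prudent_polygon w by [].
  have [bw|bw] := classification pgw tr.
    by apply/orP; left; apply/basic_polygonsP.
  apply/orP; right; rewrite -[w](mapK mirrorK) map_f //.
  by apply/basic_polygonsP; rewrite area_mirror.
- by split=> //; apply: basic_polygon3.
- case/mapP=> w' /basic_polygonsP[bw aw] ->; rewrite area_mirror.
  by split=> //; apply/polygon3_mirror/basic_polygon3.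
Qed.

Lemma uniq_all_polygons n : uniq (all_polygons n).
Proof.
rewrite cat_uniq map_inj_uniq ?uniq_basic_polygons ?andbT /=; last first.
  by apply: inj_map; apply: inv_inj mirrorK.
apply/hasPn => _ /mapP[w /basic_polygonsP[/basic_upright/andP[_ nup] _] ->].
by apply/negP => /basic_polygonsP[/basic_upright/andP[up _] _]; rewrite up in nup.
Qed.

Lemma polygons3_set n : polygons3 n = [set` all_polygons n]%classic.
Proof. by apply/seteqP; split=> w /= /mem_all_polygons. Qed.

Lemma finite_polygons3 n : finite_set (polygons3 n).
Proof. by rewrite polygons3_set; apply: finite_seq. Qed.

Lemma set_fset_seq (T : choiceType) (s : seq T) :
  [set` s]%classic = [set` [fset x in s]%fset]%classic.
Proof. by apply/seteqP; split=> x /=; rewrite inE. Qed.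

Lemma PA3_size n : PA3 n = size (all_polygons n).
Proof.
apply: card_fset_set; rewrite polygons3_set.
rewrite set_fset_seq; apply/card_eq_fsetP; by rewrite card_fseq undup_id ?uniq_all_polygons.
Qed.

(** The summands count [polyC], [polyA] and [polyB]; the factor 2 is the reflection. For positive
    [n] every composition is nonempty, so the filter on [polyA] removes nothing. *)
Lemma PA3_count n : (0 < n)%N ->
  PA3 n = (2 * (size (all_row_codes n) + 2 ^ n.-1 + 1))%N.
Proof.
move=> n0; rewrite PA3_size size_cat size_map addnn -mul2n; congr (2 * _)%N.
rewrite /basic_polygons !size_cat !size_map n0 /= -addnA; congr (_ + (_ + _))%N.
rewrite -size_compositions // size_filter; apply/eqP; rewrite -all_count.
by apply/allP => -[|d ds] //; rewrite (compositionsP n).2 /= => /eqP e; rewrite -e in n0.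
Qed.

(** * Recurrences for the numbers of codes *)

Lemma size_row_codes_from X k R n : size (row_codes_from X R k n) =
  if k is k'.+1 then ((if (R < n)%N then size (X (n - R.+1)%N) else 0) +
    \sum_(a <- iota 0 (minn R.+1 n)) size (row_codes_from X R k' (n - a.+1)))%N
  else 0%N.
Proof.
case: k => [//|k] /=; rewrite size_cat; congr (_ + _)%N.
  by case: ifP; rewrite ?size_map.
rewrite size_flatten /shape -map_comp sumnE big_map; apply: eq_bigr => a _ /=.
by rewrite size_map.
Qed.

Lemma row_codes_from_fuel X R k n : (n <= k)%N ->
  row_codes_from X R k n = row_codes_from X R n n.
Proof.
elim/ltn_ind: n k => -[|n] IHn [|k] //= nk.
congr (_ ++ flatten _); apply/eq_in_map => a; rewrite mem_iota => ha.
by congr map; rewrite !(IHn (n.+1 - a.+1)%N) //; lia.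
Qed.

Lemma size_row_codes R n : size (row_codes R n) =
  ((if (R < n)%N then size (col_codes R (n - R.+1)) else 0) +
    \sum_(0 <= a < R.+1 | (a < n)%N) size (row_codes R (n - a.+1)))%N.
Proof.
rewrite {1}/row_codes size_row_codes_from; case: n => [|n].
  by rewrite big_pred0.
congr (_ + _)%N; rewrite -[minn _ _]subn0 -/(index_iota 0 _).
rewrite (big_nat_widen _ _ R.+1) ?geq_minl // big_nat_cond [RHS]big_nat_cond.
apply: eq_big => a; first by lia.
by move=> ha; rewrite /row_codes row_codes_from_fuel //; lia.
Qed.

(** * Formal power series *)

Section FpsTheory.
Variable R : comNzRingType.
Implicit Types f g h : fps R.

Lemma fcoefB f g n : fcoef (f - g) n = fcoef f n - fcoef g n.
Proof. by rewrite fcoefD fcoefN. Qed.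

Lemma fcoef_sum (I : Type) (r : seq I) (P : pred I) (F : I -> fps R) n :
  fcoef (\sum_(i <- r | P i) F i) n = \sum_(i <- r | P i) fcoef (F i) n.
Proof. exact: (big_morph (fun f => fcoef f n) (fun f g => fcoefD f g n) (fcoef0 R n)). Qed.

Lemma fcoefM0 f g : fcoef (f * g) 0 = fcoef f 0 * fcoef g 0.
Proof. by rewrite fcoefM big_ord1. Qed.

Lemma fcoefXM f n : fcoef (fpsX * f) n = if n is n'.+1 then fcoef f n' else 0.
Proof.
rewrite fcoefM; case: n => [|n]; first by rewrite big_ord1 mul0r.
rewrite 2!big_ord_recl /= mul0r add0r mul1r subn1 big1 ?addr0 // => i _.
by rewrite mul0r.
Qed.

Lemma fcoefXnM f k n : fcoef (fpsX ^+ k * f) n = if (k <= n)%N then fcoef f (n - k) else 0.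
Proof.
elim: k n => [|k IHk] n; first by rewrite expr0 mul1r subn0.
by rewrite exprS -mulrA fcoefXM; case: n => [//|n]; rewrite IHk.
Qed.

Lemma mulXI : injective (fun f : fps R => fpsX * f).
Proof.
move=> f g e; apply: fpsP => n.
by have /(congr1 (fun h => fcoef h n.+1)) := e; rewrite !fcoefXM.
Qed.

Definition fps_lim (S : nat -> fps R) f : Prop :=
  forall n, exists M, forall N, (M <= N)%N -> fcoef (S N) n = fcoef f n.

Lemma fps_lim_unique S f g : fps_lim S f -> fps_lim S g -> f = g.
Proof.
move=> lf lg; apply: fpsP => n; have [M1 h1] := lf n; have [M2 h2] := lg n.
by rewrite -(h1 (maxn M1 M2)) ?leq_maxl // h2 ?leq_maxr.
Qed.

Lemma fps_lim_ext S S' f : (forall N, S N = S' N) -> fps_lim S f -> fps_lim S' f.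
Proof. by move=> e l n; have [M h] := l n; exists M => N /h; rewrite e. Qed.

Lemma fps_lim_const f : fps_lim (fun=> f) f.
Proof. by move=> n; exists 0%N. Qed.

Lemma fps_limD S S' f g : fps_lim S f -> fps_lim S' g ->
  fps_lim (fun N => S N + S' N) (f + g).
Proof.
move=> l l' n; have [M h] := l n; have [M' h'] := l' n; exists (maxn M M') => N.
by rewrite geq_max => /andP[/h e /h' e']; rewrite !fcoefD e e'.
Qed.

Lemma fps_limM c S f : fps_lim S f -> fps_lim (fun N => c * S N) (c * f).
Proof.
move=> l n.
(* A single bound for the finitely many coefficients that enter the product. *)
have [M h] : exists M, forall N, (M <= N)%N -> forall k, (k <= n)%N -> fcoef (S N) k = fcoef f k.
  elim: n => [|n [M h]]; first by have [M h] := l 0%N; exists M => N /h e k; rewrite leqn0 => /eqP->.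
  have [M' h'] := l n.+1; exists (maxn M M') => N; rewrite geq_max => /andP[MN M'N] k.
  by rewrite leq_eqVlt => /predU1P[->|]; [apply: h' | apply: h].
by exists M => N /h e; rewrite !fcoefM; apply: eq_bigr => i _; rewrite e ?leq_subr.
Qed.

Lemma fps_limS S f : fps_lim S f -> fps_lim (fun N => S N.+1) f.
Proof. by move=> l n; have [M h] := l n; exists M => N MN; apply: h; apply: ltnW. Qed.

(* Junk unless [a k] vanishes to order [k]. *)
Definition fps_series (a : nat -> fps R) : fps R :=
  FPS (fun n => fcoef (\sum_(0 <= k < n.+1) a k) n).

Lemma fps_seriesP (a : nat -> fps R) :
  (forall k n, (n < k)%N -> fcoef (a k) n = 0) ->
  fps_lim (fun N => \sum_(0 <= k < N) a k) (fps_series a).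
Proof.
move=> a0 n; exists n.+1 => N nN.
rewrite -[RHS]/(fcoef (\sum_(0 <= k < n.+1) a k) n).
rewrite (big_cat_nat (leq0n _) nN) fcoefD [X in _ + X]fcoef_sum.
rewrite [X in _ + X]big_nat_cond [X in _ + X]big1 ?addr0 // => k; rewrite andbT => /andP[nk _].
exact: a0.
Qed.
End FpsTheory.

(** * Generating functions of the codes and their functional equation *)

Section GeneratingFunction.
Local Notation q := (@fpsX int).

Definition colF (R : nat) : fps int := FPS (fun n => (size (col_codes R n))%:Z).
Definition rowF (R : nat) : fps int := FPS (fun n => (size (row_codes R n))%:Z).

Definition ones : fps int := FPS (fun=> 1).

Lemma ones_inv : ones * (1 - q) = 1.
Proof.
apply: fpsP => n; rewrite mulrBr mulr1 mulrC fcoefB fcoefXM fcoef1.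
by case: n => [|n]; rewrite ?subr0 //= subrr.
Qed.

Lemma colF0 : colF 0 = 1.
Proof. by apply: fpsP => -[|n]. Qed.

Lemma size_col_codesS R n : size (col_codes R.+1 n) =
  (\sum_(d < n.+1) size (col_codes R (n - d)) + size (row_codes R n))%N.
Proof.
rewrite col_codesS size_cat size_map; congr (_ + _)%N.
rewrite size_flatten /shape -map_comp sumnE big_map -(big_mkord xpredT (fun d => size (col_codes R (n - d)))).
by rewrite /index_iota subn0; apply: eq_bigr => d _; rewrite /= size_map.
Qed.

Lemma colFS R : (1 - q) * colF R.+1 = colF R + (1 - q) * rowF R.
Proof.
have -> : colF R.+1 = ones * colF R + rowF R.
  apply: fpsP => n; rewrite fcoefD fcoefM /= size_col_codesS PoszD; congr (_ + _).
  rewrite (big_morph Posz PoszD (erefl _)).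
  by apply: eq_bigr => d _; rewrite mul1r.
by rewrite mulrDr mulrA [(1 - q) * _]mulrC ones_inv mul1r.
Qed.

Lemma rowFE R :
  rowF R = q ^+ R.+1 * colF R + (\sum_(0 <= a < R.+1) q ^+ a.+1) * rowF R.
Proof.
apply: fpsP => n; rewrite fcoefD fcoefXnM mulr_suml fcoef_sum.
rewrite -[LHS]/(Posz (size (row_codes R n))) size_row_codes PoszD.
congr (_ + _); first by case: ifP.
rewrite (big_morph Posz PoszD (erefl _)) big_mkcond.
by apply: eq_bigr => a _; rewrite fcoefXnM; case: ifP.
Qed.

(** Multiplying by [1 - q] sums the geometric factor, and 1 - q - q(1 - q^(R+1)) = 1 - 2q + q^(R+2).
    The powers [q ^+ R] are kept apart because they will shift [u] to [q u]. *)
Lemma rowF_rec R :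
  (1 - 2 * q) * rowF R + q ^+ 2 * (q ^+ R * rowF R) =
  (1 - q) * q * (q ^+ R * colF R).
Proof.
have geo : (\sum_(0 <= a < R.+1) q ^+ a.+1) * (1 - q) = q * (1 - q ^+ R.+1).
  elim: R => [|R IHR]; first by rewrite big_nat1; ring.
  by rewrite big_nat_recr //= mulrDl IHR !exprS; ring.
have e := congr1 (fun f => (1 - q) * f) (rowFE R); rewrite /= in e.
have : (1 - q) * rowF R = (1 - q) * (q ^+ R.+1 * colF R) + q * (1 - q ^+ R.+1) * rowF R.
  by rewrite {1}e mulrDr -geo; ring.
rewrite !exprS => h; have -> : (1 - 2 * q) * rowF R = (1 - q) * rowF R - q * rowF R by ring.
by rewrite h; ring.
Qed.

Lemma rowF_order R n : (n <= R)%N -> fcoef (rowF R) n = 0.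
Proof.
move=> nR /=; apply/eqP; rewrite eqz_nat size_eq0; apply/eqP.
case e: (row_codes R n) => [//|c s]; have [_ h] := row_codesP R n.
have := h c; rewrite e mem_head => /esym/and4P[adm rc /eqP cR /eqP cw].
by have := cols_lt_weight adm rc; lia.
Qed.

(* [W m] and [Y m] are the bivariate series [\sum_R u ^+ R * rowF R] and
   [\sum_R u ^+ R * colF R] at [u = q ^+ m]. *)
Definition W (m : nat) : fps int := fps_series (fun R => q ^+ (m * R) * rowF R).
Definition Y (m : nat) : fps int := fps_series (fun R => q ^+ (m * R) * colF R).

Lemma W_lim m : fps_lim (fun N => \sum_(0 <= R < N) q ^+ (m * R) * rowF R) (W m).
Proof.
apply: fps_seriesP => R n nR; rewrite fcoefXnM; case: ifP => // _.
by apply: rowF_order; lia.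
Qed.

Lemma Y_lim m : fps_lim (fun N => \sum_(0 <= R < N) q ^+ (m.+1 * R) * colF R) (Y m.+1).
Proof.
by apply: fps_seriesP => R n nR; rewrite fcoefXnM; case: ifP => //; lia.
Qed.

(** [rowF_rec] weighted by [q ^+ (m * R)] and summed: its factors [q ^+ R] raise the index from [m]
    to [m.+1]. *)
Lemma W_rec m : (1 - 2 * q) * W m + q ^+ 2 * W m.+1 = (1 - q) * q * Y m.+1.
Proof.
apply: fps_lim_unique (fps_limM ((1 - q) * q) (Y_lim m)).
apply: fps_lim_ext (fps_limD (fps_limM (1 - 2 * q) (W_lim m)) (fps_limM (q ^+ 2) (W_lim m.+1))).
move=> N; rewrite !mulr_sumr -big_split /=; apply: eq_bigr => R _.
have -> : q ^+ (m.+1 * R) = q ^+ (m * R) * q ^+ R by rewrite -exprD mulSn addnC.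
transitivity (q ^+ (m * R) * ((1 - 2 * q) * rowF R + q ^+ 2 * (q ^+ R * rowF R))).
  by ring.
by rewrite rowF_rec; ring.
Qed.

(** [colFS] weighted and summed: the shift of [R] by one costs [q ^+ m.+1], and [colF 0 = 1]
    supplies the constant. *)
Lemma Y_rec m : (1 - q - q ^+ m.+1) * Y m.+1 = (1 - q) * (1 + q ^+ m.+1 * W m.+1).
Proof.
have h : (1 - q) * Y m.+1 =
    (1 - q) + (q ^+ m.+1 * Y m.+1 + (1 - q) * q ^+ m.+1 * W m.+1).
  apply: fps_lim_unique (fps_limM (1 - q) (fps_limS (Y_lim m))) _.
  apply: fps_lim_ext (fps_limD (fps_lim_const (1 - q)) (fps_limD
    (fps_limM (q ^+ m.+1) (Y_lim m)) (fps_limM ((1 - q) * q ^+ m.+1) (W_lim m.+1)))).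
  move=> N; rewrite big_nat_recl //= muln0 expr0 mul1r colF0 mulrDr mulr1; congr (_ + _).
  rewrite !mulr_sumr -big_split /=; apply: eq_bigr => R _.
  transitivity (q ^+ (m.+1 * R) * q ^+ m.+1 * (colF R + (1 - q) * rowF R)).
    by ring.
  by rewrite -colFS mulnS exprD; ring.
rewrite [LHS](_ : _ = (1 - q) * Y m.+1 - q ^+ m.+1 * Y m.+1); last by ring.
by rewrite h; ring.
Qed.

Definition denom (m : nat) : fps int := 1 - q - q ^+ (m + 1).
Definition numer (m : nat) : fps int := 1 - q - q ^+ m + q ^+ (m + 1) - q ^+ (m + 2).

(** [Y] is eliminated between [W_rec] and [Y_rec]; [numer m] arises as denom m - (1-q)^2 q^m. *)
Lemma W_iter m :
  denom m * (1 - 2 * q) * W m = q * (1 - q) ^+ 2 - q ^+ 2 * numer m * W m.+1.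
Proof.
have e := congr1 (fun f => denom m * f) (W_rec m).
have : denom m * (1 - 2 * q) * W m =
    q * (1 - q) * (denom m * Y m.+1) - denom m * q ^+ 2 * W m.+1.
  rewrite /= in e; rewrite [RHS](_ : _ = denom m * ((1 - q) * q * Y m.+1) - denom m * q ^+ 2 * W m.+1).
    by rewrite -e; ring.
  by ring.
move->; rewrite {1}/denom addn1 Y_rec /denom /numer addn1 addn2 !exprS; ring.
Qed.

(** * Solution of the functional equation *)

Lemma unit_fcoef0 (f : fps int) : fcoef f 0 = 1 -> f \is a GRing.unit.
Proof. by move=> e; rewrite fps_unitE e unitr1. Qed.

Lemma fcoef0_qX n : fcoef (q ^+ n.+1) 0 = 0.
Proof. by rewrite exprS fcoefXM. Qed.

Lemma unit_1q : (1 - q) \is a GRing.unit.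
Proof. by apply: unit_fcoef0; rewrite fcoefB fcoef1 /= subr0. Qed.

Lemma unit_12q : (1 - 2 * q) \is a GRing.unit.
Proof. by apply: unit_fcoef0; rewrite fcoefB fcoef1 fcoefM0 /= mulr0 subr0. Qed.

Lemma unit_denom m : denom m \is a GRing.unit.
Proof. by apply: unit_fcoef0; rewrite /denom addn1 !fcoefB fcoef1 fcoef0_qX /= !subr0. Qed.

Definition term (m : nat) : fps int :=
  (-1) ^+ m * q ^+ (2 * m) / ((1 - 2 * q) ^+ m * (1 - q - q ^+ (m + 1)))
  * \prod_(1 <= k < m)
      ((1 - q - q ^+ k + q ^+ (k + 1) - q ^+ (k + 2)) / (1 - q - q ^+ (k + 1))).

(* [(1 - 2 q) * tail m * W m / (1 - q) ^+ 2] is the remainder of the series once the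
   terms of index less than [m] have been summed. *)
Definition tail (m : nat) : fps int :=
  (-1) ^+ m * q ^+ (2 * m).-1 / (1 - 2 * q) ^+ m
  * \prod_(1 <= k < m) (numer k / denom k).

Lemma term_tail m : (0 < m)%N -> q * tail m = term m * denom m.
Proof.
move=> m0; rewrite /term /tail -/(denom m).
have -> : q ^+ (2 * m) = q * q ^+ (2 * m).-1 by rewrite -exprS prednK ?muln_gt0.
rewrite invrM ?unitrX ?unit_12q ?unit_denom //.
set P := \prod_(_ <= _ < _) _.
rewrite [RHS](_ : _ = (-1) ^+ m * (q * q ^+ (2 * m).-1) * ((1 - 2 * q) ^+ m)^-1 * P * ((denom m)^-1 * denom m)).
  by rewrite mulVr ?unit_denom // mulr1; ring.
by ring.
Qed.

Lemma tailS m : (0 < m)%N -> tail m.+1 * (1 - 2 * q) * denom m = - (q ^+ 2 * numer m * tail m).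
Proof.
move=> m0; have e : (2 * m.+1).-1 = (2 * m).-1.+2 by lia.
rewrite /tail e big_nat_recr //= !exprSr invrM ?unitrX ?unit_12q //.
set P := \prod_(_ <= _ < _) _; set A := ((1 - 2 * q) ^+ m)^-1.
rewrite [LHS](_ : _ = (-1) ^+ m * -1 * (q ^+ (2 * m).-1 * q * q) * A * P * numer m
   * ((1 - 2 * q)^-1 * (1 - 2 * q)) * ((denom m)^-1 * denom m)); last by ring.
by rewrite !mulVr ?unit_12q ?unit_denom // expr0 !mulr1; ring.
Qed.

(** This is [W_iter] multiplied by [q * tail m], with the common factors [q] and [denom m]
    cancelled; it makes the partial sums telescope. The series [q] is not invertible, but
    multiplication by it is injective. *)
Lemma term_step m : (0 < m)%N ->
  (1 - q) ^+ 2 * term m = (1 - 2 * q) * tail m * W m - (1 - 2 * q) * tail m.+1 * W m.+1.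
Proof.
move=> m0; apply: (mulIr (unit_denom m)); apply: mulXI => /=.
have h1 := term_tail m0; have h2 := tailS m0; have h3 := W_iter m.
transitivity (q * (1 - q) ^+ 2 * (term m * denom m)); first by ring.
rewrite -h1.
transitivity (q * (tail m * (denom m * (1 - 2 * q) * W m) -
   (tail m.+1 * (1 - 2 * q) * denom m) * W m.+1)); last by ring.
by rewrite h2 h3; ring.
Qed.

(** The remainder at index 1, where [(1 - 2 * q) * tail 1 = - q]. *)
Definition sumS : fps int := - q * W 1 / (1 - q) ^+ 2.

Lemma sum_term M : (0 < M)%N -> (1 - q) ^+ 2 * (\sum_(1 <= m < M) term m) =
  (1 - q) ^+ 2 * sumS - (1 - 2 * q) * tail M * W M.
Proof.
have tail1 : (1 - 2 * q) * tail 1 = - q.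
  rewrite /tail big_geq // expr1 mulr1 mulrCA mulrV ?unit_12q // mulr1.
  by rewrite mulN1r.
have sumSE : (1 - q) ^+ 2 * sumS = - q * W 1.
  by rewrite /sumS mulrCA mulrV ?mulr1 // unitrX // unit_1q.
case: M => // M _; elim: M => [|M IHM].
  by rewrite big_geq // mulr0 sumSE tail1 subrr.
by rewrite big_nat_recr //= mulrDr IHM term_step //; ring.
Qed.

Lemma has_sum_term : fps_has_sum 1 term sumS.
Proof.
have u : (1 - q) ^+ 2 \is a GRing.unit by rewrite unitrX // unit_1q.
suff lim : fps_lim (fun N => \sum_(1 <= m < N) term m) sumS by [].
rewrite -[sumS](mulKr u); apply: (@fps_lim_ext _
   (fun N => ((1 - q) ^+ 2)^-1 * ((1 - q) ^+ 2 * (\sum_(1 <= m < N) term m)))).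
  by move=> N; rewrite mulKr.
(* The remainder is divisible by [q ^+ (2 * N).-1], whose exponent exceeds [n] from [N = n.+2]
   on. *)
apply: fps_limM => n; exists n.+2 => N hN.
rewrite sum_term; last lia.
rewrite fcoefB; suff -> : fcoef ((1 - 2 * q) * tail N * W N) n = 0 by rewrite subr0.
rewrite /tail; set P := \prod_(_ <= _ < _) _.
rewrite [X in fcoef X](_ : _ = q ^+ (2 * N).-1 *
  ((-1) ^+ N / (1 - 2 * q) ^+ N * P * (1 - 2 * q) * W N)); last by ring.
by rewrite fcoefXnM; case: ifP => //; lia.
Qed.

(** * Assembling the generating function *)

Definition pow2 : fps int := FPS (fun n => if n is n'.+1 then (2 ^ n')%:Z else 0).
Definition ones1 : fps int := FPS (fun n => if n is _.+1 then 1 else 0).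

Lemma pow2E : (1 - 2 * q) * pow2 = q.
Proof.
rewrite mulrBl mul1r -mulrA [2 * _]mulrDl mul1r; apply: fpsP => n.
rewrite fcoefB fcoefD fcoefXM; case: n => [|[|n]] //=.
by rewrite expnS mul2n -addnn PoszD subrr.
Qed.

Lemma ones1E : (1 - q) * ones1 = q.
Proof.
rewrite mulrBl mul1r; apply: fpsP => n.
by rewrite fcoefB fcoefXM; case: n => [|[|n]].
Qed.

Lemma fcoef_W0 n : fcoef (W 0) n = (size (all_row_codes n))%:Z.
Proof.
rewrite -[LHS]/(fcoef (\sum_(0 <= R < n.+1) q ^+ (0 * R) * rowF R) n) fcoef_sum.
under eq_bigr do rewrite mul0n expr0 mul1r.
(* The truncated series has one index more than [all_row_codes]; its last term vanishes in degree
   [n]. *)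
rewrite big_nat_recr //= -[Posz (size (row_codes n n))]/(fcoef (rowF n) n) rowF_order //.
rewrite addr0 /all_row_codes size_flatten /shape -map_comp sumnE big_map.
by rewrite (big_morph Posz PoszD (erefl _)) /index_iota subn0.
Qed.

Lemma PA3_gfE : PA3_gf = 2 * (W 0 + pow2 + ones1).
Proof.
rewrite mulrDl mul1r; apply: fpsP => n; rewrite !fcoefD fcoef_W0.
case: n => [//|n]; rewrite -[LHS]/(Posz (PA3 n.+1)) PA3_count //=; lia.
Qed.

(** The rational part of the formula is 2q(1-q)^2/(1-2q)^2 + 2q/(1-2q) + 2q/(1-q): the inhomogeneous
    term of the step from [W 0] to [W 1], then the two simple kinds of polygons. *)
Lemma PA3_gf_formula :
  PA3_gf = - 2 * q ^+ 3 * (1 - q) ^+ 2 / (1 - 2 * q) ^+ 2 * sumS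
    + 2 * q * (3 - 10 * q + 9 * q ^+ 2 - q ^+ 3) / ((1 - 2 * q) ^+ 2 * (1 - q)).
Proof.
have uP : (1 - 2 * q) ^+ 2 \is a GRing.unit by rewrite unitrX // unit_12q.
have uS : (1 - q) ^+ 2 \is a GRing.unit by rewrite unitrX // unit_1q.
have u1 := unit_1q.
(* At index 0, [denom 0 = 1 - 2 * q] yields the square and [numer 0 = - q ^+ 2] the factor
   [q ^+ 4]. *)
have W0 : (1 - 2 * q) ^+ 2 * W 0 = q * (1 - q) ^+ 2 + q ^+ 4 * W 1.
  have := W_iter 0; rewrite /denom /numer !add0n expr0 expr1 => h.
  rewrite [LHS](_ : _ = (1 - q - q) * (1 - 2 * q) * W 0); last by ring.
  by rewrite h; ring.
have sumSE : (1 - q) ^+ 2 * sumS = - q * W 1.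
  by rewrite /sumS mulrCA mulrV ?mulr1.
apply: (mulIr u1); apply: (mulIr uP); rewrite PA3_gfE (invrM uP u1).
set iP := ((1 - 2 * q) ^+ 2)^-1; set i1 := (1 - q)^-1.
have eP : (1 - 2 * q) ^+ 2 * iP = 1 by rewrite mulrV.
have e1 : (1 - q) * i1 = 1 by rewrite mulrV.
transitivity (2 * ((1 - q) * ((1 - 2 * q) ^+ 2 * W 0) +
  (1 - q) * (1 - 2 * q) * ((1 - 2 * q) * pow2) +
  (1 - 2 * q) ^+ 2 * ((1 - q) * ones1))); first by ring.
rewrite W0 pow2E ones1E.
transitivity (- 2 * q ^+ 3 * ((1 - q) ^+ 2 * sumS) * (1 - q) * ((1 - 2 * q) ^+ 2 * iP)
  + 2 * q * (3 - 10 * q + 9 * q ^+ 2 - q ^+ 3) * ((1 - q) * i1) * ((1 - 2 * q) ^+ 2 * iP));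
  last by ring.
by rewrite eP e1 sumSE; ring.
Qed.

End GeneratingFunction.

Theorem theorem1 :
  [/\ forall n : nat, finite_set (polygons3 n),
      exists2 S : fps int,
        fps_has_sum 1 (fun m : nat =>
          let q : fps int := fpsX in
          (-1) ^+ m * q ^+ (2 * m)
            / ((1 - 2 * q) ^+ m * (1 - q - q ^+ (m + 1)))
          * \prod_(1 <= k < m)
              ((1 - q - q ^+ k + q ^+ (k + 1) - q ^+ (k + 2))
                / (1 - q - q ^+ (k + 1)))) S
        & let q : fps int := fpsX in
          PA3_gf =
            - 2 * q ^+ 3 * (1 - q) ^+ 2 / (1 - 2 * q) ^+ 2 * S
            + 2 * q * (3 - 10 * q + 9 * q ^+ 2 - q ^+ 3)
              / ((1 - 2 * q) ^+ 2 * (1 - q))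
    & [seq PA3 n | n <- iota 1 10]
        = [:: 6; 10; 20; 42; 92; 204; 454; 1010; 2242; 4962]%N].
Proof.
split; first exact: finite_polygons3.
  by exists sumS; [exact: has_sum_term | exact: PA3_gf_formula].
(* [PA3] is the cardinality of a set given by a predicate; the list of codes, by contrast, can be
   evaluated. *)
rewrite (eq_in_map _ (fun n => 2 * (size (all_row_codes n) + 2 ^ n.-1 + 1))%N _).1.
  by vm_compute.
by move=> n; rewrite mem_iota => /andP[n0 _]; apply: PA3_count.
Qed.
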